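(* Let $\Omega_0\subset\mathbb C_z\subset\mathbb P^1$ be a bounded domain containing the point $z_0=0$ whose boundary $\partial\Omega_0$ contains a corner point $c$ with interior angle strictly less than $\pi/2$. Let $\omega$ be a semipositive $(1,1)$-form on $\mathbb P^1$ with $\int_{\mathbb P^1}\omega=1$ such that, for some constant $\lambda>0$, on a large ball $B\subset \mathbb C_z$ containing $\overline{\Omega}_0$, $$\omega=\lambda\,\frac{i}{2}(1-\chi_{\Omega_0})\,dz\wedge d\bar z,$$ and such that $\omega$ is extended to all of $\mathbb P^1$ as a smooth K\''ahler form outside this ball (so $\omega$ is smooth and strictly positive on $\mathbb P^1\setminus\overline{\Omega}_0$). Let $\tilde\Phi$ be the envelope (weak solution to the homogeneous Monge-Amp\`ere equation) with background form $\omega$: $$\tilde\Phi:=\sup\Big\{\Psi\in\mathrm{Psh}(\mathbb P^1\times\overline{\mathbb D},\pi_{\mathbb P^1}^*\omega):\ \limsup_{\zeta\to\zeta'}\Psi(\zeta)\le 0\ \text{for all }\zeta'\in\mathbb P^1\times\partial\mathbb D,\ \ \nu_{(z_0,0)}(\Psi)\ge 1\Big\},$$ extended by its boundary value $0$ to $\mathbb P^1\times\partial\mathbb D$. Then $\tilde\Phi$ is not in $\mathcal C^1(\mathbb P^1\times\overline{\mathbb D}^\times)$, i.e. it is not $\mathcal C^1$ up to the boundary $\{|\tau|=1\}$.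
   Context: $\mathbb P^1$ is covered by two copies $\mathbb C_z,\mathbb C_w$ of $\mathbb C$ with coordinates $z$ and $w=1/z$. $\mathbb D$ and $\overline{\mathbb D}$ are the open and closed unit discs in $\mathbb C$, with coordinate $\tau$; $\overline{\mathbb D}^\times=\overline{\mathbb D}\setminus\{0\}$; $\pi_{\mathbb P^1}:\mathbb P^1\times\overline{\mathbb D}\to\mathbb P^1$ is the projection. $\chi_A$ is the characteristic function of $A$. A corner point $c$ with interior angle $\theta$ means that near $c$ the boundary consists of two regular $\mathcal C^1$ arcs ending at $c$ and meeting there with angle $\theta>0$ measured inside $\Omega_0$. Convention: $dd^c=\frac{i}{2\pi}\partial\bar\partial$, so that $dd^c\ln|z|^2=\delta_0$ on $\mathbb C$. $\mathrm{Psh}(\mathbb P^1\times\overline{\mathbb D},\pi_{\mathbb P^1}^*\omega)$ denotes the functions $\Psi$ with values in $[-\infty,\infty)$ on the interior $\mathbb P^1\times\mathbb D$ such that $\Psi+v\circ\pi_{\mathbb P^1}$ is plurisubharmonic wherever locally $\omega=dd^cv$ (here $v$ is a continuous local potential of $\omega$). The condition $\nu_{(z_0,0)}(\Psi)\ge1$ means that for all $c'<1$, $\Psi(z,\tau)\le c'\ln(|z-z_0|^2+|\tau|^2)+O(1)$ for $(z,\tau)$ near $(z_0,0)$. *)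

(* Defs.v *)
From HB Require Import structures.
From mathcomp Require Import all_boot all_order all_algebra.
From mathcomp Require Import all_classical all_reals all_analysis.
From mathcomp.real_closed Require Import complex.

Set Implicit Arguments.
Unset Strict Implicit.
Unset Printing Implicit Defensive.

Import Order.TTheory GRing.Theory Num.Theory.
Import numFieldNormedType.Exports.

Local Open Scope classical_set_scope.
Local Open Scope ring_scope.

(* The complex line is R * R: this type has the real normed module structure
   and the product Lebesgue measure, which R[i] lacks; multiplication, inverse
   and modulus are those of R[i].  The library norm `|x| of R * R is the sup
   norm, so moduli are always written cabs x. *)
Notation plane R := (R * R)%type (only parsing).

Section Plane.
Context {R : realType}.
Implicit Types x y : plane R.

Definition toC x : R[i] := Complex x.1 x.2.
Definition ofC (z : R[i]) : plane R :=
  (complex.Re z, complex.Im z).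

Definition cmul x y : plane R := ofC (toC x * toC y).
Definition cinv x : plane R := ofC (toC x)^-1.
Definition cabs x : R := Normc.normc (toC x).
Definition expi (t : R) : plane R := (cos t, sin t).

Definition leb2 := (@lebesgue_measure R \x @lebesgue_measure R)%E.

Definition eball (b : plane R) (r : R) : set (plane R) :=
  [set x | cabs (x - b) < r].

Definition boundary (A : set (plane R)) : set (plane R) :=
  closure A `\` interior A.

Fixpoint Ck (k : nat) (U : set (plane R)) (f : plane R -> R) : Prop :=
  (forall x, U x -> {for x, continuous f}) /\
  if k is k'.+1 then
    forall v : plane R,
      (forall x, U x -> derivable f x v) /\ Ck k' U (fun x => 'D_v f x)
  else True.

Definition smooth (U : set (plane R)) (f : plane R -> R) : Prop :=
  forall k, Ck k U f.

End Plane.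

Section ProjectiveLine.
Context (R : realType).

(* None is the point z = oo. *)
Definition P1 := option (plane R).

Inductive chart := Cz | Cw.

Definition other (k : chart) : chart := if k is Cz then Cw else Cz.

(* The inverse of the coordinate k. *)
Definition pt (k : chart) (x : plane R) : P1 :=
  match k with
  | Cz => Some x
  | Cw => if x == 0 then None else Some (cinv x)
  end.

(* A real (1,1)-form on P^1 with locally bounded measurable coefficients, given
   in the coordinate x of each chart by dens k x * (i/2) dx /\ d(conj x), where
   (i/2) dx /\ d(conj x) is the Lebesgue measure. *)
Record form11 := Form11 {
  dens : chart -> plane R -> R;
  dens_measurable : forall k,
    measurable_fun (setT : set (measurableTypeR R * measurableTypeR R))
                   (dens k);
  dens_bounded : forall k r, exists M : R, forall x,
    cabs x <= r -> `|dens k x| <= M;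
  dens_glue : forall k x, x != 0 ->
    dens k x = dens (other k) (cinv x) / cabs x ^+ 4
}.

Definition semipositive (w : form11) : Prop := forall k x, 0 <= dens w k x.

Definition smooth_on (w : form11) (E : set P1) : Prop :=
  forall k, smooth (pt k @^-1` E) (dens w k).

Definition positive_on (w : form11) (E : set P1) : Prop :=
  forall k x, E (pt k x) -> 0 < dens w k x.

(* The point at infinity is negligible for a form with bounded coefficients. *)
Definition total_mass (w : form11) : \bar R :=
  (\int[leb2]_(z in setT) (dens w Cz z)%:E)%E.

(* Coefficient of dd^c phi = (i/2pi) d dbar phi on (i/2) dx /\ d(conj x):
   phi_(x, conj x) / pi = Laplacian / (4 pi). *)
Definition ddc (phi : plane R -> R) (x : plane R) : R :=
  ('D_(1, 0) (fun y => 'D_(1, 0) phi y) x +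
   'D_(0, 1) (fun y => 'D_(0, 1) phi y) x) / (4 * pi).

Definition test_function (V : set (plane R)) (phi : plane R -> R) : Prop :=
  smooth setT phi /\
  exists K : set (plane R),
    [/\ compact K, K `<=` V & forall x, ~ K x -> phi x = 0].

(* w = dd^c v on V, in the sense of currents. *)
Definition local_potential (w : form11) (k : chart) (V : set (plane R))
    (v : plane R -> R) : Prop :=
  (forall x, V x -> {for x, continuous v}) /\
  forall phi, test_function V phi ->
    \int[leb2]_(x in V) (v x * ddc phi x) =
    \int[leb2]_(x in V) (phi x * dens w k x).

(* Plurisubharmonic functions on an open subset of C^2 (-oo is allowed). *)
Definition psh (U : set (plane R * plane R)) (u : plane R * plane R -> \bar R)
    : Prop :=
  [/\ forall x, U x -> (u x < +oo)%E,
      forall x (a : R), U x -> (u x < a%:E)%E ->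
        \forall y \near x, (u y < a%:E)%E
    & forall a b : plane R * plane R,
        let line (s : plane R) := (a.1 + cmul s b.1, a.2 + cmul s b.2) in
        (forall s, cabs s <= 1 -> U (line s)) ->
        ((2 * pi)%R%:E * u a <=
           \int[lebesgue_measure]_(t in `[0%R, (2 * pi)%R]) u (line (expi t)))%E].

(* Only the values of Psi over |tau| < 1 matter. *)
Definition omega_psh (w : form11) (Psi : P1 * plane R -> \bar R) : Prop :=
  (forall p tau, cabs tau < 1 -> (Psi (p, tau) < +oo)%E) /\
  forall k (V : set (plane R)) (v : plane R -> R),
    open V -> local_potential w k V v ->
    psh [set y | V y.1 /\ cabs y.2 < 1]
        (fun y => Psi (pt k y.1, y.2) + (v y.1)%:E)%E.

Definition boundary_le0 (Psi : P1 * plane R -> \bar R) : Prop :=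
  forall k (x tau : plane R), cabs tau = 1 ->
    (limf_esup (fun y : plane R * plane R => Psi (pt k y.1, y.2))
       (within [set y | (cabs y.2 < 1)%R] (nbhs (x, tau))) <= 0)%E.

(* lne takes the value -oo at 0, unlike ln. *)
Definition lelong_ge1 (z0 : plane R) (Psi : P1 * plane R -> \bar R) : Prop :=
  forall c' : R, c' < 1 -> exists M : R,
    \forall y \near ((z0, 0) : plane R * plane R),
      (Psi (pt Cz y.1, y.2) <=
         c'%:E * lne (cabs (y.1 - z0) ^+ 2 + cabs y.2 ^+ 2)%R%:E + M%:E)%E.

Definition candidate (w : form11) (z0 : plane R)
    (Psi : P1 * plane R -> \bar R) : Prop :=
  [/\ omega_psh w Psi, boundary_le0 Psi & lelong_ge1 z0 Psi].

(* Meaningful for |tau| <= 1 only. *)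
Definition envelope (w : form11) (z0 : plane R) (y : P1 * plane R) : \bar R :=
  if cabs y.2 < 1
  then ereal_sup [set Psi y | Psi in candidate w z0]
  else 0%E.

(* F is finite on P^1 x {0 < |tau| <= 1}, continuous there, and C^1 on
   P^1 x {0 < |tau| < 1} with all directional derivatives in each chart
   extending continuously to |tau| = 1. *)
Definition C1_up_to_boundary (F : P1 * plane R -> \bar R) : Prop :=
  exists f : P1 * plane R -> R,
    (forall p tau, 0 < cabs tau <= 1 -> F (p, tau) = (f (p, tau))%:E) /\
    forall k,
      let fk (y : plane R * plane R) : R := f (pt k y.1, y.2) in
      let S := [set y : plane R * plane R | 0 < cabs y.2 <= 1] in
      {within S, continuous fk} /\
      forall v : plane R * plane R,
        exists g : plane R * plane R -> R,
          {within S, continuous g} /\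
          forall y : plane R * plane R, 0 < cabs y.2 < 1 -> is_derive y v fk (g y).

End ProjectiveLine.

Section Corner.
Context {R : realType}.

(* A regular C^1 arc on [0, 1]; a map which is C^1 up to the end points is the
   restriction of a C^1 map on the line. *)
Definition regular_arc (g : R -> plane R) : Prop :=
  [/\ forall t : R, derivable g t 1,
      continuous (g^`())%classic,
      forall t : R, 0 <= t <= 1 -> (g^`())%classic t != 0
    & forall s t : R, 0 <= s <= 1 -> 0 <= t <= 1 -> g s = g t -> s = t].

(* Near c the domain lies between the two arcs: it contains the rays of the open
   sector of opening theta from the first tangent to the second, and no ray of
   the complementary open sector. *)
Definition corner_point (Om : set (plane R)) (c : plane R) (theta : R) : Prop :=
  boundary Om c /\ 0 < theta < 2 * pi /\
  exists (g1 g2 : R -> plane R) (alpha : R),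
    [/\ regular_arc g1 /\ regular_arc g2,
        g1 0 = c /\ g2 0 = c,
        \forall x \near c, boundary Om x <->
          (g1 @` `[0, 1] `|` g2 @` `[0, 1]) x,
        (g1^`())%classic 0 = cabs ((g1^`())%classic 0) *: expi alpha /\
        (g2^`())%classic 0 = cabs ((g2^`())%classic 0) *: expi (alpha + theta)
      & (forall s : R, 0 < s < theta ->
           \forall t \near 0^'+, Om (c + t *: expi (alpha + s))) /\
        (forall s : R, theta < s < 2 * pi ->
           \forall t \near 0^'+, ~ Om (c + t *: expi (alpha + s)))].

End Corner.

(* Main.v *)
Require Import Defs.
From mathcomp Require Import all_boot all_order all_algebra.
From mathcomp Require Import all_classical all_reals all_analysis.
From mathcomp Require Import measurable_realfun.
From mathcomp.real_closed Require Import complex.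
From mathcomp Require Import ring lra.
Import Order.TTheory GRing.Theory Num.Theory.
Import numFieldNormedType.Exports.
Local Open Scope classical_set_scope.
Local Open Scope ring_scope.

(** Suppose that the envelope is given by a function f that is C^1 up to
    |tau| = 1, and let G z be the derivative of f in the direction of the real
    part of tau at the point (z, 1).  Since f vanishes for |tau| = 1, the value
    f (z, 1 - eps q) is - eps Re(q) G z + o(eps) (slope_line).  Two incompatible
    facts on G at the corner are proved.

    Upper bound of the envelope.  Over Omega0 the form vanishes, so the envelope
    has the mean value inequality on every disc in Omega0 x D.  On the discs
    s |-> (A + s B, 1 - eps (1 + kap s / 2)) it becomes, after division by eps,
    a mean value inequality for G weighted by 1 + Re(kap s) / 2 (slope_mean).
    The freedom in the unit number kap makes the weighted inequality see first
    order terms: a paraboloid touching G from below can do so only at its vertex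
    (paraboloid_touch), whence |G x - G y| <= K |x - y|^2 locally, and G is
    constant on the connected set Omega0 (supermean_constant).  At z = 0 the pole
    bounds every candidate by the Green function ln |tau|^2 of the disc
    (log_majorant), so G 0 >= 2.  By continuity G c >= 2.

    Lower bound of the envelope.  Near the corner Omega0 lies in a wedge
    |y| < m x with m < 1 (corner_in_wedge: an acute interior angle is exactly what
    makes the half angle smaller than pi / 4).  Hence there is a function Q with
    Q >= delta |z - c|^2 whose opposite is harmonic in that wedge and, elsewhere,
    bends downwards less than omega allows (wedge_fun).  Gluing - Q, plus a
    small multiple of ln |z - c|, with t ln |z|^2 and with a constant gives an
    omega-subharmonic barrier psi <= 0 with a pole of weight t > 0 at 0 and with
    psi >= - Q + eps ln |z - c|^2 + O(eps) near c.  Then psi + (1 - t) ln |tau|^2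
    is a candidate (barrier_envelope_ge); letting eps tend to 0 and z tend to c
    gives f (c, tau) >= (1 - t) ln |tau|^2 (corner_value), that is
    G c <= 2 (1 - t) < 2.

    Checking that the barrier is a candidate against an arbitrary continuous local
    potential v, known only through test functions, takes four steps.  The
    pieces of psi have second order jets from below whose traceless part is
    harmless (jet), and jets are stable under maxima, sums and inversion (jet_max,
    jet_inv).  The mean of v against a smooth radial kernel satisfies a local
    four-point inequality with the constant prescribed by the density of omega
    (smear_submean).  A continuous function with the local four-point inequality
    has the mean value inequality on the closed disc (submean_local_to_global).
    Finally poles are reached as decreasing limits (omega_psh_decreasing_limit). *)

Set Implicit Arguments.
Unset Strict Implicit.
Unset Printing Implicit Defensive.

(** * The plane and integrals over the unit circle *)

Section Basics.
Context {R : realType}.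
Implicit Types x y z h : plane R.

(** The squared modulus: polynomial, hence easier to handle than the modulus. *)
Definition nsq x : R := x.1 ^+ 2 + x.2 ^+ 2.
(** Multiplication by i. *)
Definition irot x : plane R := (- x.2, x.1).

Lemma nsq_ge0 x : 0 <= nsq x.
Proof. by rewrite addr_ge0 ?sqr_ge0. Qed.

Lemma cabsE x : cabs x = Num.sqrt (nsq x).
Proof. by []. Qed.

Lemma cabs_ge0 x : 0 <= cabs x.
Proof. by rewrite cabsE sqrtr_ge0. Qed.

Lemma cabs_sqr x : cabs x ^+ 2 = nsq x.
Proof. by rewrite cabsE sqr_sqrtr// nsq_ge0. Qed.

Lemma cabs_lt x (a : R) : 0 <= a -> (cabs x < a) = (nsq x < a ^+ 2).
Proof. by move=> a0; rewrite -cabs_sqr ltr_pXn2r// nnegrE cabs_ge0. Qed.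

Lemma cabs_le x (a : R) : 0 <= a -> (cabs x <= a) = (nsq x <= a ^+ 2).
Proof. by move=> a0; rewrite -cabs_sqr ler_pXn2r// nnegrE cabs_ge0. Qed.

Lemma cmulE x y : cmul x y = (x.1 * y.1 - x.2 * y.2, x.1 * y.2 + x.2 * y.1).
Proof. by []. Qed.

Lemma cinvE x : cinv x = (x.1 / nsq x, - (x.2 / nsq x)).
Proof. by rewrite /cinv /ofC/= /nsq/=. Qed.

Lemma nsqM x y : nsq (cmul x y) = nsq x * nsq y.
Proof. rewrite cmulE /nsq/=; ring. Qed.

Lemma nsq_expi (t : R) : nsq (expi t) = 1.
Proof. exact: cos2Dsin2. Qed.

Lemma nsq_eq0 x : (nsq x == 0) = (x == 0).
Proof.
case: x => a b; rewrite /nsq/= paddr_eq0 ?sqr_ge0// !sqrf_eq0.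
by apply/andP/eqP => [[/eqP-> /eqP->]|[-> ->]].
Qed.

Lemma nsq_gt0 x : (0 < nsq x) = (x != 0).
Proof. by rewrite lt_neqAle nsq_ge0 andbT eq_sym nsq_eq0. Qed.

Lemma norm_fst x : `|x.1| <= `|x|.
Proof. by rewrite prod_normE le_max lexx. Qed.

Lemma norm_snd x : `|x.2| <= `|x|.
Proof. by rewrite prod_normE le_max lexx orbT. Qed.

Lemma nsq_le_norm x : nsq x <= 2 * `|x| ^+ 2.
Proof.
rewrite /nsq mulr_natl mulr2n; apply: lerD; rewrite -[_ ^+ 2]real_normK ?num_real//;
  rewrite ler_pXn2r ?nnegrE//; [exact: norm_fst|exact: norm_snd].
Qed.

Lemma norm_le_nsq x : `|x| ^+ 2 <= nsq x.
Proof.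
rewrite prod_normE /Order.max; case: ifPn => _; rewrite real_normK ?num_real// /nsq.
  by rewrite lerDr sqr_ge0.
by rewrite lerDl sqr_ge0.
Qed.

Lemma fst_continuous : continuous (fun x : plane R => x.1).
Proof. by move=> x; exact: cvg_fst. Qed.

Lemma snd_continuous : continuous (fun x : plane R => x.2).
Proof. by move=> x; exact: cvg_snd. Qed.

Lemma cvg_fst_comp {T} {F : set_system T} {FF : Filter F} (f : T -> plane R) x :
  f @ F --> x -> (fun t => (f t).1) @ F --> x.1.
Proof. by move=> fx; apply: (cvg_comp f (fun y : plane R => y.1) fx); exact: fst_continuous. Qed.

Lemma cvg_snd_comp {T} {F : set_system T} {FF : Filter F} (f : T -> plane R) x :
  f @ F --> x -> (fun t => (f t).2) @ F --> x.2.
Proof. by move=> fx; apply: (cvg_comp f (fun y : plane R => y.2) fx); exact: snd_continuous. Qed.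

Lemma cvg_mkpair {T} {F : set_system T} {FF : Filter F} (f g : T -> R) (a b : R) :
  f @ F --> a -> g @ F --> b -> (fun t => (f t, g t) : plane R) @ F --> ((a, b) : plane R).
Proof. by move=> fa gb; exact: (cvg_pair fa gb). Qed.

Lemma cvg_cmul {T} {F : set_system T} {FF : Filter F} (f g : T -> plane R) x y :
  f @ F --> x -> g @ F --> y -> (fun t => cmul (f t) (g t)) @ F --> cmul x y.
Proof.
move=> fx gy; rewrite cmulE.
have f1 : (fun t => (f t).1) @ F --> x.1 by exact: cvg_fst_comp.
have f2 : (fun t => (f t).2) @ F --> x.2 by exact: cvg_snd_comp.
have g1 : (fun t => (g t).1) @ F --> y.1 by exact: cvg_fst_comp.
have g2 : (fun t => (g t).2) @ F --> y.2 by exact: cvg_snd_comp.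
have c1 : (fun t => (f t).1 * (g t).1 - (f t).2 * (g t).2) @ F --> x.1 * y.1 - x.2 * y.2.
  by apply: cvgB; exact: cvgM.
have c2 : (fun t => (f t).1 * (g t).2 + (f t).2 * (g t).1) @ F --> x.1 * y.2 + x.2 * y.1.
  by apply: cvgD; exact: cvgM.
exact: (cvg_mkpair c1 c2).
Qed.

Lemma cvg_nsq {T} {F : set_system T} {FF : Filter F} (f : T -> plane R) x :
  f @ F --> x -> (fun t => nsq (f t)) @ F --> nsq x.
Proof.
move=> fx; have f1 : (fun t => (f t).1) @ F --> x.1 by exact: cvg_fst_comp.
have f2 : (fun t => (f t).2) @ F --> x.2 by exact: cvg_snd_comp.
by rewrite /nsq; apply: cvgD; rewrite expr2; apply: cvgM.
Qed.

Lemma nsq_continuous : continuous (nsq : plane R -> R).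
Proof. by move=> x; apply: cvg_nsq; exact: cvg_id. Qed.

Lemma expi_continuous : continuous (expi : R -> plane R).
Proof. by move=> t; exact: (cvg_mkpair (@continuous_cos R t) (@continuous_sin R t)). Qed.

Lemma cvg_irot {T} {F : set_system T} {FF : Filter F} (f : T -> plane R) x :
  f @ F --> x -> (fun t => irot (f t)) @ F --> irot x.
Proof.
move=> fx; have f1 : (fun t => (f t).1) @ F --> x.1 by exact: cvg_fst_comp.
have f2 : (fun t => (f t).2) @ F --> x.2 by exact: cvg_snd_comp.
exact: (cvg_mkpair (cvgN f2) f1).
Qed.

Lemma irotM x y : cmul x (irot y) = irot (cmul x y).
Proof. by rewrite !cmulE /irot/=; congr pair; ring. Qed.

Lemma cmulDr x y z : cmul x (y + z) = cmul x y + cmul x z.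
Proof. by rewrite !cmulE; congr pair => /=; ring. Qed.

Lemma cmulDl x y z : cmul (y + z) x = cmul y x + cmul z x.
Proof. by rewrite !cmulE; congr pair => /=; ring. Qed.

Lemma cmulNr x y : cmul x (- y) = - cmul x y.
Proof. by rewrite !cmulE; congr pair => /=; ring. Qed.

Lemma cmul0 x : cmul x 0 = 0.
Proof. by rewrite !cmulE; congr pair => /=; ring. Qed.

Lemma cmulC x y : cmul x y = cmul y x.
Proof. by rewrite !cmulE; congr pair => /=; ring. Qed.

Lemma nsq_irot x : nsq (irot x) = nsq x.
Proof. by rewrite /nsq/=; ring. Qed.

End Basics.

Section CircleIntegral.
Context {R : realType}.
Implicit Types f g : R -> R.

(** The integral of a real function over one period [0, 2 pi]. *)
Definition cint f : R := \int[lebesgue_measure]_(t in `[0%R, (2 * pi)%R]) f t.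

Lemma pi2_gt0 : 0 < 2 * pi :> R.
Proof. by rewrite mulr_gt0// pi_gt0. Qed.

Lemma cint_integrable f : continuous f ->
  (@lebesgue_measure R).-integrable `[0%R, (2 * pi)%R] (EFin \o f).
Proof.
move=> cf; apply: continuous_compact_integrable; first exact: segment_compact.
exact: continuous_subspaceT.
Qed.

Lemma cintD f g : continuous f -> continuous g ->
  cint (fun t => f t + g t) = cint f + cint g.
Proof. by move=> cf cg; rewrite /cint RintegralD//; exact: cint_integrable. Qed.

Lemma cintZ c f : continuous f -> cint (fun t => c * f t) = c * cint f.
Proof. by move=> cf; rewrite /cint RintegralZl//; exact: cint_integrable. Qed.

Lemma cint_cst c : cint (fun=> c) = 2 * pi * c.
Proof.
rewrite /cint Rintegral_cst//=.
have h := lebesgue_measure_itv `[0, 2 * pi :> R]; rewrite /= in h.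
rewrite h lte_fin pi2_gt0 oppr0 adde0/=.
by rewrite mulrC.
Qed.

Lemma le_cint f g : continuous f -> continuous g ->
  (forall t, 0 <= t <= 2 * pi -> f t <= g t) -> cint f <= cint g.
Proof.
move=> cf cg fg; apply: le_Rintegral => //.
- exact: cint_integrable.
- exact: cint_integrable.
Qed.

Lemma cint_EFin f : continuous f ->
  (\int[lebesgue_measure]_(t in `[0%R, (2 * pi)%R]) (f t)%:E)%E = (cint f)%:E.
Proof.
move=> cf; rewrite /cint /Rintegral fineK//.
have := cint_integrable cf; exact: integrable_fin_num.
Qed.

Lemma cint_dist f g (e : R) : continuous f -> continuous g ->
  (forall t, 0 <= t <= 2 * pi -> `|f t - g t| <= e) ->
  `|cint f - cint g| <= 2 * pi * e.
Proof.
move=> cf cg fg; rewrite ler_distl; apply/andP; split.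
- rewrite lerBlDr -cint_cst -cintD//; last by move=> ?; exact: cvg_cst.
  apply: le_cint => //; first by move=> t; apply: cvgD; [exact: cf|exact: cvg_cst].
  by move=> t /fg; rewrite ler_distl => /andP[]; rewrite lerBlDr.
- rewrite -cint_cst -cintD//; last by move=> ?; exact: cvg_cst.
  apply: le_cint => //; first by move=> t; apply: cvgD; [exact: cg|exact: cvg_cst].
  by move=> t /fg; rewrite ler_distl => /andP[].
Qed.

Lemma itv_translate f (a c d : R) : c <= d -> continuous f ->
  (\int[lebesgue_measure]_(t in `[(c + a)%R, (d + a)%R]) (f t)%:E =
   \int[lebesgue_measure]_(t in `[c, d]) (f (t + a)%R)%:E)%E.
Proof.
move=> cd cf.
have dF x : is_derive x (1 : R) (fun t : R => t + a) 1.
  by rewrite -[X in is_derive _ _ _ X]addr0; exact: is_deriveD.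
have F1 : ((fun t : R => t + a)^`() = cst 1)%classic.
  by apply/funext => x; rewrite derive1E derive_val.
rewrite (@integration_by_substitution_increasing R (fun t => t + a) f)//.
- by apply: eq_integral => t _; rewrite F1/= mulr1.
- by move=> x y _ _ xy; rewrite ltrD2r.
- by move=> x _; rewrite F1; exact: cvg_cst.
- by rewrite F1; exact: is_cvg_cst.
- by rewrite F1; exact: is_cvg_cst.
- have cF : continuous (fun t : R => t + a).
    by move=> x; apply: cvgD; [exact: cvg_id|exact: cvg_cst].
  split => [x _|//|//]; first exact: ex_derive.
  + exact: cvg_at_right_filter (cF c).
  + exact: cvg_at_left_filter (cF d).
- exact: continuous_subspaceT.
Qed.

(** The integral over a period does not depend on the origin of angles. *)
Lemma cint_shift f a : 0 <= a <= 2 * pi -> continuous f ->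
  (forall t, f (t + 2 * pi) = f t) -> cint (fun t => f (t + a)) = cint f.
Proof.
move=> /andP[a0 a2] cf per.
have cfs b : continuous (fun t => f (t + b)).
  move=> x; apply: (@continuous_comp _ _ _ (fun t : R => t + b) f); last exact: cf.
  by apply: cvgD; [exact: cvg_id|exact: cvg_cst].
have pi0 := pi2_gt0.
have If c d : (@lebesgue_measure R).-integrable `[c, d] (EFin \o f).
  apply: continuous_compact_integrable; first exact: segment_compact.
  exact: continuous_subspaceT.
have spl c d e : c <= d <= e ->
    \int[lebesgue_measure]_(t in `[c, e]) f t =
     \int[lebesgue_measure]_(t in `[c, d]) f t +
     \int[lebesgue_measure]_(t in `[d, e]) f t.
  move=> /andP[cd de]; rewrite -(Rintegral_itv_obnd_cbnd (r := d)).
    by rewrite -(@Rintegral_itvB _ f (BLeft c) (BRight e) d)// ?bnd_simp// addrC subrK.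
  by apply: integrableS (If d e) => //; apply: subset_itvr; rewrite bnd_simp.
have tr c d b : c <= d -> \int[lebesgue_measure]_(t in `[c + b, d + b]) f t =
    \int[lebesgue_measure]_(t in `[c, d]) f (t + b).
  by move=> cd; rewrite /Rintegral itv_translate.
rewrite /cint -tr ?ltW// add0r (spl a (2 * pi)); last by rewrite a2 lerDl.
rewrite (spl 0 a) ?a0// addrC; congr (_ + _).
rewrite [X in `[X, _]](_ : _ = 0 + 2 * pi) ?add0r// [X in `[_, X]]addrC.
rewrite -{1}[2 * pi]add0r tr//.
by apply: eq_Rintegral => t _; rewrite per.
Qed.

End CircleIntegral.

(** * From local four-point inequalities to the circle mean *)

Section LocalToGlobal.
Context {R : realType}.
Implicit Types (x z h : plane R) (p q u : plane R -> R).

(** The mean of p over the four points x + i^j h is at least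
    p x + m |h|^2 - o(|h|^2), uniformly for x near z.  For a C^2 function this says
    that a quarter of the Laplacian is at least m at z. *)
Definition submean4 p z (m : R) : Prop := forall e, 0 < e ->
  \forall x \near z & h \near (0 : plane R),
    4 * (p x + (m - e) * nsq h) <=
      p (x + h) + p (x - h) + p (x + irot h) + p (x - irot h).

(** The closed unit disc. *)
Definition udisc : set (plane R) := [set z | nsq z <= 1].

Lemma udisc_closed : closed udisc.
Proof.
have -> : udisc = nsq @^-1` [set r | r <= 1] by [].
apply: closed_comp; last exact: closed_le.
by move=> x _; exact: nsq_continuous.
Qed.

Lemma closed_bounded_compact (A : set (plane R)) (M : R) :
  closed A -> (forall x, A x -> `|x| <= M) -> compact A.
Proof.
move=> cA bA.
have cK : compact (`[- M, M]%classic `*` `[- M, M]%classic : set (plane R)).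
  by apply: compact_setX; exact: segment_compact.
apply: (subclosed_compact cA cK) => x /bA xM.
by split; rewrite /= in_itv/= -ler_norml; apply: le_trans xM;
  [exact: norm_fst|exact: norm_snd].
Qed.

Lemma udisc_compact : compact udisc.
Proof.
apply: (@closed_bounded_compact _ 1); first exact: udisc_closed.
move=> x x1; have := norm_le_nsq x => h.
by rewrite -(@ler_pXn2r _ 2)// ?nnegrE// expr1n (le_trans h).
Qed.

Lemma expi_polar z : nsq z = 1 -> exists2 a : R, 0 <= a <= 2 * pi & z = expi a.
Proof.
case: z => x y; rewrite /nsq/= => xy.
have x1 : -1 <= x <= 1.
  by rewrite -ler_norml -(@ler_pXn2r _ 2) ?nnegrE// real_normK ?num_real// expr1n -xy lerDl sqr_ge0.
have pi0 := @pi_gt0 R.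
have [y0|y0] := leP 0 y.
  exists (acos x); first by rewrite acos_ge0//= (le_trans (acos_lepi _))//; lra.
  rewrite /expi acosK// sin_acos//; congr pair.
  by rewrite (_ : 1 - x ^+ 2 = y ^+ 2) ?sqrtr_sqr ?ger0_norm//; lra.
exists (2 * pi - acos x).
  have := acos_ge0 x1; have := acos_lepi x1; lra.
rewrite /expi; congr pair.
  by rewrite mulr_natl -cosN opprB cosB cos2pi sin2pi acosK// mulr1 mulr0 addr0.
rewrite mulr_natl sinB cos2pi sin2pi mul0r mul1r sub0r sin_acos//.
rewrite (_ : 1 - x ^+ 2 = y ^+ 2) ?sqrtr_sqr ?ltr0_norm ?opprK//; lra.
Qed.

Lemma cvg_circle_point u z t : {for cmul (expi t) z, continuous u} ->
  {for t, continuous (fun t => u (cmul (expi t) z))}.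
Proof.
move=> cu; apply: (@continuous_comp _ _ _ (fun t : R => cmul (expi t) z) u) => //.
by apply: cvg_cmul; [exact: expi_continuous|exact: cvg_cst].
Qed.

Lemma near_segment {I : Type} (F : set_system I) {FF : Filter F} (a b : R)
    (P : I -> R -> Prop) :
  (forall t, a <= t <= b -> \forall t' \near t & i \near F, P i t') ->
  \forall i \near F, forall t, a <= t <= b -> P i t.
Proof.
move=> H; have /compact_near_coveringP := @segment_compact R a b.
move=> /(_ I F P FF) K.
apply: filterS (K _) => [i Pi t tab|t]; first by apply: Pi; rewrite /= in_itv.
by rewrite /= in_itv/=; exact: H.
Qed.

Lemma near0_pick (P : plane R -> Prop) : nbhs (0 : plane R) P ->
  exists2 h : plane R, 0 < nsq h & P h.
Proof.
move/nbhs_ballP => [r /= r0 rP]; exists (r / 2, 0).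
  by rewrite /nsq/= expr0n addr0 exprn_gt0// divr_gt0.
apply: rP; rewrite -ball_normE/= sub0r normrN prod_normE/= normr0 gtr0_norm ?divr_gt0//.
by rewrite gt_max r0 andbT ltr_pdivrMr// ltr_pMr// ltr1n.
Qed.

(** The local four-point inequality at all points of the open disc implies the
    mean value inequality on the circle.  The rotation averages A s of u inherit
    the four-point inequality, are constant on the unit circle and equal 2 pi u 0 at
    the centre; if the conclusion failed, A s + eta |s|^2 would have an interior
    maximum, against the four-point inequality. *)
Lemma submean_local_to_global u :
  (forall s, nsq s <= 1 -> {for s, continuous u}) ->
  (forall s, nsq s < 1 -> submean4 u s 0) ->
  2 * pi * u 0 <= cint (fun t => u (expi t)).
Proof.
move=> cu su; rewrite leNgt; apply/negP => lt0.
have pi0 := pi2_gt0 (R := R).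
have cur s : nsq s <= 1 -> continuous (fun t => u (cmul (expi t) s)).
  by move=> s1 t; apply: cvg_circle_point; apply: cu; rewrite nsqM nsq_expi mul1r.
pose eta := (2 * pi * u 0 - cint (fun t => u (expi t))) / (2 * pi) / 2.
have eta0 : 0 < eta by rewrite !divr_gt0// subr_gt0.
pose A s := cint (fun t => u (cmul (expi t) s)).
pose F s := A s + 2 * pi * eta * nsq s.
(* the averages are continuous up to the circle *)
have cA : {within udisc, continuous A}.
  apply/subspace_continuousP => s0 s0D; apply/cvgrPdist_le => e e0.
  have e0' : 0 < e / (2 * pi) by rewrite divr_gt0.
  have : \forall s \near within udisc (nbhs s0), forall t, 0 <= t <= 2 * pi ->
      `|u (cmul (expi t) s0) - u (cmul (expi t) s)| <= e / (2 * pi).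
    apply: near_segment => t _.
    have H : (fun q : R * plane R => u (cmul (expi q.1) s0) - u (cmul (expi q.1) q.2)) @
        (nbhs t, within udisc (nbhs s0)) --> u (cmul (expi t) s0) - u (cmul (expi t) s0).
      have cut : {for cmul (expi t) s0, continuous u} by apply: cu; rewrite nsqM nsq_expi mul1r.
      apply: cvgB.
        apply: (cvg_comp (fun q : R * plane R => cmul (expi q.1) s0) u _ cut).
        apply: cvg_cmul; last exact: cvg_cst.
        by apply: (cvg_comp fst expi _ (@expi_continuous R t)); exact: cvg_fst.
      apply: (cvg_comp (fun q : R * plane R => cmul (expi q.1) q.2) u _ cut).
      apply: cvg_cmul.
        by apply: (cvg_comp fst expi _ (@expi_continuous R t)); exact: cvg_fst.
      have h : snd @ (nbhs t, within udisc (nbhs s0)) --> within udisc (nbhs s0) by exact: cvg_snd.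
      by apply: cvg_trans h _; exact: cvg_within.
    rewrite subrr in H; move/cvgrPdist_le : H => /(_ _ e0').
    by apply: filterS => q; rewrite sub0r normrN.
  have WU : \forall s \near within udisc (nbhs s0), udisc s.
    by rewrite near_withinE; exact: nearW.
  move=> H; apply: filterS2 WU H => s sU sD.
  have -> : e = 2 * pi * (e / (2 * pi)) by rewrite mulrC divfK// gt_eqF.
  apply: cint_dist; [exact: cur|exact: cur|].
  by move=> t t0; exact: sD.
have cF : {within udisc, continuous F}.
  apply/subspace_continuousP => s sD; apply: cvgD.
    by move/subspace_continuousP : cA; exact.
  by apply: cvgM; [exact: cvg_cst|apply: cvg_nsq; exact: cvg_within].
have [s1 s1D s1max] : exists2 s1 : plane R, nsq s1 <= 1 &
    forall t : plane R, nsq t <= 1 -> F t <= F s1.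
  have [|s1 s1D s1max] := compact_EVT_max _ udisc_compact cF.
    by exists 0; rewrite /udisc/= /nsq/= expr0n addr0.
  exists s1; first by move: s1D; rewrite inE.
  by move=> t t1; apply: s1max; rewrite inE.
have F0 : F 0 = 2 * pi * u 0.
  rewrite /F /A /nsq/= !expr0n/= addr0 mulr0 addr0.
  by under eq_fun do rewrite cmul0; rewrite cint_cst.
have F1 s : nsq s = 1 -> F s < F 0.
  move=> ns1; have [a a02 sa] := expi_polar ns1.
  rewrite F0 /F ns1 mulr1.
  have -> : A s = cint (fun t => u (expi t)).
    rewrite -(cint_shift a02).
    + by congr cint; apply/funext => t; rewrite sa /expi cmulE/= cosD sinD; congr (u _); congr pair; ring.
    + move=> t; have -> : (fun t => u (expi t)) = (fun t => u (cmul (expi t) (1, 0))).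
        by apply/funext => r; rewrite cmulE/=; congr (u _); rewrite !mulr1 !mulr0 subr0 add0r.
      by apply: cur; rewrite /nsq/= expr1n expr0n addr0.
    + by move=> t; rewrite /expi mulr_natl cosD2pi sinD2pi.
  rewrite /eta; set X := 2 * pi * u 0; set Y := cint _.
  have -> : 2 * pi * ((X - Y) / (2 * pi) / 2) = (X - Y) / 2.
    by rewrite mulrC mulrAC divfK// gt_eqF.
  by move: lt0; rewrite -/X -/Y; lra.
have s1lt : nsq s1 < 1.
  rewrite lt_neqAle s1D andbT; apply/eqP => /F1; apply/negP; rewrite -leNgt.
  by apply: s1max; rewrite /nsq/= expr0n addr0.
have e20 : 0 < eta / 2 by rewrite divr_gt0.
(* the four-point inequality holds with the same h for all rotations of s1 *)
have near4 : \forall h \near (0 : plane R), forall t : R, 0 <= t <= 2 * pi ->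
   4 * (u (cmul (expi t) s1) + (0 - eta / 2) * nsq h) <=
   u (cmul (expi t) (s1 + h)) + u (cmul (expi t) (s1 - h)) +
   u (cmul (expi t) (s1 + irot h)) + u (cmul (expi t) (s1 - irot h)).
  pose Q (h : plane R) (t : R) : Prop := is_true (4 * (u (cmul (expi t) s1) + (0 - eta / 2) * nsq h) <=
    u (cmul (expi t) (s1 + h)) + u (cmul (expi t) (s1 - h)) +
    u (cmul (expi t) (s1 + irot h)) + u (cmul (expi t) (s1 - irot h))).
  apply: (@near_segment _ (nbhs (0 : plane R)) _ 0 (2 * pi) Q) => t _.
  have := su (cmul (expi t) s1); rewrite nsqM nsq_expi mul1r => /(_ s1lt) /(_ _ e20) H.
  case: H => -[A1 B1] /= [xA B0] AB.
  have ce : (fun q : R * plane R => expi q.1) @ (nbhs t, nbhs (0 : plane R)) --> expi t.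
    by apply: (cvg_comp fst expi _ (@expi_continuous R t)); exact: cvg_fst.
  have c1 : (fun q : R * plane R => cmul (expi q.1) s1) @ (nbhs t, nbhs (0 : plane R)) -->
      cmul (expi t) s1 by apply: cvg_cmul => //; exact: cvg_cst.
  have c2 : (fun q : R * plane R => cmul (expi q.1) q.2) @ (nbhs t, nbhs (0 : plane R)) -->
      (0 : plane R).
    by rewrite -[X in _ --> X](cmul0 (expi t)); apply: cvg_cmul => //; exact: cvg_snd.
  have D1 : \forall t' \near t & h \near (0 : plane R), A1 (cmul (expi t') s1) := c1 _ xA.
  have D2 : \forall t' \near t & h \near (0 : plane R), B1 (cmul (expi t') h) := c2 _ B0.
  apply: filterS2 D1 D2 => -[t' h] /= At Bh.
  have /= := AB (cmul (expi t') s1, cmul (expi t') h) (conj At Bh).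
  by rewrite /Q nsqM nsq_expi mul1r !cmulDr !cmulNr !irotM.
have near1 : \forall h \near (0 : plane R), nsq (s1 + h) <= 1 /\ nsq (s1 - h) <= 1 /\
   nsq (s1 + irot h) <= 1 /\ nsq (s1 - irot h) <= 1.
  have nn (f : plane R -> plane R) : f h @[h --> (0 : plane R)] --> s1 ->
      \forall h \near (0 : plane R), nsq (f h) <= 1.
    move=> fs; have c : nsq (f h) @[h --> (0 : plane R)] --> nsq s1 by exact: cvg_nsq.
    have H : \forall h \near (0 : plane R), nsq (f h) < 1 by exact: (cvgr_lt _ c).
    by apply: filterS H => h; exact: ltW.
  have cr : irot h @[h --> (0 : plane R)] --> irot (0 : plane R).
    by apply: cvg_irot; exact: cvg_id.
  have r0 : irot (0 : plane R) = 0 by rewrite /irot/= oppr0.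
  have n1 : \forall h \near (0 : plane R), nsq (s1 + h) <= 1.
    apply: nn; rewrite -[X in _ --> X](addr0 s1).
    by apply: cvgD; [exact: cvg_cst|exact: cvg_id].
  have n2 : \forall h \near (0 : plane R), nsq (s1 - h) <= 1.
    apply: nn; rewrite -[X in _ --> X](subr0 s1).
    by apply: cvgB; [exact: cvg_cst|exact: cvg_id].
  have n3 : \forall h \near (0 : plane R), nsq (s1 + irot h) <= 1.
    apply: nn; have e3 : s1 + irot 0 = s1 by rewrite r0 addr0.
    rewrite -[X in _ --> X]e3.
    by apply: cvgD; [exact: cvg_cst|].
  have n4 : \forall h \near (0 : plane R), nsq (s1 - irot h) <= 1.
    apply: nn; have e3 : s1 - irot 0 = s1 by rewrite r0 subr0.
    rewrite -[X in _ --> X]e3.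
    by apply: cvgB; [exact: cvg_cst|].
  by apply: filterS2 (filterI n1 n2) (filterI n3 n4) => h [? ?] [? ?].
have [h [h0 [h1 h4]]] : exists h : plane R, 0 < nsq h /\
  (nsq (s1 + h) <= 1 /\ nsq (s1 - h) <= 1 /\
   nsq (s1 + irot h) <= 1 /\ nsq (s1 - irot h) <= 1) /\ 
  forall t : R, 0 <= t <= 2 * pi ->
   4 * (u (cmul (expi t) s1) + (0 - eta / 2) * nsq h) <=
   u (cmul (expi t) (s1 + h)) + u (cmul (expi t) (s1 - h)) +
   u (cmul (expi t) (s1 + irot h)) + u (cmul (expi t) (s1 - irot h)).
  by have [h h0 [h1 h4]] := near0_pick (filterI near1 near4); exists h.
move: h1 => [p1 [p2 [p3 p4]]].
(* integrating over the rotations *)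
have big : 4 * (A s1 + 2 * pi * ((0 - eta / 2) * nsq h)) <=
   A (s1 + h) + A (s1 - h) + A (s1 + irot h) + A (s1 - irot h).
  have k1 := cur _ s1D; have k2 := cur _ p1; have k3 := cur _ p2.
  have k4 := cur _ p3; have k5 := cur _ p4.
  have ck c : continuous (fun _ : R => c : R) by move=> ?; exact: cvg_cst.
  have cD (f g : R -> R) : continuous f -> continuous g -> continuous (fun t => f t + g t).
    by move=> cf cg t; apply: cvgD; [exact: cf|exact: cg].
  have c1 := cD _ _ k2 k3; have c2 := cD _ _ c1 k4; have c3 := cD _ _ c2 k5.
  have c0 := cD _ _ k1 (ck ((0 - eta / 2) * nsq h)).
  rewrite /A -cint_cst -(cintD k2 k3) -(cintD c1 k4) -(cintD c2 k5) -(cintD k1 (ck _)).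
  rewrite -(cintZ _ c0); apply: le_cint => //.
  by move=> t; apply: cvgM; [exact: cvg_cst|exact: c0].
have m1 := s1max (s1 + h); have m2 := s1max (s1 - h).
have m3 := s1max (s1 + irot h); have m4 := s1max (s1 - irot h).
move: (m1 p1) (m2 p2) (m3 p3) (m4 p4); rewrite /F => {m1 m2 m3 m4} m1 m2 m3 m4.
have Enn : nsq (s1 + h) + nsq (s1 - h) + nsq (s1 + irot h) + nsq (s1 - irot h)
   = 4 * nsq s1 + 4 * nsq h by rewrite /nsq/=; ring.
pose c := 2 * pi * eta; have c0 : 0 < c by rewrite mulr_gt0.
have : c * (nsq (s1 + h) + nsq (s1 - h) + nsq (s1 + irot h) + nsq (s1 - irot h))
   = c * (4 * nsq s1 + 4 * nsq h) by rewrite Enn.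
have chpos : 0 < c * nsq h by rewrite mulr_gt0.
have : 2 * pi * ((0 - eta / 2) * nsq h) = - (c * nsq h) / 2 by rewrite /c; field.
move: m1 m2 m3 m4 big chpos; rewrite -/c => *; lra.
Unshelve. all: by end_near. Qed.

End LocalToGlobal.

(** * Flat functions and their Taylor expansion *)

Section PointwiseDerive.
Context {R : realType} {V : normedModType R}.
Implicit Types (f g : V -> R) (x v : V).

Lemma is_derive_mul f g x v a b : is_derive x v f a -> is_derive x v g b ->
  is_derive x v (fun y => f y * g y) (f x * b + g x * a).
Proof. by move=> df dg; have := is_deriveM df dg. Qed.

Lemma is_derive_add f g x v a b : is_derive x v f a -> is_derive x v g b ->
  is_derive x v (fun y => f y + g y) (a + b).
Proof. by move=> df dg; have := is_deriveD df dg. Qed.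

(** A directional derivative is the derivative along a line. *)
Lemma is_derive_line f x v a :
  is_derive x v f a <-> is_derive (0 : R) (1 : R) (fun t : R => f (x + t *: v)) a.
Proof.
have e : (fun h : R => h^-1 *: ((f \o shift x) (h *: v) - f x)) =
         (fun h : R => h^-1 *: (((fun t : R => f (x + t *: v)) \o shift 0) (h *: 1)
            - f (x + 0 *: v))).
  apply/funext => h /=; rewrite addr0 scale0r addr0.
  by have -> : h *: (1 : R) = h by [exact: mulr1]; rewrite (addrC x).
split=> -[].
  by rewrite /derivable /derive e => h1 h2; constructor.
by rewrite /derivable /derive -e => h1 h2; constructor.
Qed.

Lemma is_derive_comp1 (F : R -> R) f x v a b : is_derive x v f a ->
  is_derive (f x) (1 : R) F b -> is_derive x v (fun y => F (f y)) (b * a).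
Proof.
move=> /is_derive_line df dF; apply/is_derive_line.
have := @is_derive1_comp R F (fun t : R => f (x + t *: v)) 0 b a.
by rewrite scale0r addr0 => h; exact: h.
Qed.

End PointwiseDerive.

Section FlatFunctions.
Context {R : realType}.
Implicit Types (P Q : {poly R}) (x y : R).

(** The functions P(1/x) exp(-1/x) for x > 0, extended by 0: they are closed under
    derivation, which makes them smooth. *)
Definition flat P x : R := if 0 < x then P.[x^-1] * expR (- x^-1) else 0.
(** The polynomial of the derivative of flat P. *)
Definition flatD P : {poly R} := 'X^2 * (P - P^`()).

Lemma horner_expR_bound Q : exists2 M, 0 < M &
  forall y, 0 < y -> `|Q.[y] * expR (- y)| <= M.
Proof.
exists (1 + \sum_(i < size Q) `|Q`_i| * i`!%:R).
  by rewrite ltr_wpDr// sumr_ge0// => i _; rewrite mulr_ge0.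
move=> y y0; rewrite horner_coef mulr_suml (le_trans (ler_norm_sum _ _ _))//.
apply: ler_wpDl => //; apply: ler_sum => i _.
rewrite -mulrA normrM ler_wpM2l// expRN ger0_norm; last first.
  by rewrite divr_ge0 ?expR_ge0// exprn_ge0// ltW.
rewrite ler_pdivrMr ?expR_gt0//.
case: (val i) => [|n].
  by rewrite expr0 fact0 mul1r -[leLHS]expR0 ler_expR ltW.
have := expR_ge1Dxn n (ltW y0) => H.
rewrite -ler_pdivrMl ?ltr0n ?fact_gt0// mulrC (le_trans _ H)// lerDr//.
Qed.

Lemma flat_le0 P x : x <= 0 -> flat P x = 0.
Proof. by rewrite /flat leNgt => /negbTE ->. Qed.

Lemma flat_bound P : exists2 M, 0 < M & forall x, `|flat P x| <= M * `|x| ^+ 2.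
Proof.
have [M M0 MP] := horner_expR_bound ('X^2 * P); exists M => // x.
have [x0|x0] := ltP 0 x; last by rewrite flat_le0// normr0 mulr_ge0// ?exprn_ge0// ltW.
have := MP x^-1; rewrite invr_gt0 => /(_ x0).
rewrite hornerM hornerXn /flat x0 -mulrA normrM => H.
rewrite [`|x|]gtr0_norm// -ler_pdivrMr ?exprn_gt0//; apply: le_trans H.
have i0 : 0 <= x^-1 ^+ 2 by exact: sqr_ge0.
by rewrite [`|x^-1 ^+ 2|]ger0_norm// exprVn mulrC.
Qed.

Lemma is_derive_flat P x : is_derive x (1 : R) (flat P) (flat (flatD P) x).
Proof.
have [x0|x0|->] := ltrgtP x 0.
- rewrite flat_le0; last exact: ltW.
  apply: (@near_eq_is_derive _ _ _ (cst 0)).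
  by near=> y; rewrite flat_le0//; apply: ltW; near: y; exact: lt_nbhsl.
- have xn0 : x != 0 by rewrite gt_eqF.
  have dV : is_derive x (1 : R) (fun y : R => y^-1) (- x ^- 2).
    have := @is_deriveV R id x 1 1 xn0 (is_derive_id _ _).
    by rewrite /GRing.scale/= mulr1.
  have dP : is_derive x (1 : R) (fun y => P.[y^-1] * expR (- y^-1)) (flat (flatD P) x).
    have d1 : is_derive x (1 : R) (fun y => P.[y^-1]) (P^`().[x^-1] * - x ^- 2).
      exact: (@is_derive1_comp R (horner P) (fun y => y^-1)).
    have d2 : is_derive x (1 : R) (fun y => expR (- y^-1)) (expR (- x^-1) * x ^- 2).
      have d3 : is_derive x (1 : R) (fun y : R => - y^-1) (x ^- 2).
        by rewrite -[X in is_derive _ _ _ X]opprK; exact: is_deriveN.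
      exact: (@is_derive1_comp R expR (fun y => - y^-1)).
    apply: is_derive_eq (is_derive_mul d1 d2) _.
    rewrite /flat x0 /flatD !hornerE /GRing.scale/= exprVn; ring.
  apply: near_eq_is_derive dP; near=> y; rewrite /flat.
  by have -> // : 0 < y by near: y; exact: lt_nbhsr.
- rewrite flat_le0//.
  have [M M0 MP] := flat_bound P.
  have c : (fun h : R => h^-1 *: ((flat P \o shift 0) (h *: 1) - flat P 0)) @ 0^' --> 0.
    apply/cvgr0Pnorm_le => e e0; near=> h.
    rewrite /= addr0 [flat P 0]flat_le0// subr0 /GRing.scale/= mulr1.
    have h0 : h != 0 by near: h; exact: nbhs_dnbhs_neq.
    rewrite normrM normfV ler_pdivrMl ?normr_gt0//.
    rewrite (le_trans (MP h))// expr2 mulrCA ler_wpM2l//.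
    rewrite -ler_pdivlMl//; near: h.
    apply: cvg_within; apply: (@cvgr0_norm_le _ _ _ (nbhs (0 : R)) _ id) => //.
    by rewrite mulr_gt0// invr_gt0.
  constructor; first by apply/cvg_ex; exists 0.
  exact/cvg_lim.
Unshelve. all: by end_near. Qed.

Lemma flat_bounded P (a : R) : exists2 M, 0 < M & forall x, x <= a -> `|flat P x| <= M.
Proof.
have [M M0 MP] := flat_bound P; exists (M * a ^+ 2 + 1).
  by rewrite ltr_wpDl// mulr_ge0 ?sqr_ge0// ltW.
move=> x xa; have [x0|x0] := leP x 0.
  by rewrite flat_le0// normr0 addr_ge0// mulr_ge0 ?sqr_ge0// ltW.
rewrite (le_trans (MP x))// ler_wpDr// ler_wpM2l ?(ltW M0)// gtr0_norm//.
have a0 := le_trans (ltW x0) xa.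
by rewrite ler_pXn2r ?nnegrE ?(ltW x0)//.
Qed.

Lemma flat_ge0 x : 0 <= flat 1 x.
Proof. by rewrite /flat; case: ifP => // x0; rewrite hornerC mul1r expR_ge0. Qed.

Lemma flat_gt0 x : 0 < x -> 0 < flat 1 x.
Proof. by move=> x0; rewrite /flat x0 hornerC mul1r expR_gt0. Qed.

Lemma mvt_bound (f df : R -> R) (K x y : R) :
  (forall z, Num.min x y <= z <= Num.max x y -> is_derive z (1 : R) f (df z)) ->
  (forall z, Num.min x y <= z <= Num.max x y -> `|df z| <= K) ->
  `|f y - f x| <= K * `|y - x|.
Proof.
move=> fd.
wlog xy : x y fd / x < y => [wl|].
  case: (boolP (x < y)) => [xy|nxy]; first exact: (wl x y).
  case: (boolP (y < x)) => [yx|nyx].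
    move=> H; rewrite distrC (distrC y); apply: (wl y x) => // z.
      by rewrite minC maxC; exact: fd.
    by rewrite minC maxC; exact: H.
  have -> : x = y by apply/eqP; rewrite eq_le !leNgt nxy nyx.
  by rewrite !subrr normr0 mulr0.
move: fd; rewrite (min_idPl (ltW xy)) (max_idPr (ltW xy)) => fd H.
have cf : {within `[x, y], continuous f}.
  apply: derivable_within_continuous => z; rewrite in_itv/= => zxy.
  by have [] := fd z zxy.
have fo z : z \in `]x, y[ -> is_derive z (1 : R) f (df z).
  by rewrite in_itv/= => /andP[? ?]; apply: fd; rewrite !ltW.
have [c cxy ->] := MVT xy fo cf.
rewrite normrM ler_wpM2r// H//; move: cxy; rewrite in_itv/= => /andP[? ?].
by rewrite !ltW.
Qed.

(** Second order Taylor expansion with a remainder that is uniform on half lines,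
    by applying the mean value inequality three times. *)
Lemma flat_taylor (a : R) (P1 := flatD 1) (P2 := flatD P1) :
  exists2 C, 0 < C & forall q d, q <= a -> q + d <= a ->
  `|flat 1 (q + d) - (flat 1 q + flat P1 q * d + flat P2 q * d ^+ 2 / 2)| <= C * `|d| ^+ 3.
Proof.
have [C C0 HC] := flat_bounded (flatD P2) a; exists C => // q d qa qda.
have dsh P z : is_derive z (1 : R) (fun s => flat P (q + s)) (flat (flatD P) (q + z)).
  rewrite -[X in is_derive _ _ _ X]mulr1.
  have d1 : is_derive z (1 : R) (fun s : R => q + s) 1.
    by apply: is_derive_eq (is_derive_add (is_derive_cst _ _ _) (is_derive_id _ _)) _; rewrite add0r.
  exact: (@is_derive_comp1 _ _ (flat P) _ _ _ _ _ d1 (is_derive_flat _ _)).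
have dl (c z : R) : is_derive z (1 : R) (fun s : R => c * s) c.
  by apply: is_derive_eq (is_derive_mul (is_derive_cst c _ _) (is_derive_id _ _)) _;
    rewrite mulr1 mulr0 addr0.
have bnd z : Num.min 0 d <= z <= Num.max 0 d -> q + z <= a /\ `|z| <= `|d|.
  have [d0|d0] := leP 0 d => /andP[z1 z2].
    by split; [lra|rewrite !ger0_norm//].
  by split; [lra|rewrite !ler0_norm//; lra].
have sub z y : Num.min 0 d <= z <= Num.max 0 d -> Num.min 0 z <= y <= Num.max 0 z ->
    Num.min 0 d <= y <= Num.max 0 d.
  by case: (leP 0 d) => ?; case: (leP 0 z) => ? /andP[? ?] /andP[? ?]; apply/andP; split; lra.
have b2 z : Num.min 0 d <= z <= Num.max 0 d -> `|flat P2 (q + z) - flat P2 q| <= C * `|d|.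
  move=> zd; have := @mvt_bound (fun s => flat P2 (q + s)) _ C 0 z (fun z _ => dsh P2 z).
  rewrite addr0 subr0 => H; apply: le_trans (H _) _.
    by move=> y yz; apply: HC; have [] := bnd _ (sub _ _ zd yz).
  by rewrite ler_wpM2l ?(ltW C0)//; have [] := bnd _ zd.
have b1 z : Num.min 0 d <= z <= Num.max 0 d ->
    `|flat P1 (q + z) - flat P2 q * z - flat P1 q| <= C * `|d| ^+ 2.
  move=> zd.
  have := @mvt_bound (fun s => flat P1 (q + s) + (- flat P2 q) * s)
     (fun s => flat P2 (q + s) + (- flat P2 q)) (C * `|d|) 0 z
     (fun z _ => is_derive_add (dsh P1 z) (dl _ z)).
  rewrite addr0 mulr0 addr0 subr0 mulNr => H; apply: le_trans (H _) _.
    by move=> y yz; apply: b2; exact: sub yz.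
  rewrite expr2 mulrA ler_wpM2l//; last by have [] := bnd _ zd.
  by rewrite mulr_ge0 ?(ltW C0).
have dsq (z : R) : is_derive z (1 : R) (fun s : R => (- (flat P2 q) / 2) * (s * s)) (- (flat P2 q * z)).
  have h : is_derive z (1 : R) (fun s : R => s * s) (z + z).
    by apply: is_derive_eq (is_derive_mul (is_derive_id z (1 : R)) (is_derive_id z (1 : R))) _; rewrite mulr1.
  apply: is_derive_eq (is_derive_mul (is_derive_cst (- (flat P2 q) / 2) _ _) h) _.
  by rewrite /cst mulr0 addr0; field.
have := @mvt_bound (fun s => flat 1 (q + s) + (- flat P1 q) * s + (- (flat P2 q) / 2) * (s * s))
   (fun s => flat P1 (q + s) + (- flat P1 q) + (- (flat P2 q * s))) (C * `|d| ^+ 2) 0 d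
   (fun z _ => is_derive_add (is_derive_add (dsh 1 z) (dl _ z)) (dsq z)).
rewrite subr0 (_ : C * `|d| ^+ 2 * `|d| = C * `|d| ^+ 3); last by ring.
move=> H.
have e : flat 1 (q + d) - (flat 1 q + flat P1 q * d + flat P2 q * d ^+ 2 / 2) =
  flat 1 (q + d) + - flat P1 q * d + - flat P2 q / 2 * (d * d) -
  (flat 1 (q + 0) + - flat P1 q * 0 + - flat P2 q / 2 * (0 * 0)).
  by rewrite addr0; field.
rewrite e; apply: H => z zd; rewrite addrAC; exact: b1.
Qed.

End FlatFunctions.

(** * A smooth radial kernel *)

Section Smooth.
Context {R : realType}.
Implicit Types (f g : plane R -> R) (x y v : plane R).

Lemma is_derive_fst y v : is_derive y v (fun z : plane R => z.1) v.1.
Proof.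
apply/is_derive_line.
apply: is_derive_eq (is_derive_add (is_derive_cst y.1 _ _)
  (is_derive_mul (is_derive_id (0 : R) (1 : R)) (is_derive_cst v.1 _ _))) _.
by rewrite /cst mulr0 mulr1 !add0r.
Qed.

Lemma is_derive_snd y v : is_derive y v (fun z : plane R => z.2) v.2.
Proof.
apply/is_derive_line.
apply: is_derive_eq (is_derive_add (is_derive_cst y.2 _ _)
  (is_derive_mul (is_derive_id (0 : R) (1 : R)) (is_derive_cst v.2 _ _))) _.
by rewrite /cst mulr0 mulr1 !add0r.
Qed.

Lemma CkS k f : Ck k.+1 setT f -> Ck k setT f.
Proof.
elim: k f => [|k IH] f [cf df]; split => // v; have [d1 d2] := df v.
by split => //; exact: IH.
Qed.

Lemma Ck_derive k f (df : plane R -> plane R -> R) :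
  (forall v x, is_derive x v f (df v x)) -> (forall v, Ck k setT (df v)) ->
  (forall x, {for x, continuous f}) -> Ck k.+1 setT f.
Proof.
move=> fd cd cf; split => [x _|v]; first exact: cf.
split => [x _|]; first exact: ex_derive.
rewrite (_ : (fun x => 'D_v f x) = df v)//.
by apply/funext => x; exact: derive_val.
Qed.

Lemma CkD k f g : Ck k setT f -> Ck k setT g -> Ck k setT (fun x => f x + g x).
Proof.
elim: k f g => [|k IH] f g [cf df] [cg dg].
  by split => // x _; apply: cvgD; [exact: cf|exact: cg].
apply: (Ck_derive (df := fun v x => 'D_v f x + 'D_v g x)).
- move=> v x; apply: is_derive_add; apply: DeriveDef => //.
    by have [h _] := df v; exact: h.
  by have [h _] := dg v; exact: h.
- by move=> v; apply: IH; [have [] := df v|have [] := dg v].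
- by move=> x; apply: cvgD; [exact: cf|exact: cg].
Qed.

Lemma CkM k f g : Ck k setT f -> Ck k setT g -> Ck k setT (fun x => f x * g x).
Proof.
elim: k f g => [|k IH] f g Hf Hg; have [cf df] := Hf; have [cg dg] := Hg.
  by split => // x _; apply: cvgM; [exact: cf|exact: cg].
apply: (Ck_derive (df := fun v x => f x * 'D_v g x + g x * 'D_v f x)).
- move=> v x; apply: is_derive_mul; apply: DeriveDef => //.
    by have [h _] := df v; exact: h.
  by have [h _] := dg v; exact: h.
- move=> v; apply: CkD; apply: IH; [exact: CkS|by have [] := dg v|exact: CkS|by have [] := df v].
- by move=> x; apply: cvgM; [exact: cf|exact: cg].
Qed.

Lemma Ck_cst k (a : R) : Ck k setT (fun _ : plane R => a).
Proof.
elim: k a => [|k IH] a; first by split => // x _; exact: cvg_cst.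
apply: (Ck_derive (df := fun _ _ => 0)).
- by move=> v; exact: IH.
- by move=> x; exact: cvg_cst.
Qed.

Lemma Ck_fst k : Ck k setT (fun y : plane R => y.1).
Proof.
case: k => [|k]; first by split=> [x _|]; [exact: (@fst_continuous R x)|exact: I].
apply: (Ck_derive (df := fun v _ => v.1)); last exact: (@fst_continuous R).
- by move=> v x; exact: is_derive_fst.
- by move=> v; exact: Ck_cst.
Qed.

Lemma Ck_snd k : Ck k setT (fun y : plane R => y.2).
Proof.
case: k => [|k]; first by split=> [x _|]; [exact: (@snd_continuous R x)|exact: I].
apply: (Ck_derive (df := fun v _ => v.2)); last exact: (@snd_continuous R).
- by move=> v x; exact: is_derive_snd.
- by move=> v; exact: Ck_cst.
Qed.

(** A radial kernel around x, supported in the disc |y - x|^2 <= D; pbump 1 is the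
    mollifier and the other polynomials P occur in its derivatives. *)
Definition pbump (P : {poly R}) (D : R) x y : R := flat P (D - nsq (y - x)).

Lemma is_derive_pbump P D x y v : is_derive y v (pbump P D x)
  (pbump (flatD P) D x y * (- 2 * ((y.1 - x.1) * v.1 + (y.2 - x.2) * v.2))).
Proof.
apply: (@is_derive_comp1 _ _ (flat P) (fun y => D - nsq (y - x))); last exact: is_derive_flat.
have d1 : is_derive y v (fun z : plane R => z.1 - x.1) v.1.
  by apply: is_derive_eq (is_derive_add (is_derive_fst _ _) (is_derive_cst _ _ _)) _; rewrite addr0.
have d2 : is_derive y v (fun z : plane R => z.2 - x.2) v.2.
  by apply: is_derive_eq (is_derive_add (is_derive_snd _ _) (is_derive_cst _ _ _)) _; rewrite addr0.
have d3 := is_derive_add (is_derive_cst D y v) (is_derive_mul (is_derive_cst (- 1 : R) y v)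
  (is_derive_add (is_derive_mul d1 d1) (is_derive_mul d2 d2))).
have -> : (fun y => D - nsq (y - x)) = (fun z : plane R => cst D z + cst (- 1 : R) z *
   ((z.1 - x.1) * (z.1 - x.1) + (z.2 - x.2) * (z.2 - x.2))).
  by apply/funext => z; rewrite /cst/= /nsq/= !expr2 mulN1r.
by apply: is_derive_eq d3 _; rewrite /cst; ring.
Qed.

Lemma flat_continuous P : continuous (flat P : R -> R).
Proof.
move=> x; apply: differentiable_continuous; apply/derivable1_diffP.
by have [] := is_derive_flat P x.
Qed.

Lemma pbump_continuous P D x : continuous (pbump P D x).
Proof.
move=> y; apply: (cvg_comp (fun y => D - nsq (y - x)) (flat P)); last exact: flat_continuous.
apply: cvgB; first exact: cvg_cst.
by apply: cvg_nsq; apply: cvgB; [exact: cvg_id|exact: cvg_cst].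
Qed.

(** By induction on k, since derivatives of a pbump are again pbumps up to
    polynomial factors. *)
Lemma Ck_pbump k P D x : Ck k setT (pbump P D x).
Proof.
elim: k P => [|k IH] P; first by split => // y _; exact: pbump_continuous.
apply: (Ck_derive (df := fun v y => pbump (flatD P) D x y *
   (- 2 * ((y.1 - x.1) * v.1 + (y.2 - x.2) * v.2)))).
- by move=> v y; exact: is_derive_pbump.
- move=> v; apply: CkM => //; apply: CkM; first exact: Ck_cst.
  apply: CkD; (apply: CkM; last exact: Ck_cst); (apply: CkD; last exact: Ck_cst).
    exact: Ck_fst.
  exact: Ck_snd.
- exact: pbump_continuous.
Qed.

Lemma ddc_pbump D x y : ddc (pbump 1 D x) y =
  (nsq (y - x) * pbump (flatD (flatD 1)) D x y - pbump (flatD 1) D x y) / pi.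
Proof.
have D1 P v : (fun y => 'D_v (pbump P D x) y) = fun y => pbump (flatD P) D x y *
   (- 2 * ((y.1 - x.1) * v.1 + (y.2 - x.2) * v.2)).
  by apply/funext => z; have /@derive_val := is_derive_pbump P D x z v.
have d1 v : is_derive y v (fun z : plane R => z.1 - x.1) v.1.
  by apply: is_derive_eq (is_derive_add (is_derive_fst _ _) (is_derive_cst _ _ _)) _; rewrite addr0.
have d2 v : is_derive y v (fun z : plane R => z.2 - x.2) v.2.
  by apply: is_derive_eq (is_derive_add (is_derive_snd _ _) (is_derive_cst _ _ _)) _; rewrite addr0.
have D2 (v : plane R) : 'D_v (fun y => 'D_v (pbump 1 D x) y) y =
   pbump (flatD 1) D x y * (- 2 * (v.1 * v.1 + v.2 * v.2)) +
   (- 2 * ((y.1 - x.1) * v.1 + (y.2 - x.2) * v.2)) * (pbump (flatD (flatD 1)) D x y *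
   (- 2 * ((y.1 - x.1) * v.1 + (y.2 - x.2) * v.2))).
  rewrite D1; have lin : is_derive y v (fun y : plane R => - 2 * ((y.1 - x.1) * v.1 + (y.2 - x.2) * v.2))
     (- 2 * (v.1 * v.1 + v.2 * v.2)).
    apply: is_derive_eq (is_derive_mul (is_derive_cst (- 2 : R) _ _) (is_derive_add
      (is_derive_mul (d1 v) (is_derive_cst v.1 _ _)) (is_derive_mul (d2 v) (is_derive_cst v.2 _ _)))) _.
    by rewrite /cst; ring.
  by have /@derive_val := is_derive_mul (is_derive_pbump (flatD 1) D x y v) lin.
have alg (p A B u1 u2 : R) : p != 0 ->
  (B * (-2 * (1 * 1 + 0 * 0)) + -2 * (u1 * 1 + u2 * 0) * (A * (-2 * (u1 * 1 + u2 * 0))) +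
  (B * (-2 * (0 * 0 + 1 * 1)) + -2 * (u1 * 0 + u2 * 1) * (A * (-2 * (u1 * 0 + u2 * 1))))) / (4 * p)
  = ((u1 ^+ 2 + u2 ^+ 2) * A - B) / p by move=> p0; field.
have p0 : (@pi R) != 0 := lt0r_neq0 (@pi_gt0 R).
etransitivity; first exact (congr2 (fun a b => (a + b) / (4 * pi)) (D2 (1, 0)) (D2 (0, 1))).
exact (alg _ _ _ _ _ p0).
Qed.

Lemma pbump_eq0 P D x y : D <= nsq (y - x) -> pbump P D x y = 0.
Proof. by move=> h; rewrite /pbump flat_le0// subr_le0. Qed.

Lemma disc_closed x (D : R) : closed [set y : plane R | nsq (y - x) <= D].
Proof.
have -> : [set y : plane R | nsq (y - x) <= D] = (fun y => nsq (y - x)) @^-1` [set r | r <= D] by [].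
apply: closed_comp; last exact: closed_le.
by move=> y _; apply: cvg_nsq; apply: cvgB; [exact: cvg_id|exact: cvg_cst].
Qed.

Lemma disc_compact x (D : R) : compact [set y : plane R | nsq (y - x) <= D].
Proof.
apply: (@closed_bounded_compact _ _ (`|x| + (D + 1))); first exact: disc_closed.
move=> y /= yD; have h := norm_le_nsq (y - x).
have n0 : 0 <= `|y - x| by [].
have : `|y - x| <= D + 1.
  rewrite leNgt; apply/negP => lt; have D0 : 0 <= D by exact: le_trans (nsq_ge0 _) yD.
  have : (D + 1) * (D + 1) <= `|y - x| ^+ 2 by rewrite expr2 ler_pM// ?addr_ge0// ltW.
  nra.
move=> h2; rewrite -[y](subrK x) addrC (le_trans (ler_normD _ _))// lerD2l//.
Qed.

Lemma pbump_test V D x : [set y : plane R | nsq (y - x) <= D] `<=` V ->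
  test_function V (pbump 1 D x).
Proof.
move=> DV; split; first by move=> k; exact: Ck_pbump.
exists [set y : plane R | nsq (y - x) <= D]; split => //; first exact: disc_compact.
by move=> y /= /negP; rewrite -ltNge => /ltW; exact: pbump_eq0.
Qed.

End Smooth.

(** * Measurability and integrability in the plane *)

Section PlaneMeasure.
Context {R : realType}.
Notation mplane := (measurableTypeR R * measurableTypeR R)%type.
Implicit Types (f g : plane R -> R).

Lemma open_measurable_plane (U : set (plane R)) : open U ->
  measurable (U : set mplane).
Proof.
move=> oU.
pose box (q : rat * rat * nat) : set mplane :=
  `](ratr q.1.1 - q.2.+1%:R^-1), (ratr q.1.1 + q.2.+1%:R^-1)[%classic `*`
  `](ratr q.1.2 - q.2.+1%:R^-1), (ratr q.1.2 + q.2.+1%:R^-1)[%classic.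
pose F q := if `[< box q `<=` U >] then box q else set0.
have -> : U = \bigcup_q F q.
  apply/seteqP; split => [y Uy|y [q _]]; last first.
    by rewrite /F; case: ifPn => // /asboolP h /h.
  have : nbhs y U by exact: open_nbhs_nbhs.
  move/nbhs_ballP => [e /= e0 eU].
  have [n] : exists n : nat, n.+1%:R^-1 < e / 2.
    exists (Num.truncn (e / 2)^-1).
    rewrite invf_plt ?posrE ?ltr0n ?divr_gt0//; exact: truncnS_gt.
  move=> ne; have n0 : (0 : R) < n.+1%:R^-1 by rewrite invr_gt0 ltr0n.
  have pick (a : R) : exists q : rat, `|ratr q - a| < n.+1%:R^-1.
    have lt : a - n.+1%:R^-1 < a + n.+1%:R^-1.
      by rewrite ltrD2l (lt_trans _ n0)// oppr_lt0.
    have [q] := rat_in_itvoo lt.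
    by rewrite in_itv/= => ?; exists q; rewrite ltr_distl.
  have [q1 hq1] := pick y.1; have [q2 hq2] := pick y.2.
  exists (q1, q2, n) => //; rewrite /F; case: ifPn => [_|/asboolPn[]].
    by rewrite /box/=; split; rewrite /= in_itv/= -ltr_distl distrC.
  move=> z; rewrite /box /= => -[]; rewrite !in_itv/= -!ltr_distl => h1 h2.
  have tri (u v w d : R) : `|u - v| < d -> `|w - u| < d -> d < e / 2 -> `|v - w| < e.
    move=> huv hwu de; rewrite (_ : v - w = (v - u) + (u - w)); last by ring.
    by rewrite (le_lt_trans (ler_normD _ _))// distrC [X in _ + X]distrC; lra.
  apply: eU; rewrite -ball_normE/= prod_normE/= gt_max; apply/andP; split.
    exact: tri hq1 h1 ne.
  exact: tri hq2 h2 ne.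
apply: countable_bigcupT_measurable => // q; rewrite /F; case: ifPn => // _.
by apply: measurableX; exact: measurable_itv.
Qed.

Lemma continuous_measurable_plane (U : set (plane R)) f : open U ->
  (forall x, U x -> {for x, continuous f}) ->
  measurable_fun (U : set mplane) f.
Proof.
move=> oU cf; apply: (measurability _ (measurable_realfun.RGenOpens.measurableE R)).
move=> _ [_ [a [b ->] <-]].
have -> : U `&` f @^-1` `]a, b[ = \bigcup_(V in [set V : set (plane R) |
    open V /\ V `<=` U `&` f @^-1` `]a, b[]) V.
  apply/seteqP; split => [x [Ux fx]|x [V [_ h]] /h//].
  have : nbhs x (U `&` f @^-1` `]a, b[).
    apply: filterI; first exact: open_nbhs_nbhs.
    by apply: cf => //; apply: open_nbhs_nbhs; split => //; exact: interval_open.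
  rewrite nbhsE => -[V [oV Vx] VU]; by exists V.
by apply: open_measurable_plane; apply: bigcup_open => V [].
Qed.

Lemma box_finite (r : R) : (leb2 ((`[(- r)%R, r]%classic `*` `[(- r)%R, r]%classic)%classic : set mplane) < +oo)%E.
Proof.
have fin : (@lebesgue_measure R `[(- r)%R, r]%classic < +oo)%E.
  have h := lebesgue_measure_itv `[- r, r]; rewrite /= in h; rewrite h.
  by case: ifPn => _; rewrite -?EFinB ?ltry.
rewrite /leb2 product_measure1E; [|exact: measurable_itv..].
by apply: lte_mul_pinfty => //; rewrite ge0_fin_numE.
Qed.

(** A bounded measurable function with bounded support is integrable. *)
Lemma bounded_supp_integrable (V : set mplane) f (M r : R) : measurable V ->
  measurable_fun V f -> 0 <= M -> (forall y, V y -> `|f y| <= M) ->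
  (forall y, V y -> r < `|y| -> f y = 0) ->
  leb2.-integrable V (EFin \o f).
Proof.
move=> mV mf M0 fM f0.
pose B : set mplane := `[- r, r]%classic `*` `[- r, r]%classic.
have mB : measurable B by apply: measurableX; exact: measurable_itv.
apply: (@le_integrable _ _ _ leb2 V mV _ (fun y => (M * \1_B y)%:E)).
- exact/measurable_EFinP.
- move=> y Vy; rewrite !abse_EFin/= lee_fin.
  have [By|nB] := pselect (B y).
    by rewrite indicE mem_set// mulr1 (ger0_norm M0) fM.
  rewrite f0 ?normr0//; rewrite ltNge; apply/negP => yr; apply: nB.
  split; rewrite /= in_itv/= -ler_norml; apply: le_trans yr;
  [exact: norm_fst|exact: norm_snd].
- apply: (@integrableS _ _ _ leb2 setT) => //.
  rewrite (_ : (fun y : mplane => _) = (fun y => M%:E * (\1_B y)%:E)%E); last first.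
    by apply/funext => y; rewrite EFinM.
  apply: integrableZl => //; apply/integrableP; split.
    exact/measurable_EFinP/measurable_indic.
  rewrite (eq_integral (fun y => (\1_B y)%:E)); last first.
    by move=> t _; rewrite gee0_abs// lee_fin.
  by rewrite integral_indic// setIT; exact: box_finite.
Qed.

End PlaneMeasure.

(** * Four-point differences of the kernel *)

Section BumpMean.
Context {R : realType}.
Implicit Types (x y h u : plane R) (D : R).

Lemma nsq_near0 (e : R) : 0 < e -> \forall h \near (0 : plane R), nsq h <= e.
Proof.
move=> e0; have c : nsq h @[h --> (0 : plane R)] --> (0 : R).
  by rewrite (_ : 0 = nsq (0 : plane R)); [exact: nsq_continuous|rewrite /nsq/= expr0n addr0].
have H : \forall h \near (0 : plane R), nsq h < e by exact: (cvgr_lt _ c).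
by apply: filterS H => h; exact: ltW.
Qed.

(** The four-point difference of the kernel in its centre x, minus its second order
    term 4 pi |h|^2 ddc. *)
Definition pbump4 D x y h : R := pbump 1 D (x + h) y + pbump 1 D (x - h) y +
  pbump 1 D (x + irot h) y + pbump 1 D (x - irot h) y - 4 * pbump 1 D x y -
  4 * pi * nsq h * ddc (pbump 1 D x) y.

Lemma pbump4E D x y h : pbump4 D x y h = pbump 1 D (x + h) y + pbump 1 D (x - h) y +
  pbump 1 D (x + irot h) y + pbump 1 D (x - irot h) y - 4 * pbump 1 D x y -
  4 * nsq h * (nsq (y - x) * pbump (flatD (flatD 1)) D x y - pbump (flatD 1) D x y).
Proof.
rewrite /pbump4 ddc_pbump; congr (_ - _).
have alg (p n X : R) : p != 0 -> 4 * p * n * (X / p) = 4 * n * X by move=> p0; field.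
exact (alg _ _ _ (lt0r_neq0 (@pi_gt0 R))).
Qed.

Lemma pbump4_supp D x y h : nsq h <= D -> 4 * D <= nsq (y - x) -> pbump4 D x y h = 0.
Proof.
move=> hD yD; rewrite pbump4E.
have D0 : 0 <= D := le_trans (nsq_ge0 h) hD.
have far (k : plane R) : nsq k <= D -> D <= nsq (y - (x + k)).
  move=> kD; have := nsq_ge0 (y - x - k - k).
  have -> : nsq (y - x - k - k) = 2 * nsq (y - (x + k)) - nsq (y - x) + 2 * nsq k.
    by rewrite /nsq/=; ring.
  by move=> ?; lra.
have nN (k : plane R) : nsq (- k) = nsq k by rewrite /nsq/=; ring.
have xD : D <= nsq (y - x) by lra.
rewrite !pbump_eq0 ?far ?nN ?nsq_irot//; ring.
Qed.

(** The difference is o(|h|^2) uniformly in x and y: the Taylor expansions at the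
    four points add up to the Laplacian term, and the cubic remainders are small.
    The squared increment of |y - x|^2 is at most
    34 D |h|^2 where |y - x|^2 < 4 D. *)
Lemma pbump4_bound D (e : R) : 0 < D -> 0 < e -> \forall h \near (0 : plane R),
  nsq h <= D /\ forall x y, `|pbump4 D x y h| <= e * nsq h.
Proof.
move=> D0 e0.
have [C C0 HC] := @flat_taylor R D.
have [B B0 HB] := flat_bounded (flatD (flatD 1)) D.
pose e1 := e / (4 * C * (34 * D) + 2 * B + 1).
have den0 : 0 < 4 * C * (34 * D) + 2 * B + 1.
  have : 0 < C * D by rewrite mulr_gt0.
  by move: B0; lra.
have e10 : 0 < e1 by rewrite divr_gt0.
have n1 := nsq_near0 D0; have n2 := nsq_near0 e10.
have n3 : \forall h \near (0 : plane R), nsq h <= e1 ^+ 2 / (34 * D).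
  by apply: nsq_near0; rewrite divr_gt0 ?exprn_gt0// mulr_gt0.
apply: filterS3 n1 n2 n3 => h h1 h2 h3; split => // x y.
have [yD|yD] := leP (4 * D) (nsq (y - x)).
  by rewrite pbump4_supp// normr0 mulr_ge0 ?(ltW e0) ?nsq_ge0.
rewrite pbump4E; set u : plane R := y - x in yD *.
pose q := D - nsq u.
have qD : q <= D by rewrite /q gerBl nsq_ge0.
pose d (k : plane R) : R := nsq u - nsq (u - k).
have bE (k : plane R) : pbump 1 D (x + k) y = flat 1 (q + d k).
  have eu : y - (x + k) = u - k by rewrite /u opprD addrA.
  rewrite /pbump eu /q /d; congr (flat 1 _); ring.
pose P1 := flat (flatD 1) q; pose P2 := flat (flatD (flatD 1)) q.
have P2B : `|P2| <= B by exact: HB.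
have hs := nsq_ge0 h.
have dk (k : plane R) : nsq k = nsq h ->
    `|flat 1 (q + d k) - (flat 1 q + P1 * d k + P2 * d k ^+ 2 / 2)| <= C * e1 * (34 * D) * nsq h.
  move=> kh; have qd : q + d k <= D by rewrite /q /d addrA subrK gerBl nsq_ge0.
  apply: le_trans (HC q (d k) qD qd) _.
  have d2 : d k ^+ 2 <= 34 * D * nsq h.
    have cs : (u.1 * k.1 + u.2 * k.2) ^+ 2 <= nsq u * nsq k.
      have -> : nsq u * nsq k = (u.1 * k.1 + u.2 * k.2) ^+ 2 + (u.1 * k.2 - u.2 * k.1) ^+ 2.
        by rewrite /nsq; ring.
      by rewrite lerDl sqr_ge0.
    have dE : d k = 2 * (u.1 * k.1 + u.2 * k.2) - nsq k by rewrite /d /nsq/=; ring.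
    have sq (a b : R) : (2 * a - b) ^+ 2 <= 8 * a ^+ 2 + 2 * b ^+ 2.
      have -> : 8 * a ^+ 2 + 2 * b ^+ 2 = (2 * a - b) ^+ 2 + (2 * a + b) ^+ 2 by ring.
      by rewrite lerDl sqr_ge0.
    have a1 : d k ^+ 2 <= 8 * (u.1 * k.1 + u.2 * k.2) ^+ 2 + 2 * nsq k ^+ 2.
      by rewrite dE; exact: sq.
    rewrite kh in cs a1.
    have a2 : nsq u * nsq h <= 4 * D * nsq h by rewrite ler_wpM2r// ltW.
    have a3 : nsq h ^+ 2 <= D * nsq h by rewrite expr2 ler_wpM2r.
    by lra.
  have d1 : `|d k| <= e1.
    rewrite -(@ler_pXn2r _ 2)// ?nnegrE ?(ltW e10)// real_normK ?num_real//.
    apply: le_trans d2 _; rewrite mulrC -ler_pdivlMr// mulr_gt0//.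
  rewrite exprSr real_normK ?num_real// mulrA.
  have c1 : C * d k ^+ 2 <= C * (34 * D * nsq h) by rewrite ler_wpM2l ?(ltW C0).
  have -> : C * e1 * (34 * D) * nsq h = C * (34 * D * nsq h) * e1 by ring.
  by apply: ler_pM => //; rewrite mulr_ge0 ?sqr_ge0 ?(ltW C0).
rewrite !bE.
have nN (k : plane R) : nsq (- k) = nsq k by rewrite /nsq/=; ring.
have E0 : pbump 1 D x y = flat 1 q by [].
rewrite E0 -[pbump (flatD (flatD 1)) D x y]/P2 -[pbump (flatD 1) D x y]/P1.
have k1 := dk h erefl; have k2 := dk (- h) (nN h).
have k3 := dk (irot h) (nsq_irot h).
have k4 : `|flat 1 (q + d (- irot h)) - (flat 1 q + P1 * d (- irot h) + P2 * d (- irot h) ^+ 2 / 2)|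
   <= C * e1 * (34 * D) * nsq h by apply: dk; rewrite nN nsq_irot.
set T1 := flat 1 (q + d h) in k1 *; set T2 := flat 1 (q + d (- h)) in k2 *.
set T3 := flat 1 (q + d (irot h)) in k3 *; set T4 := flat 1 (q + d (- irot h)) in k4 *.
set T0 := flat 1 q in k1 k2 k3 k4 *.
have alg : P1 * (d h + d (- h) + d (irot h) + d (- irot h)) +
  P2 * (d h ^+ 2 + d (- h) ^+ 2 + d (irot h) ^+ 2 + d (- irot h) ^+ 2) / 2 =
  4 * nsq h * (nsq u * P2 - P1) + 2 * P2 * nsq h ^+ 2.
  by rewrite /d /nsq/=; field.
have -> : T1 + T2 + T3 + T4 - 4 * T0 - 4 * nsq h * (nsq u * P2 - P1) =
  ((T1 - (T0 + P1 * d h + P2 * d h ^+ 2 / 2)) +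
  (T2 - (T0 + P1 * d (- h) + P2 * d (- h) ^+ 2 / 2)) +
  (T3 - (T0 + P1 * d (irot h) + P2 * d (irot h) ^+ 2 / 2)) +
  (T4 - (T0 + P1 * d (- irot h) + P2 * d (- irot h) ^+ 2 / 2))) + 2 * P2 * nsq h ^+ 2.
  have e2 : 4 * nsq h * (nsq u * P2 - P1) = P1 * (d h + d (- h) + d (irot h) + d (- irot h)) +
  P2 * (d h ^+ 2 + d (- h) ^+ 2 + d (irot h) ^+ 2 + d (- irot h) ^+ 2) / 2 - 2 * P2 * nsq h ^+ 2.
    by rewrite alg; ring.
  by rewrite e2; field.
have last : `|2 * P2 * nsq h ^+ 2| <= 2 * B * e1 * nsq h.
  have -> : 2 * P2 * nsq h ^+ 2 = P2 * (2 * (nsq h * nsq h)) by ring.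
  have n0 : 0 <= 2 * (nsq h * nsq h) by rewrite mulr_ge0// mulr_ge0.
  rewrite normrM (ger0_norm n0).
  have -> : 2 * B * e1 * nsq h = B * (2 * (e1 * nsq h)) by ring.
  by apply: ler_pM => //; rewrite ler_wpM2l// ler_wpM2r.
have := ler_normD ((T1 - (T0 + P1 * d h + P2 * d h ^+ 2 / 2)) +
  (T2 - (T0 + P1 * d (- h) + P2 * d (- h) ^+ 2 / 2)) +
  (T3 - (T0 + P1 * d (irot h) + P2 * d (irot h) ^+ 2 / 2)) +
  (T4 - (T0 + P1 * d (- irot h) + P2 * d (- irot h) ^+ 2 / 2))) (2 * P2 * nsq h ^+ 2).
move/le_trans; apply.
have tri (a b c' d' : R) : `|a + b + c' + d'| <= `|a| + `|b| + `|c'| + `|d'|.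
  do 2 (apply: le_trans (ler_normD _ _) _; rewrite lerD2r).
  exact: ler_normD.
apply: le_trans (lerD (tri _ _ _ _) last) _.
apply: le_trans (lerD (lerD (lerD (lerD k1 k2) k3) k4) (lexx _)) _.
have -> : e * nsq h = e1 * (4 * C * (34 * D) + 2 * B + 1) * nsq h.
  by rewrite /e1 divfK// gt_eqF.
have : 0 <= e1 * nsq h by rewrite mulr_ge0 ?(ltW e10).
by move: (e1 * nsq h) => *; nra.
Qed.

End BumpMean.

(** * Mass and translation invariance of the kernel *)

Section BumpIntegral.
Context {R : realType}.
Notation mplane := (measurableTypeR R * measurableTypeR R)%type.
Notation mu := (@lebesgue_measure R).
Implicit Types (x y h u : plane R) (D : R).

Lemma integral_translate (G : R -> R) (a : R) : continuous G -> (forall t, 0 <= G t) ->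
  (\int[mu]_t (G (t + a)%R)%:E = \int[mu]_t (G t)%:E)%E.
Proof.
move=> cG G0.
have dF (x : R) : is_derive x (1 : R) (fun t : R => t + a) 1.
  by rewrite -[X in is_derive _ _ _ X]addr0; exact: is_deriveD.
have F1 : ((fun t : R => t + a)^`() = cst 1)%classic.
  by apply/funext => x; rewrite derive1E derive_val.
rewrite [RHS](@increasing_ge0_integration_by_substitutionT R (fun t => t + a) G)//.
- by apply: eq_integral => t _; rewrite F1/= mulr1.
- by move=> x y xy; rewrite ltrD2r.
- by rewrite F1 => x; exact: cvg_cst.
- by rewrite F1; exact: is_cvg_cst.
- by rewrite F1; exact: is_cvg_cst.
- exact: cvg_addrr_Ny.
- exact: cvg_addrr.
Qed.

Lemma measurable_pbump P D x : measurable_fun (setT : set mplane) (pbump P D x).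
Proof.
apply: continuous_measurable_plane; first exact: openT.
by move=> y _; exact: pbump_continuous.
Qed.

(** The total integral of the kernel. *)
Definition pbumpi D : \bar R := (\int[leb2]_y (pbump 1 D 0 y)%:E)%E.

Lemma pbump_translate D x : (\int[leb2]_y (pbump 1 D x y)%:E = pbumpi D)%E.
Proof.
have p0 z y : (0 <= (pbump 1 D z y)%:E)%E by rewrite lee_fin flat_ge0.
have mp z : measurable_fun (setT : set mplane) (fun y => (pbump 1 D z y)%:E).
  by apply/measurable_EFinP; exact: measurable_pbump.
have c1 z (t : R) : continuous (fun s : R => pbump 1 D z (t, s)).
  move=> s; apply: (cvg_comp (fun s : R => (t, s) : plane R) (pbump 1 D z)); last exact: pbump_continuous.
  by apply: cvg_mkpair; [exact: cvg_cst|exact: cvg_id].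
have c2 z (t : R) : continuous (fun s : R => pbump 1 D z (s, t)).
  move=> s; apply: (cvg_comp (fun s : R => (s, t) : plane R) (pbump 1 D z)); last exact: pbump_continuous.
  by apply: cvg_mkpair; [exact: cvg_id|exact: cvg_cst].
have E z : (\int[leb2]_y (pbump 1 D z y)%:E = \int[mu]_t \int[mu]_s (pbump 1 D z (t, s))%:E)%E.
  exact (fubini_tonelli1 _ (mp z) (p0 z)).
have E' z : (\int[mu]_t \int[mu]_s (pbump 1 D z (t, s))%:E = \int[mu]_s \int[mu]_t (pbump 1 D z (t, s))%:E)%E.
  exact (fubini_tonelli _ (mp z) (p0 z)).
have T2 t : (\int[mu]_s (pbump 1 D x (t, s))%:E = \int[mu]_s (pbump 1 D (x.1, 0%R) (t, s))%:E)%E.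
  have <- := @integral_translate (fun s => pbump 1 D (x.1, 0) (t, s)) (- x.2) (c1 _ _)
     (fun s => flat_ge0 _).
  apply: eq_integral => s _; congr EFin; rewrite /pbump; congr (flat 1 (_ - nsq _)).
  by apply: (congr2 pair); rewrite /= ?subr0.
have T1 s : (\int[mu]_t (pbump 1 D (x.1, 0%R) (t, s))%:E = \int[mu]_t (pbump 1 D 0%R (t, s))%:E)%E.
  have <- := @integral_translate (fun t => pbump 1 D 0 (t, s)) (- x.1) (c2 _ _)
     (fun s => flat_ge0 _).
  apply: eq_integral => t _; congr EFin; rewrite /pbump; congr (flat 1 (_ - nsq _)).
  by apply: (congr2 pair); rewrite /= ?subr0.
rewrite /pbumpi (E x) (E 0).
transitivity (\int[mu]_t \int[mu]_s (pbump 1 D (x.1, 0%R) (t, s))%:E)%E.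
  by apply: eq_integral => t _; exact: T2.
etransitivity; first exact (E' (x.1, 0)).
etransitivity; last exact (esym (E' 0)).
by apply: eq_integral => s _; exact: T1.
Qed.

End BumpIntegral.

Section Smear.
Context {R : realType}.
Notation mplane := (measurableTypeR R * measurableTypeR R)%type.
Implicit Types (x y h u : plane R) (D l e : R) (v f g : plane R -> R).

(** The closed disc of squared radius D. *)
Definition disc x D : set (plane R) := [set y | nsq (y - x) <= D].

Lemma nsqD3 x y h : nsq (x + y + h) <= 3 * (nsq x + nsq y + nsq h).
Proof.
rewrite -subr_ge0 (_ : _ - _ = nsq (x - y) + nsq (y - h) + nsq (h - x)).
  by apply: addr_ge0; [apply: addr_ge0|]; exact: nsq_ge0.
by rewrite /nsq/=; ring.
Qed.

Lemma disc_norm x D y : disc x D y -> `|y| <= `|x| + (D + 1).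
Proof.
move=> yD; have h := norm_le_nsq (y - x).
have n0 : 0 <= `|y - x| by [].
have h3 : `|y - x| <= D + 1.
  rewrite leNgt; apply/negP => lt; have D0 : 0 <= D by exact: le_trans (nsq_ge0 _) yD.
  have : (D + 1) * (D + 1) <= `|y - x| ^+ 2 by rewrite expr2 ler_pM// ?addr_ge0// ltW.
  have : `|y - x| ^+ 2 <= D := le_trans h yD.
  nra.
by rewrite -[y](subrK x) addrC (le_trans (ler_normD _ _))// lerD2l.
Qed.

Lemma disc_bound f x D : (forall y, disc x D y -> {for y, continuous f}) ->
  exists2 M, 0 < M & forall y, disc x D y -> `|f y| <= M.
Proof.
move=> cf; have [D0|D0] := ltP D 0.
  exists 1 => // y; rewrite /disc/= => /le_lt_trans/(_ D0).
  by rewrite ltNge nsq_ge0.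
have [||c _ cM] := @compact_EVT_max _ R (fun y => `|f y|) _ _ (@disc_compact R x D).
- by exists x; rewrite /= subrr /nsq/= expr0n addr0.
- apply/subspace_continuousP => y yD; apply: cvg_norm; apply: cvg_trans (cf y yD).
  by apply: cvg_app; exact: cvg_within.
exists (`|f c| + 1); first by rewrite ltr_wpDl.
by move=> y yD; rewrite ler_wpDr// cM// inE.
Qed.

(** Bounded measurable functions supported in a disc: the kernels against which a
    potential is integrated. *)
Definition kernel_on x D f := [/\ measurable_fun (setT : set mplane) f,
  exists B, forall y, `|f y| <= B & forall y, D < nsq (y - x) -> f y = 0].

Lemma kernel_onD x D f g : kernel_on x D f -> kernel_on x D g ->
  kernel_on x D (fun y => f y + g y).
Proof.
move=> [mf [B fB] f0] [mg [B' gB] g0]; split.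
- exact: measurable_funD.
- by exists (B + B') => y; rewrite (le_trans (ler_normD _ _))// lerD.
- by move=> y yD; rewrite f0// g0// addr0.
Qed.

Lemma kernel_onZ x D (a : R) f : kernel_on x D f -> kernel_on x D (fun y => a * f y).
Proof.
move=> [mf [B fB] f0]; split.
- exact: measurable_funM.
- by exists (`|a| * B) => y; rewrite normrM ler_wpM2l.
- by move=> y yD; rewrite f0// mulr0.
Qed.

Lemma kernel_on_pbump P x D x' D' : (disc x' D' `<=` disc x D) ->
  kernel_on x D (pbump P D' x').
Proof.
move=> sub; split; first exact: measurable_pbump.
- by have [B _ HB] := flat_bounded P D'; exists B => y; apply: HB; rewrite gerBl nsq_ge0.
- move=> y yD; apply: pbump_eq0; rewrite leNgt; apply/negP => /ltW/sub.
  by rewrite /disc/= leNgt yD.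
Qed.

Lemma kernel_integrable V v f x D : open V -> (forall y, V y -> {for y, continuous v}) ->
  disc x D `<=` V -> kernel_on x D f ->
  (@leb2 R).-integrable (V : set mplane) (EFin \o (fun y => v y * f y)).
Proof.
move=> oV cv DV [mf [B fB] f0].
have mV := open_measurable_plane oV.
have [M M0 vM] := disc_bound (fun y yD => cv y (DV y yD)).
have B0 : 0 <= B by apply: le_trans (fB 0).
apply: (@bounded_supp_integrable _ _ _ (M * B) (`|x| + (D + 1))) => //.
- apply: measurable_funM; first exact: continuous_measurable_plane.
  exact: measurable_funTS.
- by rewrite mulr_ge0 ?(ltW M0).
- move=> y Vy; have [yD|yD] := leP (nsq (y - x)) D.
    by rewrite normrM ler_pM// vM.
  by rewrite f0// mulr0 normr0 mulr_ge0 ?(ltW M0).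
- move=> y Vy yx; rewrite f0 ?mulr0// ltNge; apply/negP => /disc_norm.
  by rewrite leNgt yx.
Qed.

(** The total integral of the kernel, as a real number. *)
Definition bump_mass D : R := fine (@pbumpi R D).

Lemma pbump_mass V D x : measurable (V : set mplane) -> disc x D `<=` V ->
  \int[leb2]_(y in V) pbump 1 D x y = bump_mass D.
Proof.
move=> mV DV; rewrite /bump_mass -(pbump_translate D x) /Rintegral; congr fine.
rewrite integral_mkcond; apply: eq_integral => y _ /=.
rewrite patchE; case: ifPn => // /negP nV; rewrite pbump_eq0//.
rewrite leNgt; apply/negP => /ltW yD; apply: nV; rewrite inE; exact: DV.
Qed.

Lemma bump_mass_gt0 D : 0 < D -> 0 < bump_mass D.
Proof.
move=> D0.
have iT : (@leb2 R).-integrable (setT : set mplane) (EFin \o pbump 1 D 0).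
  have k1 : kernel_on 0 D (pbump 1 D 0) by apply: kernel_on_pbump.
  have := @kernel_integrable setT (fun=> 1) (pbump 1 D 0) 0 D openT
     (fun _ _ => cvg_cst _) (fun _ _ => I) k1.
  have -> : (fun y => 1 * pbump 1 D 0 y) = pbump 1 D 0 by apply/funext => y; rewrite mul1r.
  exact.
rewrite -(@pbump_mass setT D 0)//.
pose s := Num.min 1 (D / 4).
have s0 : 0 < s by rewrite lt_min ltr01 divr_gt0.
pose B : set mplane := (`[0, s]%classic `*` `[0, s]%classic)%classic.
have mB : measurable B by apply: measurableX; exact: measurable_itv.
pose m := flat 1 (D / 2).
have m0 : 0 < m by apply: flat_gt0; rewrite divr_gt0.
have lb y : B y -> m <= pbump 1 D 0 y.
  move=> [/= ]; rewrite !in_itv/= => /andP[y10 y1s] /andP[y20 y2s].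
  have n2 : nsq (y - 0) <= D / 2.
    rewrite subr0 /nsq.
    have s1 : s <= 1 by rewrite ge_min lexx.
    have s4 : s <= D / 4 by rewrite ge_min lexx orbT.
    have q1 : y.1 ^+ 2 <= s by rewrite expr2 -[leRHS]mulr1 ler_pM// (le_trans y1s).
    have q2 : y.2 ^+ 2 <= s by rewrite expr2 -[leRHS]mulr1 ler_pM// (le_trans y2s).
    by lra.
  have q0 : D / 2 <= D - nsq (y - 0) by lra.
  have d2 : 0 < D / 2 by rewrite divr_gt0.
  have q0' := lt_le_trans d2 q0.
  rewrite /m /pbump /flat d2 q0' !hornerC !mul1r ler_expR lerN2 lef_pV2//.
have fin : (0 < leb2 B)%E /\ leb2 B \is a fin_num.
  have fB : (leb2 B < +oo)%E.
    apply: le_lt_trans (box_finite s); apply: le_measure; rewrite ?inE//.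
      by apply: measurableX; exact: measurable_itv.
    move=> y [/= ]; rewrite !in_itv/= => /andP[y10 y1s] /andP[y20 y2s].
    by split; rewrite /= ?in_itv/=; apply/andP; split; lra.
  split; last by rewrite ge0_fin_numE.
  have hs : (0 < @lebesgue_measure R `[0%R, s]%classic)%E.
    have h := lebesgue_measure_itv `[0, s]; rewrite /= in h; rewrite h.
    by rewrite lte_fin s0 -EFinB subr0 lte_fin.
  rewrite /B /leb2 product_measure1E; [|exact: measurable_itv..].
  exact: mule_gt0.
apply: (@lt_le_trans _ _ (m * fine (leb2 B))).
  by rewrite mulr_gt0// fine_gt0// fin.1 ltey_eq fin.2.
have bi k : 0 <= k -> leb2.-integrable (setT : set mplane) (EFin \o (fun y => k * \1_B y)).
  move=> k0; apply: (@bounded_supp_integrable _ _ _ k (s + 1)) => //.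
  + by apply: measurable_funM => //; exact: measurable_indic.
  + by move=> y _; rewrite indicE; case: (y \in B); rewrite ?mulr1 ?mulr0 ?normr0 ?ger0_norm.
  + move=> y _ ys; rewrite indicE memNset ?mulr0//.
    move=> [/= ]; rewrite !in_itv/= => /andP[y10 y1s] /andP[y20 y2s].
    move: ys; rewrite prod_normE/= lt_max !ger0_norm//.
    by case/orP => ?; lra.
have -> : m * fine (leb2 B) = \int[leb2]_y (m * \1_B y).
  have b1 := bi 1 ler01.
  have b1' : leb2.-integrable (setT : set mplane) (EFin \o \1_B).
    move: b1; have -> // : (fun y => 1 * \1_B y) = (\1_B : mplane -> R).
    by apply/funext => y; rewrite mul1r.
  by rewrite RintegralZl// /Rintegral integral_indic// setIT.
apply: le_Rintegral => //; first exact: bi (ltW m0).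
- move=> y _; rewrite indicE; case: (boolP (y \in B)); last by rewrite mulr0 flat_ge0.
  by rewrite inE mulr1 => /lb.
Qed.

End Smear.

(** * Mollifying a local potential *)

Section Smear2.
Context {R : realType}.
Notation mplane := (measurableTypeR R * measurableTypeR R)%type.
Implicit Types (x y h u : plane R) (D l e : R) (v f g : plane R -> R).

(** The mean of v against the kernel centred at x. *)
Definition smear (V : set (plane R)) v D x : R :=
  (\int[leb2]_(y in V) (v y * pbump 1 D x y)) / bump_mass D.

Lemma disc_sub x0 x D D' : nsq (x - x0) <= D -> 2 * (D' + D) <= 9 * D ->
  disc x D' `<=` disc x0 (9 * D).
Proof.
move=> xD D'D y; rewrite /disc/= => yD.
have -> : nsq (y - x0) = 2 * nsq (y - x) + 2 * nsq (x - x0) - nsq (y - x - (x - x0)).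
  by rewrite /nsq/=; ring.
by have := nsq_ge0 (y - x - (x - x0)); lra.
Qed.

Lemma disc_sub3 x0 x h D : nsq (x - x0) <= D -> nsq h <= D ->
  disc (x + h) D `<=` disc x0 (9 * D).
Proof.
move=> xD hD y; rewrite /disc/= => yD.
have -> : y - x0 = (y - (x + h)) + h + (x - x0).
  by rewrite opprD !addrA !subrK.
by apply: le_trans (nsqD3 _ _ _) _; lra.
Qed.

Lemma nsq_near x0 (e : R) : 0 < e -> \forall x \near x0, nsq (x - x0) <= e.
Proof.
move=> e0; have c : nsq (x - x0) @[x --> x0] --> nsq (x0 - x0).
  by apply: cvg_nsq; apply: cvgB; [exact: cvg_id|exact: cvg_cst].
have H : \forall x \near x0, nsq (x - x0) < e.
  by apply: (cvgr_lt _ c); rewrite subrr /nsq/= expr0n addr0.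
by apply: filterS H => h; exact: ltW.
Qed.

Lemma kernel_on_ddc x0 x D D' : 0 < D' -> disc x D' `<=` disc x0 D ->
  kernel_on x0 D (ddc (pbump 1 D' x)).
Proof.
move=> D'0 sub.
have [k1 [B1 H1] z1] := kernel_on_pbump (flatD 1) sub.
have [k2 [B2 H2] z2] := kernel_on_pbump (flatD (flatD 1)) sub.
have e : ddc (pbump 1 D' x) = fun y => (nsq (y - x) * pbump (flatD (flatD 1)) D' x y
   - pbump (flatD 1) D' x y) / pi by apply/funext => y; exact: ddc_pbump.
have cn : continuous (fun y => nsq (y - x)).
  by move=> y; apply: cvg_nsq; apply: cvgB; [exact: cvg_id|exact: cvg_cst].
have pi0 := @pi_gt0 R.
split.
- rewrite e; apply: continuous_measurable_plane; first exact: openT.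
  move=> y _; apply: cvgM; last exact: cvg_cst.
  by apply: cvgB; [apply: cvgM; [exact: cn|]|]; exact: pbump_continuous.
- exists ((D' * B2 + B1) / pi) => y; rewrite e normrM [`|pi^-1|]ger0_norm ?invr_ge0 ?(ltW pi0)//.
  rewrite ler_wpM2r ?invr_ge0 ?(ltW pi0)// (le_trans (ler_normB _ _))// lerD// normrM.
  have [yD|/ltW yD] := leP (nsq (y - x)) D'.
    by rewrite ler_pM// ger0_norm// nsq_ge0.
  rewrite (pbump_eq0 _ yD) normr0 mulr0 mulr_ge0 ?(ltW D'0)//.
  exact: le_trans (H2 0).
- by move=> y yD; rewrite e z1// z2// mulr0 subrr mul0r.
Qed.

Lemma kernel_bound V v x0 D : open V -> (forall y, V y -> {for y, continuous v}) ->
  disc x0 D `<=` V -> exists2 W, 0 <= W & forall f (c : R), kernel_on x0 D f -> 0 <= c ->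
    (forall y, `|f y| <= c) -> `|\int[leb2]_(y in (V : set mplane)) (v y * f y)| <= c * W.
Proof.
move=> oV cv DV.
have mV := open_measurable_plane oV.
have [M M0 vM] := disc_bound (fun y yD => cv y (DV y yD)).
pose K : set mplane := disc x0 D.
have mK : measurable K.
  rewrite -[K]setCK; apply: measurableC; apply: open_measurable_plane.
  by apply: closed_openC; exact: disc_closed.
have iK (a : R) : 0 <= a -> leb2.-integrable (V : set mplane) (EFin \o (fun y => a * \1_K y)).
  move=> a0; apply: (@bounded_supp_integrable _ _ _ a (`|x0| + (D + 1))) => //.
  - by apply: measurable_funM => //; apply: measurable_indic.
  - by move=> y _; rewrite indicE; case: (y \in K); rewrite ?mulr1 ?mulr0 ?normr0 ?ger0_norm.
  - move=> y _ ys; rewrite indicE memNset ?mulr0// => /disc_norm.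
    by rewrite leNgt ys.
exists (\int[leb2]_(y in (V : set mplane)) (M * \1_K y)).
  apply: Rintegral_ge0 => y _; rewrite mulr_ge0 ?(ltW M0)// indicE; by case: (y \in K).
move=> f c kf c0 fc.
have ki := kernel_integrable oV cv DV kf.
apply: le_trans (le_normr_Rintegral mV ki) _.
rewrite -RintegralZl//; last exact: iK (ltW M0).
apply: le_Rintegral => //.
- have := integrable_norm ki; exact.
- have cM : 0 <= c * M by rewrite mulr_ge0 ?(ltW M0).
  have := iK _ cM; have e2 : (fun y => c * M * \1_K y) = (fun y => c * (M * \1_K y)).
    by apply/funext => y; rewrite mulrA.
  by rewrite e2.
- have [_ _ zb] := kf.
  move=> y Vy; have [yD|yD] := leP (nsq (y - x0)) D.
    rewrite indicE mem_set// mulr1 normrM mulrC ler_pM//; exact: vM.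
  have i0 : 0 <= M * \1_K y by rewrite mulr_ge0 ?(ltW M0)// indicE; case: (y \in K).
  by rewrite zb// mulr0 normr0 mulr_ge0.
Qed.

(** The mollified potential satisfies the four-point inequality with the constant
    given by the density: the four-point difference falls on the kernel, and the
    ddc of the kernel is a test function in the weak equation for v.  The factor 9
    leaves room for translates of the kernel by h with |h|^2 <= D. *)
Lemma smear_submean (w : form11 R) k V v D l x0 : open V -> local_potential w k V v ->
  0 < D -> disc x0 (9 * D) `<=` V -> (forall y, disc x0 (9 * D) y -> l <= dens w k y) ->
  submean4 (smear V v D) x0 (pi * l).
Proof.
move=> oV [cv wv] D0 DV rl e e0.
have fin (A0 p1 p2 n1 n2 B4 : R) : p1 <= p2 -> n1 <= n2 -> - n1 <= B4 ->
  A0 + 4 * p1 - n2 <= B4 + (A0 + 4 * p2) by clear; lra.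
have mV := open_measurable_plane oV.
have C0 := bump_mass_gt0 D0.
have pi0 := @pi_gt0 R.
have [W W0 HW] := kernel_bound oV cv DV.
pose e1 := 4 * e * bump_mass D / (W + 1).
have e10 : 0 < e1 by rewrite divr_gt0 ?ltr_wpDl// !mulr_gt0.
pose I f := \int[leb2]_(y in (V : set mplane)) (v y * f y).
have ki f : kernel_on x0 (9 * D) f ->
   leb2.-integrable (V : set mplane) (EFin \o (fun y => v y * f y)).
  exact: kernel_integrable.
have ID f g : kernel_on x0 (9 * D) f -> kernel_on x0 (9 * D) g ->
    I (fun y => f y + g y) = I f + I g.
  move=> kf kg; rewrite /I -RintegralD//; [|exact: ki..].
  by apply: eq_Rintegral => y _; rewrite mulrDr.
have IZ (a : R) f : kernel_on x0 (9 * D) f -> I (fun y => a * f y) = a * I f.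
  move=> kf; rewrite /I -RintegralZl//; last exact: ki.
  by apply: eq_Rintegral => y _; rewrite mulrCA.
exists ([set x | nsq (x - x0) <= D], [set h | nsq h <= D /\ forall x y, `|pbump4 D x y h| <= e1 * nsq h]).
  by split; [exact: nsq_near|exact: pbump4_bound].
move=> [x h] [/= xD [hD Hh]].
have nN (z : plane R) : nsq (- z) = nsq z by rewrite /nsq/=; ring.
have kj (z : plane R) : nsq z = nsq h -> kernel_on x0 (9 * D) (pbump 1 D (x + z)).
  by move=> zh; apply: kernel_on_pbump; apply: disc_sub3 => //; rewrite zh.
have k1 := kj h erefl; have k2 := kj (- h) (nN h); have k3 := kj (irot h) (nsq_irot h).
have k4 : kernel_on x0 (9 * D) (pbump 1 D (x - irot h)) by apply: kj; rewrite nN nsq_irot.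
have subx : disc x D `<=` disc x0 (9 * D) by apply: disc_sub => //; lra.
have k0 : kernel_on x0 (9 * D) (pbump 1 D x) by apply: kernel_on_pbump.
have kd : kernel_on x0 (9 * D) (ddc (pbump 1 D x)) by exact: kernel_on_ddc.
have kR := kernel_onD (kernel_onZ 4 k0) (kernel_onZ (4 * pi * nsq h) kd).
have k12 := kernel_onD k1 k2; have k123 := kernel_onD k12 k3; have k1234 := kernel_onD k123 k4.
have kb : kernel_on x0 (9 * D) (fun y => pbump4 D x y h).
  have := kernel_onD k1234 (kernel_onZ (- 1) kR).
  rewrite (_ : (fun y => _ + _) = (fun y => pbump4 D x y h))//.
  by apply/funext => y; rewrite /pbump4; ring.
have sumE : I (pbump 1 D (x + h)) + I (pbump 1 D (x - h)) + I (pbump 1 D (x + irot h)) +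
    I (pbump 1 D (x - irot h)) =
    I (fun y => pbump4 D x y h) + (4 * I (pbump 1 D x) + 4 * pi * nsq h * I (ddc (pbump 1 D x))).
  rewrite -(ID _ _ k1 k2) -(ID _ _ k12 k3) -(ID _ _ k123 k4) -(IZ _ _ k0) -(IZ _ _ kd).
  rewrite -(ID _ _ (kernel_onZ 4 k0) (kernel_onZ (4 * pi * nsq h) kd)) -(ID _ _ kb kR).
  by congr I; apply/funext => y; rewrite /pbump4; ring.
have Id : l * bump_mass D <= I (ddc (pbump 1 D x)).
  rewrite /I wv; last by apply: pbump_test; exact: subset_trans subx DV.
  rewrite -(@pbump_mass _ V D x)//; last exact: subset_trans subx DV.
  have i1 := @kernel_integrable R V (fun=> l) _ x0 (9 * D) oV (fun _ _ => cvg_cst _) DV k0.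
  have i2 := @kernel_integrable R V (fun=> 1) _ x0 (9 * D) oV (fun _ _ => cvg_cst _) DV k0.
  rewrite -RintegralZl//; last first.
    have e2 : (fun y => 1 * pbump 1 D x y) = pbump 1 D x by apply/funext => y; rewrite mul1r.
    rewrite e2 in i2; exact: i2.
  have [rM HrM] := @dens_bounded _ w k (2 * (`|x0| + (9 * D + 1))).
  have [mk [B HB] zk] := k0.
  have nsqle y : disc x0 (9 * D) y -> cabs y <= 2 * (`|x0| + (9 * D + 1)).
    move=> /disc_norm yn; have n0 := normr_ge0 y.
    rewrite cabs_le; last by rewrite mulr_ge0// (le_trans n0).
    apply: le_trans (nsq_le_norm y) _.
    have : `|y| ^+ 2 <= (`|x0| + (9 * D + 1)) ^+ 2 by rewrite ler_pXn2r ?nnegrE// (le_trans n0).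
    move=> h2; apply: le_trans (ler_wpM2l (ler0n _ 2) h2) _.
    by rewrite exprMn ler_wpM2r ?sqr_ge0// expr2 -[leLHS]mulr1 ler_wpM2l// ler1n.
  have rM0 : 0 <= rM.
    apply: le_trans (normr_ge0 _) (HrM x0 _); apply: nsqle.
    by rewrite /disc/= subrr /nsq/= expr0n addr0 mulr_ge0// ltW.
  apply: le_Rintegral => //; first exact: i1.
  - apply: (@bounded_supp_integrable _ _ _ (B * rM) (`|x0| + (9 * D + 1))) => //.
    + have md : measurable_fun (setT : set mplane) (dens w k) := @dens_measurable R w k.
      apply: (@measurable_funTS _ _ _ _ (V : set mplane)).
      exact: (measurable_funM mk md).
    + by rewrite mulr_ge0// (le_trans _ (HB 0)).
    + move=> y Vy; have [yD|yD] := leP (nsq (y - x0)) (9 * D).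
        by rewrite normrM ler_pM// HrM//; exact: nsqle.
      by rewrite zk// mul0r normr0 mulr_ge0// (le_trans _ (HB 0)).
    + move=> y Vy yx; rewrite zk ?mul0r// ltNge; apply/negP => /disc_norm.
      by rewrite leNgt yx.
  - move=> y Vy; rewrite mulrC; have [yD|yD] := leP (nsq (y - x0)) (9 * D).
      by rewrite ler_wpM2l// ?flat_ge0//; exact: rl.
    by rewrite zk// !mul0r.
have Ib : - (e1 * nsq h * W) <= I (fun y => pbump4 D x y h).
  have c0 : 0 <= e1 * nsq h by rewrite mulr_ge0 ?(ltW e10) ?nsq_ge0.
  have := HW _ _ kb c0 (Hh x); rewrite ler_norml => /andP[]//.
rewrite /smear -/(I (pbump 1 D x)) -/(I (pbump 1 D (x + h))) -/(I (pbump 1 D (x - h)))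
  -/(I (pbump 1 D (x + irot h))) -/(I (pbump 1 D (x - irot h))).
rewrite -!mulrDl sumE ler_pdivlMr//.
have -> : 4 * (I (pbump 1 D x) / bump_mass D + (pi * l - e) * nsq h) * bump_mass D =
  4 * I (pbump 1 D x) + 4 * ((pi * nsq h) * (l * bump_mass D)) - 4 * e * bump_mass D * nsq h.
  move: (@pi R) => p; field; exact: lt0r_neq0.
have s1 : pi * nsq h * (l * bump_mass D) <= pi * nsq h * I (ddc (pbump 1 D x)).
  by rewrite ler_wpM2l// mulr_ge0 ?nsq_ge0 ?(ltW pi0).
have s2 : e1 * nsq h * W <= 4 * e * bump_mass D * nsq h.
  rewrite /e1 mulrAC; apply: ler_wpM2r; first exact: nsq_ge0.
  rewrite [leLHS](_ : _ = 4 * e * bump_mass D * (W / (W + 1))); last by rewrite mulrA mulrAC.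
  apply: ler_piMr; first by rewrite !mulr_ge0 ?(ltW e0) ?(ltW C0).
  by rewrite ler_pdivrMr ?ltr_wpDl// mul1r lerDl.
have -> : 4 * pi * nsq h * I (ddc (pbump 1 D x)) = 4 * (pi * nsq h * I (ddc (pbump 1 D x))).
  by rewrite !mulrA.
exact: fin s1 s2 Ib.
Qed.

Lemma smear_dist V v D x (e : R) : open V -> (forall y, V y -> {for y, continuous v}) ->
  0 < D -> disc x D `<=` V -> (forall y, disc x D y -> `|v y - v x| <= e) ->
  `|smear V v D x - v x| <= e.
Proof.
move=> oV cv D0 DV ve.
have mV := open_measurable_plane oV.
have C0 := bump_mass_gt0 D0.
have k0 : kernel_on x D (pbump 1 D x) by apply: kernel_on_pbump.
have ic (a : R) : leb2.-integrable (V : set mplane) (EFin \o (fun y => a * pbump 1 D x y)).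
  by apply: (@kernel_integrable R V (fun=> a) _ x D) => // y _; exact: cvg_cst.
have iv := @kernel_integrable R V v _ x D oV cv DV k0.
have i1 : leb2.-integrable (V : set mplane) (EFin \o pbump 1 D x).
  have e2 : (fun y => 1 * pbump 1 D x y) = pbump 1 D x by apply/funext => y; rewrite mul1r.
  by have := ic 1; rewrite e2.
have cst (a : R) : \int[leb2]_(y in (V : set mplane)) (a * pbump 1 D x y) = a * bump_mass D.
  by rewrite (RintegralZl a mV i1) (pbump_mass mV DV).
rewrite ler_distl /smear ler_pdivlMr// ler_pdivrMr// -!cst.
apply/andP; split.
  apply: (le_Rintegral mV (ic _) iv) => y Vy.
  have [yD|/ltW yD] := leP (nsq (y - x)) D; last by rewrite pbump_eq0// !mulr0.
  by rewrite ler_wpM2r ?flat_ge0//; have := ve _ yD; rewrite ler_distl => /andP[].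
apply: (le_Rintegral mV iv (ic _)) => y Vy.
have [yD|/ltW yD] := leP (nsq (y - x)) D; last by rewrite pbump_eq0// !mulr0.
by rewrite ler_wpM2r ?flat_ge0//; have := ve _ yD; rewrite ler_distl => /andP[].
Qed.

Lemma smear_continuous V v D x : open V -> (forall y, V y -> {for y, continuous v}) ->
  0 < D -> disc x (9 * D) `<=` V -> {for x, continuous (smear V v D)}.
Proof.
move=> oV cv D0 DV.
have mV := open_measurable_plane oV.
have C0 := bump_mass_gt0 D0.
pose I f := \int[leb2]_(y in (V : set mplane)) (v y * f y).
apply: cvgM; last exact: cvg_cst.
apply/cvgrPdist_le => e e0.
have ki f : kernel_on x (9 * D) f ->
   leb2.-integrable (V : set mplane) (EFin \o (fun y => v y * f y)).
  exact: kernel_integrable.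
have subx x' : nsq (x' - x) <= D -> disc x' D `<=` disc x (9 * D).
  by move=> x'D; apply: disc_sub => //; lra.
have kx x' : nsq (x' - x) <= D -> kernel_on x (9 * D) (pbump 1 D x').
  by move=> x'D; apply: kernel_on_pbump; exact: subx.
have [W W0 HW] := kernel_bound oV cv DV.
have e10 : 0 < e / (W + 1) by rewrite divr_gt0// ltr_wpDl.
have near_d : \forall x' \near x, forall y, disc x (9 * D) y ->
    `|pbump 1 D x y - pbump 1 D x' y| <= e / (W + 1).
  have /compact_near_coveringP cov := @disc_compact R x (9 * D).
  apply: (cov _ (nbhs x) (fun x' y => is_true (`|pbump 1 D x y - pbump 1 D x' y| <= e / (W + 1)))).
  move=> y _.
  have c1 : (fun q : plane R * plane R => pbump 1 D x q.1 - pbump 1 D q.2 q.1) @ (nbhs y, nbhs x) -->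
     (pbump 1 D x y - pbump 1 D x y).
    have cf : (fun q : plane R * plane R => q.1) @ (nbhs y, nbhs x) --> y by exact: cvg_fst.
    have cs : (fun q : plane R * plane R => q.2) @ (nbhs y, nbhs x) --> x by exact: cvg_snd.
    apply: cvgB.
      by apply: (cvg_comp (fun q : plane R * plane R => q.1) (pbump 1 D x) cf); exact: pbump_continuous.
    apply: (cvg_comp (fun q : plane R * plane R => D - nsq (q.1 - q.2)) (flat 1));
      last exact: flat_continuous.
    by apply: cvgB; [exact: cvg_cst|apply: cvg_nsq; exact: cvgB].
  rewrite subrr in c1; move/cvgrPdist_le : c1 => /(_ _ e10).
  by apply: filterS => q; rewrite sub0r normrN.
have near_x := nsq_near x D0.
apply: filterS2 near_d near_x => x' dx' x'D.
have kx0 : kernel_on x (9 * D) (pbump 1 D x) by apply: kx; rewrite subrr /nsq/= expr0n addr0 ltW.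
have kd : kernel_on x (9 * D) (fun y => pbump 1 D x y + -1 * pbump 1 D x' y).
  by apply: kernel_onD => //; apply: kernel_onZ; exact: kx.
have dall y : `|pbump 1 D x y + -1 * pbump 1 D x' y| <= e / (W + 1).
  rewrite mulN1r; have [yD|yD] := leP (nsq (y - x)) (9 * D); first exact: dx'.
  by have [_ _ /(_ y yD)] := kd; rewrite mulN1r => ->; rewrite normr0 ltW.
have := HW _ _ kd (ltW e10) dall.
have -> : \int[leb2]_(y in (V : set mplane)) (v y * (pbump 1 D x y + -1 * pbump 1 D x' y)) =
   \int[leb2]_(y in (V : set mplane)) (v y * pbump 1 D x y) -
   \int[leb2]_(y in (V : set mplane)) (v y * pbump 1 D x' y).
  rewrite -RintegralB//; [|exact: ki|by apply: ki; exact: kx].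
  by apply: eq_Rintegral => y _; rewrite mulN1r mulrBr.
move/le_trans; apply; rewrite mulrAC ler_pdivrMr ?ltr_wpDl//.
by rewrite ler_wpM2l ?(ltW e0)// lerDl.
Qed.

End Smear2.

(** * Second order jets from below *)

Arguments cmul {R} x y : simpl never.
Arguments nsq {R} x : simpl never.
Arguments irot {R} x : simpl never.

Section Jets.
Context {R : realType}.
Implicit Types (z w h k a b : plane R) (p q u : plane R -> R) (m e : R).

(** Near z0 the function p lies above p z plus a real linear form, plus the real
    part of b k^2 (a traceless quadratic form), plus (m - e) |k|^2 for any e > 0, with
    coefficients bounded independently of the base point z.  No regularity of p is involved. *)
Definition jet p z0 m : Prop := exists (a b : plane R -> plane R) (C : R),
  (\forall z \near z0, nsq (a z) <= C /\ nsq (b z) <= C) /\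
  forall e, 0 < e -> \forall z \near z0 & k \near (0 : plane R),
    p z + (cmul (a z) k).1 + (cmul (b z) (cmul k k)).1 + (m - e) * nsq k <= p (z + k).

Lemma near2_l (z0 : plane R) (P : plane R -> Prop) : (\forall z \near z0, P z) ->
  \forall z \near z0 & k \near (0 : plane R), P z.
Proof.
move=> H; exists (P, setT); first by split => //; exact: filterT.
by move=> [z k] [].
Qed.

Lemma near2_r (z0 : plane R) (P : plane R -> Prop) : (\forall k \near (0 : plane R), P k) ->
  \forall z \near z0 & k \near (0 : plane R), P k.
Proof.
move=> H; exists (setT, P); first by split => //; exact: filterT.
by move=> [z k] [].
Qed.

Lemma near2_cvg (z0 z1 : plane R) (f : plane R * plane R -> plane R) (P : plane R -> Prop) :
  f @ (nbhs z0, nbhs (0 : plane R)) --> z1 -> (\forall z \near z1, P z) ->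
  \forall z \near z0 & k \near (0 : plane R), P (f (z, k)).
Proof.
move=> fz HP; have H : filter_prod (nbhs z0) (nbhs (0 : plane R)) (fun q : plane R * plane R => P (f q)) := fz _ HP.
by apply: filterS H => -[z k].
Qed.

Lemma cvg_fst2 (z0 : plane R) : (fun q : plane R * plane R => q.1) @ (nbhs z0, nbhs (0 : plane R)) --> z0.
Proof. exact: cvg_fst. Qed.

Lemma cvg_snd2 (z0 : plane R) : (fun q : plane R * plane R => q.2) @ (nbhs z0, nbhs (0 : plane R)) --> (0 : plane R).
Proof. exact: cvg_snd. Qed.

Lemma near2_add (z0 : plane R) (P : plane R -> Prop) : (\forall z \near z0, P z) ->
  \forall z \near z0 & k \near (0 : plane R), P (z + k).
Proof.
apply: (near2_cvg (f := fun q : plane R * plane R => q.1 + q.2)).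
rewrite -[X in _ --> X]addr0; apply: cvgD; [exact: cvg_fst2|exact: cvg_snd2].
Qed.

Lemma jet_germ p q z0 m : (\forall z \near z0, p z = q z) -> jet p z0 m -> jet q z0 m.
Proof.
move=> pq [a [b [C [HC H]]]]; exists a, b, C; split => // e /H He.
apply: filterS3 (near2_l pq) (near2_add pq) He => -[z k] /= E1 E2.
by rewrite E1 E2.
Qed.

Lemma jetW p z0 m m' : m' <= m -> jet p z0 m -> jet p z0 m'.
Proof.
move=> mm [a [b [C [HC H]]]]; exists a, b, C; split => // e /H He.
apply: filterS He => -[z k] /=; apply: le_trans.
by rewrite lerD2l ler_wpM2r ?nsq_ge0// lerD2r.
Qed.

Lemma jet_cst (c : R) z0 : jet (fun=> c) z0 0.
Proof.
exists (fun=> 0), (fun=> 0), 0; split.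
  have H z : nsq (0 : plane R) <= 0 /\ nsq (0 : plane R) <= 0.
    by rewrite /nsq/= expr0n addr0.
  by apply: (filterS _ filterT) => z _; exact: H.
move=> e e0; have H z k : c + (cmul (0 : plane R) k).1 + (cmul (0 : plane R) (cmul k k)).1 + (0 - e) * nsq k <= c.
  rewrite ?cmulE /=; have := mulr_ge0 (ltW e0) (nsq_ge0 k); lra.
by apply: (filterS _ filterT) => -[z k] _; exact: H.
Qed.

Lemma nsqD2 z w : nsq (z + w) <= 2 * nsq z + 2 * nsq w.
Proof.
have -> : 2 * nsq z + 2 * nsq w = nsq (z + w) + nsq (z - w) by rewrite /nsq/=; ring.
by rewrite lerDl nsq_ge0.
Qed.

Lemma jetD p q z0 m m' : jet p z0 m -> jet q z0 m' -> jet (fun z => p z + q z) z0 (m + m').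
Proof.
move=> [a [b [C [HC H]]]] [a' [b' [C' [HC' H']]]].
exists (fun z => a z + a' z), (fun z => b z + b' z), (2 * C + 2 * C'); split.
  apply: filterS2 HC HC' => z [h1 h2] [h3 h4].
  by split; apply: le_trans (nsqD2 _ _) _; lra.
move=> e e0; have e2 : 0 < e / 2 by rewrite divr_gt0.
apply: filterS2 (H _ e2) (H' _ e2) => -[z k] /=; rewrite ?cmulE/= => h1 h2.
have := lerD h1 h2; set n := nsq k; lra.
Qed.

Lemma jetZ (c : R) p z0 m : 0 <= c -> jet p z0 m -> jet (fun z => c * p z) z0 (c * m).
Proof.
move=> c0 [a [b [C [HC H]]]].
exists (fun z => c *: a z), (fun z => c *: b z), (c ^+ 2 * C).
have nZ (x : plane R) : nsq (c *: x) = c ^+ 2 * nsq x.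
  by rewrite /nsq /= /GRing.scale/=; ring.
split.
  by apply: filterS HC => z [h1 h2]; rewrite !nZ; split; rewrite ler_wpM2l ?sqr_ge0.
move=> e e0; have e2 : 0 < e / (c + 1) by rewrite divr_gt0// ltr_wpDl.
apply: filterS (H _ e2) => -[z k] /= h1.
have := ler_wpM2l c0 h1; apply: le_trans.
have ce : c * (e / (c + 1)) <= e.
  by rewrite mulrA ler_pdivrMr ?ltr_wpDl// mulrC ler_wpM2l ?(ltW e0)// lerDl.
have := ler_wpM2r (nsq_ge0 k) ce.
by rewrite ?cmulE /= /GRing.scale/=; set n := nsq k; lra.
Qed.

Lemma jet_max p q u z0 m : jet p z0 m -> jet q z0 m ->
  (\forall z \near z0, p z <= u z /\ q z <= u z /\ (u z = p z \/ u z = q z)) ->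
  jet u z0 m.
Proof.
move=> [a [b [C [HC H]]]] [a' [b' [C' [HC' H']]]] Hu.
exists (fun z => if u z == p z then a z else a' z), (fun z => if u z == p z then b z else b' z).
exists (Num.max C C'); split.
  apply: filterS2 HC HC' => z [h1 h2] [h3 h4].
  by case: ifPn => _; rewrite !le_max ?h1 ?h2 ?h3 ?h4 ?orbT.
move=> e e0.
apply: (filterS _ (filterI (filterI (H _ e0) (H' _ e0)) (filterI (near2_l Hu) (near2_add Hu)))).
move=> -[z k] /= [[h1 h2] [[_ [_ h3]] [h4 [h5 _]]]].
case: ifPn => [/eqP -> |ne]; first exact: le_trans h1 h4.
have -> : u z = q z by case: h3 => // h3; rewrite h3 eqxx in ne.
exact: le_trans h2 h5.
Qed.

Lemma cvg_irot0 : irot h @[h --> (0 : plane R)] --> (0 : plane R).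
Proof.
have e : irot (0 : plane R) = 0 by rewrite /irot/= oppr0.
rewrite -[X in _ --> X]e; apply: cvg_irot; exact: cvg_id.
Qed.

(** The linear and traceless parts cancel in four-point sums. *)
Lemma jet_submean p z0 m : jet p z0 m -> submean4 p z0 m.
Proof.
move=> [a [b [C [HC H]]]] e e0.
have He := H _ e0.
have pick (f : plane R -> plane R) : f h @[h --> (0 : plane R)] --> (0 : plane R) ->
    \forall z \near z0 & h \near (0 : plane R),
    p z + (cmul (a z) (f h)).1 + (cmul (b z) (cmul (f h) (f h))).1 + (m - e) * nsq (f h) <= p (z + f h).
  move=> f0; case: He => -[A B] /= [Az B0] AB.
  exists (A, f @^-1` B); first by split => //; exact: f0.
  by move=> [z h] [/= zA hB]; apply: (AB (z, f h)).
have c1 : h @[h --> (0 : plane R)] --> (0 : plane R) by exact: cvg_id.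
have c2 : - h @[h --> (0 : plane R)] --> (0 : plane R) by rewrite -[X in _ --> X]oppr0; exact: cvgN.
have c4 : - irot h @[h --> (0 : plane R)] --> (0 : plane R).
  by rewrite -[X in _ --> X]oppr0; apply: cvgN; exact: cvg_irot0.
have h1 := pick _ c1; have h2 := pick _ c2; have h3 := pick _ cvg_irot0; have h4 := pick _ c4.
apply: (filterS _ (filterI (filterI h1 h2) (filterI h3 h4))) => -[z h] /= [[k1 k2] [k3 k4]].
have nN (x : plane R) : nsq (- x) = nsq x by rewrite /nsq/=; ring.
rewrite !nN !nsq_irot in k1 k2 k3 k4.
have := lerD (lerD k1 k2) (lerD k3 k4).
have : (cmul (a z) h).1 + (cmul (a z) (- h)).1 + (cmul (a z) (irot h)).1 + (cmul (a z) (- irot h)).1 = 0.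
  by rewrite ?cmulE/=; ring.
have : (cmul (b z) (cmul h h)).1 + (cmul (b z) (cmul (- h) (- h))).1 +
  (cmul (b z) (cmul (irot h) (irot h))).1 + (cmul (b z) (cmul (- irot h) (- irot h))).1 = 0.
  by rewrite ?cmulE/=; ring.
set n := nsq h; clear; lra.
Qed.

Lemma submean4D p q z0 m m' : submean4 p z0 m -> submean4 q z0 m' ->
  submean4 (fun z => p z + q z) z0 (m + m').
Proof.
move=> hp hq e e0; have e2 : 0 < e / 2 by rewrite divr_gt0.
apply: filterS2 (hp _ e2) (hq _ e2) => -[z h] /= h1 h2.
by have := lerD h1 h2; set n := nsq h; lra.
Qed.

Lemma submean4_affine p (A B : plane R) s0 m : submean4 p (A + cmul s0 B) m ->
  submean4 (fun s => p (A + cmul s B)) s0 (m * nsq B).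
Proof.
move=> hp e e0; have e2 : 0 < e / (nsq B + 1) by rewrite divr_gt0// ltr_wpDl ?nsq_ge0.
case: (hp _ e2) => -[U1 U2] /= [Uz U0] UU.
have cA (s1 : plane R) : (fun s => A + cmul s B) @ s1 --> A + cmul s1 B.
  by apply: cvgD; [exact: cvg_cst|apply: cvg_cmul; [exact: cvg_id|exact: cvg_cst]].
have c0 : (fun h => cmul h B) @ (0 : plane R) --> (0 : plane R).
  rewrite [X in _ --> X](_ : 0 = cmul 0 B); last by rewrite cmulC cmul0.
  by apply: cvg_cmul; [exact: cvg_id|exact: cvg_cst].
exists ((fun s => A + cmul s B) @^-1` U1, (fun h => cmul h B) @^-1` U2).
  by split; [exact: cA|exact: c0].
move=> [s h] /= [sU hU].
have := UU (A + cmul s B, cmul h B) (conj sU hU); rewrite /= nsqM.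
have E (x : plane R) : A + cmul (s + x) B = A + cmul s B + cmul x B by rewrite cmulDl addrA.
have Er : cmul (irot h) B = irot (cmul h B) by rewrite cmulC irotM cmulC.
have EN (x : plane R) : cmul (- x) B = - cmul x B by rewrite cmulC cmulNr cmulC.
rewrite !E !EN Er; apply: le_trans; rewrite ler_wpM2l// lerD2l.
have ce : e / (nsq B + 1) * nsq B <= e.
  by rewrite mulrAC ler_pdivrMr ?ltr_wpDl ?nsq_ge0// ler_wpM2l ?(ltW e0)// lerDl.
have := ler_wpM2l (nsq_ge0 h) ce; rewrite !mulrA.
by set n := nsq h; set B2 := nsq B; lra.
Qed.

End Jets.

(** * Jets of logarithms, squares and harmonic quadratics *)

Arguments cmul {R} x y : simpl never.
Arguments nsq {R} x : simpl never.
Arguments irot {R} x : simpl never.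

Section SpecialJets.
Context {R : realType}.
Implicit Types (z w h k : plane R) (m e : R).

Lemma ln1_bound (y : R) : `|y| <= 1 / 2 ->
  `|ln (1 + y) - (y - y ^+ 2 / 2)| <= 2 * `|y| ^+ 3.
Proof.
move=> y2.
have y3 : - (1 / 2) <= y <= 1 / 2 by rewrite -ler_norml.
have rng (z : R) : Num.min 0 y <= z <= Num.max 0 y -> (- (1 / 2) <= z) /\ `|z| <= `|y|.
  have [y0|y0] := leP 0 y => /andP[z1 z2].
    by rewrite !ger0_norm//; split => //; lra.
  by rewrite !ler0_norm ?(ltW y0)//; split; lra.
have := @mvt_bound R (fun t => ln (1 + t) + (- 1 * t + 2^-1 * (t * t)))
   (fun t => (1 + t)^-1 + (- 1 + t)) (2 * `|y| ^+ 2) 0 y.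
rewrite addr0 ln1 !mulr0 !addr0 !subr0 => H.
have -> : ln (1 + y) - (y - y ^+ 2 / 2) = ln (1 + y) + (-1 * y + 2^-1 * (y * y)) by field.
have -> : 2 * `|y| ^+ 3 = 2 * `|y| ^+ 2 * `|y| by ring.
apply: H => /= z /rng[z1 zy].
  have p1 : 0 < 1 + z by lra.
  have d0 : is_derive z (1 : R) (fun t : R => 1 + t) 1.
    by apply: is_derive_eq (is_derive_add (is_derive_cst (1 : R) _ _) (is_derive_id _ _)) _; rewrite add0r.
  have d1 : is_derive z (1 : R) (fun t => ln (1 + t)) ((1 + z)^-1).
    have := @is_derive_comp1 R _ (@ln R) (fun t : R => 1 + t) z 1 1 (1 + z)^-1 d0 (is_derive1_ln p1).
    by rewrite mulr1.
  have d2 : is_derive z (1 : R) (fun t : R => t * t) (z + z).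
    by apply: is_derive_eq (is_derive_mul (is_derive_id z (1 : R)) (is_derive_id z (1 : R))) _; rewrite mulr1.
  have d3 := is_derive_mul (is_derive_cst (- 1 : R) z (1 : R)) (is_derive_id z (1 : R)).
  have d4 := is_derive_mul (is_derive_cst (2^-1 : R) z (1 : R)) d2.
  apply: is_derive_eq (is_derive_add d1 (is_derive_add d3 d4)) _.
  by rewrite /cst !mulr0 !addr0 mulr1; congr (_ + _); clear; field.
have p1 : 0 < 1 + z by lra.
have -> : (1 + z)^-1 + (- 1 + z) = z ^+ 2 / (1 + z) by field; rewrite gt_eqF.
rewrite normrM normrX normfV (gtr0_norm p1) ler_pdivrMr//.
have : `|z| ^+ 2 <= `|y| ^+ 2 by rewrite ler_pXn2r ?nnegrE.
have := sqr_ge0 `|y|; set Y := `|y| ^+ 2; set Z := `|z| ^+ 2 => Y0 ZY.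
by rewrite (le_trans ZY)// mulrAC -[leLHS]mul1r ler_wpM2r//; lra.
Qed.

(** The complex number 1. *)
Definition one_c : plane R := (1, 0).

(** ln |1 + z|^2 = 2 Re z - Re z^2 + O(|z|^3); the second order part is traceless,
    which is the harmonicity of ln |.|^2. *)
Lemma ln_taylor (z : plane R) (d : R) : 0 < d -> d <= 8^-1 -> nsq z <= d ^+ 2 ->
  `|ln (nsq (one_c + z)) - (2 * z.1 - (z.1 ^+ 2 - z.2 ^+ 2))| <= 63 * d * nsq z.
Proof.
move=> d0 d8 zd; set n := nsq z.
have n0 : 0 <= n := nsq_ge0 z.
have z1d : `|z.1| <= d.
  rewrite -(@ler_pXn2r _ 2) ?nnegrE ?(ltW d0)// real_normK ?num_real// (le_trans _ zd)//.
  by rewrite /nsq lerDl sqr_ge0.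
pose y := 2 * z.1 + n.
have E : nsq (one_c + z) = 1 + y by rewrite /nsq /y /n /nsq /=; ring.
have nd : n <= d by rewrite (le_trans zd)// expr2 ler_piMr ?(ltW d0)//; lra.
have y3 : `|y| <= 3 * d.
  rewrite /y (le_trans (ler_normD _ _))// normrM (ger0_norm n0) ger0_norm//.
  by move: z1d nd; clear; lra.
have y2 : `|y| <= 1 / 2 by apply: le_trans y3 _; move: d8; clear; lra.
have ysq : `|y| ^+ 2 <= 10 * n.
  rewrite real_normK ?num_real//.
  have z1n : z.1 ^+ 2 <= n by rewrite /n /nsq lerDl sqr_ge0.
  have nn : n ^+ 2 <= n by rewrite expr2 ler_piMr//; lra.
  have e1 : 8 * z.1 ^+ 2 + 2 * n ^+ 2 = y ^+ 2 + (2 * z.1 - n) ^+ 2 by rewrite /y; ring.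
  by have := sqr_ge0 (2 * z.1 - n); move: e1 z1n nn; clear; lra.
have c3 : 2 * `|y| ^+ 3 <= 60 * d * n.
  have -> : 2 * `|y| ^+ 3 = 2 * (`|y| ^+ 2 * `|y|) by ring.
  have -> : 60 * d * n = 2 * ((10 * n) * (3 * d)) by ring.
  by rewrite ler_wpM2l// ler_pM// exprn_ge0.
have L := ln1_bound y2; rewrite E.
have -> : ln (1 + y) - (2 * z.1 - (z.1 ^+ 2 - z.2 ^+ 2)) =
  (ln (1 + y) - (y - y ^+ 2 / 2)) + - (2 * z.1 * n + n * n / 2).
  by rewrite /y /n /nsq; field.
apply: le_trans (ler_normD _ _) _; rewrite normrN.
have r1 : `|2 * z.1 * n + n * n / 2| <= 3 * d * n.
  rewrite (le_trans (ler_normD _ _))//.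
  have -> : `|2 * z.1 * n| = 2 * (`|z.1| * n) by rewrite !normrM (ger0_norm n0) ger0_norm// mulrA.
  have -> : `|n * n / 2| = n * n / 2 by rewrite ger0_norm// divr_ge0// mulr_ge0.
  have h1 : `|z.1| * n <= d * n by rewrite ler_wpM2r.
  have h2 : n * n <= d * n by rewrite ler_wpM2r.
  have h3 : 0 <= d * n by rewrite mulr_ge0 ?(ltW d0).
  by move: h1 h2 h3; clear; lra.
have h4 := le_trans L c3.
apply: le_trans (lerD h4 r1) _; clear; lra.
Qed.

Lemma cmulA (x y z : plane R) : cmul x (cmul y z) = cmul (cmul x y) z.
Proof. by rewrite !cmulE/=; congr pair; ring. Qed.

Lemma cmul1 (x : plane R) : cmul one_c x = x.
Proof. by case: x => x1 x2; rewrite !cmulE/=; congr pair; ring. Qed.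

Lemma cinvK (z : plane R) : z != 0 -> cmul z (cinv z) = one_c.
Proof.
move=> z0; have n0 : nsq z != 0 by rewrite nsq_eq0.
rewrite cinvE cmulE /=; congr pair; last by rewrite mulrN; field.
by rewrite mulrN opprK !mulrA -mulrDl -!expr2 -/(nsq z) divff.
Qed.

Lemma nsq_one_c : nsq one_c = 1 :> R.
Proof. by rewrite /nsq/= expr1n expr0n addr0. Qed.

Lemma nsq_cinv (z : plane R) : nsq (cinv z) = (nsq z)^-1.
Proof.
have [->|z0] := eqVneq z 0.
  by rewrite cinvE /nsq /= !mul0r expr0n/= oppr0 expr0n/= addr0 invr0.
have n0 : nsq z != 0 by rewrite nsq_eq0.
by apply: (mulfI n0); rewrite -nsqM cinvK// nsq_one_c divff.
Qed.

Lemma ln_nsq_add (z k : plane R) : z != 0 -> one_c + cmul (cinv z) k != 0 ->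
  ln (nsq (z + k)) = ln (nsq z) + ln (nsq (one_c + cmul (cinv z) k)).
Proof.
move=> z0 k0; rewrite -lnM ?posrE ?nsq_gt0//.
by rewrite -nsqM cmulDr cmulA cinvK// cmul1 cmulC cmul1.
Qed.

Lemma cvg_cinv {T} {F : set_system T} {FF : Filter F} (f : T -> plane R) (z : plane R) :
  z != 0 -> f @ F --> z -> (fun t => cinv (f t)) @ F --> cinv z.
Proof.
move=> z0 fz; have n0 : nsq z != 0 by rewrite nsq_eq0.
have f1 : (fun t => (f t).1) @ F --> z.1 by exact: cvg_fst_comp.
have f2 : (fun t => (f t).2) @ F --> z.2 by exact: cvg_snd_comp.
have fn : (fun t => (nsq (f t))^-1) @ F --> (nsq z)^-1 by apply: cvgV => //; exact: cvg_nsq.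
rewrite (_ : (fun t => cinv (f t)) = fun t => ((f t).1 / nsq (f t), - ((f t).2 / nsq (f t)))).
  by rewrite cinvE; apply: cvg_mkpair; [exact: cvgM|apply: cvgN; exact: cvgM].
by apply/funext => t; rewrite cinvE.
Qed.

Lemma jet_ln z0 : z0 != 0 -> jet (fun z => ln (nsq z)) z0 0.
Proof.
move=> z00; have n0 : 0 < nsq z0 by rewrite nsq_gt0.
have nn : \forall z \near z0, nsq z0 / 2 < nsq z.
  have c : nsq z @[z --> z0] --> nsq z0 by exact: nsq_continuous.
  by apply: (cvgr_gt _ c); rewrite ltr_pdivrMr// ltr_pMr// ltr1n.
pose B := (nsq z0 / 2)^-1.
have B0 : 0 < B by rewrite invr_gt0 divr_gt0.
have iB z : nsq z0 / 2 < nsq z -> z != 0 /\ nsq (cinv z) <= B.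
  move=> zn; have nz : 0 < nsq z by apply: lt_trans zn; rewrite divr_gt0.
  by split; [rewrite -nsq_gt0|rewrite nsq_cinv lef_pV2 ?posrE ?divr_gt0// ltW].
exists (fun z => 2 *: cinv z), (fun z => - cmul (cinv z) (cinv z)), (4 * B + B ^+ 2); split.
  apply: filterS nn => z /iB[_ zB].
  have -> : nsq (2 *: cinv z) = 4 * nsq (cinv z) by rewrite /nsq /= /GRing.scale/=; ring.
  have -> (x : plane R) : nsq (- x) = nsq x by rewrite /nsq/=; ring.
  rewrite nsqM; have c0 := nsq_ge0 (cinv z).
  have : nsq (cinv z) * nsq (cinv z) <= B ^+ 2 by rewrite expr2 ler_pM.
  have : 0 <= B ^+ 2 by exact: sqr_ge0.
  by move: zB B0; clear; lra.
move=> e e0.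
pose d := Num.min (8^-1) (e / (63 * B)).
have d0 : 0 < d by rewrite lt_min invr_gt0 ltr0n/= divr_gt0// mulr_gt0.
have d8 : d <= 8^-1 by rewrite ge_min lexx.
have de : 63 * d * B <= e.
  by rewrite mulrAC -ler_pdivlMl ?mulr_gt0// mulrC ge_min lexx orbT.
have nk : \forall k \near (0 : plane R), nsq k < d ^+ 2 / B.
  have c : nsq k @[k --> (0 : plane R)] --> nsq (0 : plane R) by exact: nsq_continuous.
  by apply: (cvgr_lt _ c); rewrite /nsq/= expr0n addr0 divr_gt0// exprn_gt0.
apply: filterS2 (near2_l nn) (near2_r z0 nk) => -[z k] /= /iB[zn0 zB] kd.
pose t := cmul (cinv z) k.
have tB : nsq t <= B * nsq k by rewrite /t nsqM ler_wpM2r ?nsq_ge0.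
have td : nsq t <= d ^+ 2 by rewrite (le_trans tB)// mulrC -ler_pdivlMr// ltW.
have t1 : one_c + t != 0.
  apply/eqP => t1; have : t = - one_c by apply/eqP; rewrite -addr_eq0 addrC t1.
  move=> tc; move: td; rewrite tc; have -> : nsq (- one_c) = 1 :> R by rewrite /nsq/=; ring.
  apply/negP; rewrite -ltNge expr2 (le_lt_trans (y := d * 1))//; last by move: d8; clear; lra.
  by rewrite ler_wpM2l ?(ltW d0)//; move: d8; clear; lra.
change (ln (nsq z) + (cmul (2 *: cinv z) k).1 + (cmul (- cmul (cinv z) (cinv z)) (cmul k k)).1 +
  (0 - e) * nsq k <= ln (nsq (z + k))).
rewrite ln_nsq_add//.
have := ln_taylor d0 d8 td; rewrite ler_distl => /andP[lo _].
have e1 : (cmul (2 *: cinv z) k).1 = 2 * t.1 by rewrite /t !cmulE/= /GRing.scale/=; ring.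
have e2 : (cmul (- cmul (cinv z) (cinv z)) (cmul k k)).1 = - (t.1 ^+ 2 - t.2 ^+ 2).
  by rewrite /t !cmulE/=; ring.
rewrite e1 e2 -/t.
have b1 : 63 * d * nsq t <= e * nsq k.
  apply: le_trans (ler_wpM2l _ tB) _; first by rewrite mulr_ge0 ?(ltW d0).
  by rewrite mulrA ler_wpM2r ?nsq_ge0.
move: lo b1; move: (ln (nsq z)) (ln _) (63 * d * nsq t) (nsq k) => *; lra.
Qed.

Lemma jet_shift p z0 c m : jet p (z0 - c) m -> jet (fun z => p (z - c)) z0 m.
Proof.
move=> [a [b [C [HC H]]]].
have cc : z - c @[z --> z0] --> z0 - c by apply: cvgB; [exact: cvg_id|exact: cvg_cst].
exists (fun z => a (z - c)), (fun z => b (z - c)), C; split; first exact: (cc _ HC).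
move=> e /H; case=> -[A B] /= [Az B0] AB.
exists ((fun z => z - c) @^-1` A, B); first by split => //; exact: cc.
move=> [z k] [/= zA kB]; have e2 : z + k - c = z - c + k by rewrite addrAC.
rewrite e2; exact: (AB (z - c, k) (conj zA kB)).
Qed.

Lemma jet_quad (B c z0 : plane R) : jet (fun z => (cmul B (cmul (z - c) (z - c))).1) z0 0.
Proof.
apply: (jet_shift (p := fun z => (cmul B (cmul z z)).1)); set z1 := z0 - c.
exists (fun z => 2 *: cmul B z), (fun=> B), (4 * nsq B * (nsq z1 + 1) + nsq B); split.
  have c1 : nsq z @[z --> z1] --> nsq z1 by exact: nsq_continuous.
  have H : \forall z \near z1, nsq z < nsq z1 + 1 by apply: (cvgr_lt _ c1); rewrite ltrDl.
  apply: filterS H => z zn.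
  have -> : nsq (2 *: cmul B z) = 4 * nsq B * nsq z.
    by rewrite -mulrA -nsqM /nsq /= /GRing.scale/=; ring.
  have B0 := nsq_ge0 B; have n1 := nsq_ge0 z1; split.
    by rewrite ler_wpDr// ler_wpM2l ?mulr_ge0// ltW.
  have c0 : 0 <= 4 * nsq B * (nsq z1 + 1) by apply: mulr_ge0; [exact: mulr_ge0|exact: addr_ge0].
  by rewrite lerDr.
move=> e e0; apply: (filterS _ filterT) => -[z k] _ /=.
change ((cmul B (cmul z z)).1 + (cmul (2 *: cmul B z) k).1 + (cmul B (cmul k k)).1 +
  (0 - e) * nsq k <= (cmul B (cmul (z + k) (z + k))).1).
have -> : (cmul B (cmul (z + k) (z + k))).1 = (cmul B (cmul z z)).1 + (cmul (2 *: cmul B z) k).1 + (cmul B (cmul k k)).1.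
  by rewrite !cmulE /= /GRing.scale/=; ring.
by rewrite gerDl sub0r mulNr oppr_le0 mulr_ge0 ?(ltW e0)// nsq_ge0.
Qed.

(** The square of the positive part is below its second order expansion. *)
Lemma sq_pos_part (l d : R) :
  (Num.max 0 (l + d)) ^+ 2 <= (Num.max 0 l) ^+ 2 + 2 * Num.max 0 l * d + d ^+ 2.
Proof.
have e : (Num.max 0 l) ^+ 2 + 2 * Num.max 0 l * d + d ^+ 2 = (Num.max 0 l + d) ^+ 2 by ring.
rewrite e; have [ld|ld] := leP 0 (l + d); last by rewrite expr0n sqr_ge0.
have : l <= Num.max 0 l by rewrite le_max lexx orbT.
by move=> h; rewrite ler_pXn2r ?nnegrE//; lra.
Qed.

Lemma jet_neg_sq_pos (al b1 b2 : R) z0 :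
  jet (fun z => - (Num.max 0 (al + b1 * z.1 + b2 * z.2)) ^+ 2) z0 (- ((b1 ^+ 2 + b2 ^+ 2) / 2)).
Proof.
pose l (z : plane R) := al + b1 * z.1 + b2 * z.2.
pose lp z := Num.max 0 (l z).
have cl : continuous l.
  move=> z; apply: cvgD; last by apply: cvgM; [exact: cvg_cst|exact: snd_continuous].
  by apply: cvgD; [exact: cvg_cst|apply: cvgM; [exact: cvg_cst|exact: fst_continuous]].
pose C := `|l z0| + 1.
have nC : \forall z \near z0, lp z <= C.
  have H : \forall z \near z0, l z < C.
    by apply: (cvgr_lt _ (cl z0)); rewrite /C (le_lt_trans (ler_norm _))// ltrDl.
  apply: filterS H => z lz; rewrite /lp ge_max (ltW lz) andbT /C.
  by rewrite addr_ge0.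
exists (fun z => (- 2 * lp z * b1, 2 * lp z * b2)), (fun=> (- (b1 ^+ 2 - b2 ^+ 2) / 2, b1 * b2)).
exists (4 * C ^+ 2 * (b1 ^+ 2 + b2 ^+ 2) + nsq (- (b1 ^+ 2 - b2 ^+ 2) / 2, b1 * b2)); split.
  apply: filterS nC => z lC.
  have l0 : 0 <= lp z by rewrite /lp le_max lexx.
  have l2 : lp z ^+ 2 <= C ^+ 2 by rewrite ler_pXn2r ?nnegrE// (le_trans l0).
  have B0 : 0 <= b1 ^+ 2 + b2 ^+ 2 by rewrite addr_ge0 ?sqr_ge0.
  split; last by rewrite lerDr mulr_ge0// mulr_ge0 ?sqr_ge0.
  have -> : nsq (- 2 * lp z * b1, 2 * lp z * b2) = 4 * lp z ^+ 2 * (b1 ^+ 2 + b2 ^+ 2).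
    by rewrite /nsq/=; ring.
  by rewrite ler_wpDr ?nsq_ge0// ler_wpM2r// ler_wpM2l.
move=> e e0; apply: (filterS _ filterT) => -[z k] _ /=.
have := sq_pos_part (l z) (b1 * k.1 + b2 * k.2).
have -> : l z + (b1 * k.1 + b2 * k.2) = al + b1 * (z.1 + k.1) + b2 * (z.2 + k.2) by rewrite /l; ring.
rewrite -/(l z) -/(lp z); set X := Num.max 0 _ ^+ 2.
have e2 : 0 <= e * nsq k by rewrite mulr_ge0 ?(ltW e0)// nsq_ge0.
rewrite ?cmulE /=; move: e2; rewrite /nsq => e2 h; rewrite -subr_ge0.
set L := lp z in h *.
have -> : - X - (- L ^+ 2 + (-2 * L * b1 * k.1 - 2 * L * b2 * k.2) +
   (- (b1 ^+ 2 - b2 ^+ 2) / 2 * (k.1 * k.1 - k.2 * k.2) - b1 * b2 * (k.1 * k.2 + k.2 * k.1)) +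
   (- ((b1 ^+ 2 + b2 ^+ 2) / 2) - e) * (k.1 ^+ 2 + k.2 ^+ 2)) =
  (L ^+ 2 + 2 * L * (b1 * k.1 + b2 * k.2) + (b1 * k.1 + b2 * k.2) ^+ 2 - X) + e * (k.1 ^+ 2 + k.2 ^+ 2).
  by field.
by rewrite addr_ge0// subr_ge0.
Qed.

Lemma jet_neg_sq_disc (b z0 : plane R) (u0 r2 : R) : 0 <= u0 -> nsq (z0 - b) < r2 ->
  jet (fun z => - (Num.max 0 (nsq (z - b) - u0)) ^+ 2) z0 (- (4 * r2)).
Proof.
move=> u00; set z1 := z0 - b => z1r.
apply: (jet_shift (p := fun z => - (Num.max 0 (nsq z - u0)) ^+ 2)); rewrite -/z1.
pose lp (z : plane R) := Num.max 0 (nsq z - u0).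
have r0 : 0 < r2 := le_lt_trans (nsq_ge0 z1) z1r.
have nr : \forall z \near z1, nsq z < r2.
  have c1 : nsq z @[z --> z1] --> nsq z1 by exact: nsq_continuous.
  exact: (cvgr_lt _ c1).
have lpr z : nsq z < r2 -> 0 <= lp z /\ lp z <= r2.
  move=> zr; split; first by rewrite /lp le_max lexx.
  by rewrite /lp ge_max (ltW r0)/=; lra.
exists (fun z => (- 4 * lp z * z.1, 4 * lp z * z.2)).
exists (fun z => (- 2 * (z.1 ^+ 2 - z.2 ^+ 2), 4 * z.1 * z.2)).
exists (16 * r2 ^+ 2 * r2 + 4 * r2 ^+ 2); split.
  apply: filterS nr => z zr; have [l0 lr] := lpr z zr; have n0 := nsq_ge0 z.
  have l2 : lp z ^+ 2 <= r2 ^+ 2 by rewrite ler_pXn2r ?nnegrE// (le_trans l0).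
  have n2 : nsq z ^+ 2 <= r2 ^+ 2 by rewrite ler_pXn2r ?nnegrE ?(ltW r0)// ltW.
  have s0 : 0 <= r2 ^+ 2 by exact: sqr_ge0.
  split.
    have -> : nsq (- 4 * lp z * z.1, 4 * lp z * z.2) = 16 * lp z ^+ 2 * nsq z.
      by rewrite /nsq/=; ring.
    apply: ler_wpDr; first by rewrite mulr_ge0.
    by apply: ler_pM; rewrite ?mulr_ge0 ?sqr_ge0// ?ler_wpM2l// ltW.
  have -> : nsq (- 2 * (z.1 ^+ 2 - z.2 ^+ 2), 4 * z.1 * z.2) = 4 * nsq z ^+ 2.
    by rewrite /nsq/=; ring.
  by rewrite ler_wpDl ?ler_wpM2l// mulr_ge0 ?(ltW r0)// mulr_ge0.
move=> e e0.
have small : \forall z \near z1 & k \near (0 : plane R), 4 * (z.1 * k.1 + z.2 * k.2) + nsq k < e.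
  have c : (fun q : plane R * plane R => 4 * (q.1.1 * q.2.1 + q.1.2 * q.2.2) + nsq q.2) @
      (nbhs z1, nbhs (0 : plane R)) --> 4 * (z1.1 * 0 + z1.2 * 0) + nsq (0 : plane R).
    have cz := @cvg_fst2 R z1; have ck := @cvg_snd2 R z1.
    apply: cvgD; last exact: cvg_nsq.
    apply: cvgM; first exact: cvg_cst.
    apply: cvgD; apply: cvgM.
    - exact: cvg_fst_comp cz.
    - exact: (cvg_fst_comp ck).
    - exact: cvg_snd_comp cz.
    - exact: (cvg_snd_comp ck).
  have H : filter_prod (nbhs z1) (nbhs (0 : plane R)) (fun q : plane R * plane R =>
     4 * (q.1.1 * q.2.1 + q.1.2 * q.2.2) + nsq q.2 < e).
    by apply: (cvgr_lt _ c); rewrite /nsq/= !mulr0 expr0n !addr0 mulr0.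
  by apply: filterS H => -[z k].
apply: filterS2 (near2_l nr) small => -[z k] /= zr sm.
have [l0 lr] := lpr z zr.
have k0 := nsq_ge0 k.
have := sq_pos_part (nsq z - u0) (2 * (z.1 * k.1 + z.2 * k.2) + nsq k).
have -> : nsq z - u0 + (2 * (z.1 * k.1 + z.2 * k.2) + nsq k) = nsq (z + k) - u0 by rewrite /nsq/=; ring.
rewrite -/(lp z); set X := Num.max 0 _ ^+ 2; set L := lp z in l0 lr *.
have Ln : L <= nsq z.
  by rewrite /L /lp ge_max nsq_ge0/= gerBl.
have s1 : (4 * (z.1 * k.1 + z.2 * k.2) + nsq k) * nsq k <= e * nsq k by rewrite ler_wpM2r// ltW.
have s2 : (2 * L + 2 * nsq z) * nsq k <= 4 * r2 * nsq k.
  by rewrite ler_wpM2r//; move: Ln zr; clear; lra.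
rewrite ?cmulE /= => h; rewrite -subr_ge0.
have -> : - X - (- L ^+ 2 + (- 4 * L * z.1 * k.1 - 4 * L * z.2 * k.2) +
   (- 2 * (z.1 ^+ 2 - z.2 ^+ 2) * (k.1 * k.1 - k.2 * k.2) - 4 * z.1 * z.2 * (k.1 * k.2 + k.2 * k.1)) +
   (- (4 * r2) - e) * nsq k) =
   (L ^+ 2 + 2 * L * (2 * (z.1 * k.1 + z.2 * k.2) + nsq k) +
     (2 * (z.1 * k.1 + z.2 * k.2) + nsq k) ^+ 2 - X) +
   (4 * r2 * nsq k - (2 * L + 2 * nsq z) * nsq k) +
   (e * nsq k - (4 * (z.1 * k.1 + z.2 * k.2) + nsq k) * nsq k).
  by rewrite /nsq; ring.
by apply: addr_ge0; [apply: addr_ge0|]; rewrite subr_ge0.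
Qed.

End SpecialJets.

(** * Jets in the chart at infinity *)

Arguments cmul {R} x y : simpl never.
Arguments nsq {R} x : simpl never.
Arguments irot {R} x : simpl never.

Section JetInversion.
Context {R : realType}.
Implicit Types (z w h k u : plane R) (p : plane R -> R) (m e : R).

Lemma cinv_sub w h : w != 0 -> w + h != 0 ->
  cinv (w + h) - cinv w = - cmul h (cmul (cinv w) (cinv (w + h))).
Proof.
move=> w0 wh0; have e1 := cinvK w0; have e2 := cinvK wh0.
set u := cinv w in e1 *; set v := cinv (w + h) in e2 *.
have -> : cmul h (cmul u v) = cmul u (cmul (w + h) v) - cmul v (cmul w u).
  by rewrite !cmulE/=; congr pair => /=; ring.
by rewrite e1 e2 cmulC cmul1 [cmul v _]cmulC cmul1 opprB.
Qed.

Lemma fst_lower (x : plane R) (c : R) : 0 <= c -> nsq x <= c ^+ 2 -> - c <= x.1.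
Proof.
move=> c0 xc; have : `|x.1| <= c.
  rewrite -(@ler_pXn2r _ 2) ?nnegrE// real_normK ?num_real// (le_trans _ xc)//.
  by rewrite /nsq lerDl sqr_ge0.
by rewrite ler_norml => /andP[].
Qed.

(** With v = 1 / (w + h) and u = 1 / w, the increment v - u expanded to second order. *)
Lemma cinv_increment (h u v : plane R) : v = u - cmul h (cmul u v) ->
  - cmul h (cmul u v) = - cmul h (cmul u u) + cmul (cmul h h) (cmul (cmul u u) u) +
    - cmul (cmul h (cmul h h)) (cmul (cmul (cmul u u) u) v).
Proof.
move=> vE.
have s1 : - cmul h (cmul u v) = - cmul h (cmul u u) + cmul h (cmul u (cmul h (cmul u v))).
  transitivity (- cmul h (cmul u (u - cmul h (cmul u v)))); first by rewrite -vE.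
  by rewrite !cmulDr !cmulNr opprD opprK.
have s2 : cmul h (cmul u (cmul h (cmul u v))) = cmul (cmul h h) (cmul (cmul u u) v).
  by rewrite !cmulA; congr cmul; rewrite -!cmulA; congr cmul; rewrite !cmulA [cmul u h]cmulC.
have s3 : cmul (cmul h h) (cmul (cmul u u) v) = cmul (cmul h h) (cmul (cmul u u) u) -
    cmul (cmul h (cmul h h)) (cmul (cmul (cmul u u) u) v).
  rewrite {1}vE !cmulDr !cmulNr; congr (_ - _).
  rewrite [cmul (cmul u u) (cmul h _)]cmulA [cmul (cmul u u) h]cmulC -!cmulA.
  by congr cmul; rewrite !cmulA.
by rewrite s1 s2 s3 addrA.
Qed.

Lemma cinv_increment_sq (h u v : plane R) : cmul h (cmul u v) = u - v ->
  cmul (- cmul h (cmul u v)) (- cmul h (cmul u v)) =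
    cmul (cmul h h) (cmul (cmul u u) (cmul u u)) +
    cmul (- cmul h (cmul u (v + u))) (cmul (cmul h h) (cmul (cmul u u) v)).
Proof.
move=> uvE; set k := - cmul h (cmul u v).
have s1 : k + cmul h (cmul u u) = cmul (cmul h h) (cmul (cmul u u) v).
  transitivity (cmul h (cmul u (u - v))); first by rewrite /k !cmulDr !cmulNr addrC.
  by rewrite -uvE; clear; rewrite !cmulE /=; congr pair => /=; ring.
have s2 : k - cmul h (cmul u u) = - cmul h (cmul u (v + u)).
  by rewrite /k !cmulDr opprD.
have sqd (x y : plane R) : cmul x x = cmul y y + cmul (x - y) (x + y).
  by rewrite !cmulE /=; congr pair => /=; ring.
rewrite -s1 -s2 (sqd k (cmul h (cmul u u))); congr (_ + _).
by clear; rewrite !cmulE /=; congr pair => /=; ring.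
Qed.

(** Jets in the coordinate w = 1 / z.  The increment of 1 / w is
    - h / w^2 + h^2 / w^3 + O(h^3), so that the linear part feeds the traceless part
    and the coefficient m is divided by |w0|^4. *)
Lemma jet_inv p w0 m : w0 != 0 -> jet p (cinv w0) m ->
  jet (fun w => p (cinv w)) w0 (m / nsq w0 ^+ 2).
Proof.
move=> w00 [a [b [C0 [HC0 H]]]]; have n0 : 0 < nsq w0 by rewrite nsq_gt0.
pose C := `|C0| + 1; have C1 : 0 < C by rewrite ltr_wpDl.
have HC : \forall z \near cinv w0, nsq (a z) <= C /\ nsq (b z) <= C.
  have CC : C0 <= C by rewrite (le_trans (ler_norm _))// lerDl.
  by apply: filterS HC0 => z [h1 h2]; split; exact: le_trans CC.
have nn : \forall w \near w0, nsq w0 / 2 < nsq w.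
  have c : nsq z @[z --> w0] --> nsq w0 by exact: nsq_continuous.
  by apply: (cvgr_gt _ c); rewrite ltr_pdivrMr// ltr_pMr// ltr1n.
pose B := (nsq w0 / 2)^-1.
have B0 : 0 < B by rewrite invr_gt0 divr_gt0.
have iB w : nsq w0 / 2 < nsq w -> w != 0 /\ nsq (cinv w) <= B.
  move=> zn; have nz : 0 < nsq w by apply: lt_trans zn; rewrite divr_gt0.
  by split; [rewrite -nsq_gt0|rewrite nsq_cinv lef_pV2 ?posrE ?divr_gt0// ltW].
have ccinv : cinv w @[w --> w0] --> cinv w0 by apply: cvg_cinv => //; exact: cvg_id.
pose u2 w : plane R := cmul (cinv w) (cinv w).
pose u3 w := cmul (u2 w) (cinv w).
pose u4 w := cmul (u2 w) (u2 w).
exists (fun w => - cmul (a (cinv w)) (u2 w)).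
exists (fun w => cmul (a (cinv w)) (u3 w) + cmul (b (cinv w)) (u4 w)).
exists (C * B ^+ 2 + (2 * (C * B ^+ 3) + 2 * (C * B ^+ 4))); split.
  apply: filterS2 nn (ccinv _ HC) => w /iB[w0' uB] [aC bC].
  have nN (x : plane R) : nsq (- x) = nsq x by rewrite /nsq/=; ring.
  have c0 := nsq_ge0 (cinv w).
  have p2 : nsq (u2 w) <= B ^+ 2 by rewrite /u2 nsqM expr2 ler_pM.
  have p3 : nsq (u3 w) <= B ^+ 3 by rewrite /u3 nsqM exprSr ler_pM// nsq_ge0.
  have p4 : nsq (u4 w) <= B ^+ 4.
    have -> : B ^+ 4 = B ^+ 2 * B ^+ 2 by ring.
    by rewrite /u4 nsqM; apply: ler_pM => //; exact: nsq_ge0.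
  have q2 : nsq (cmul (a (cinv w)) (u2 w)) <= C * B ^+ 2 by rewrite nsqM ler_pM// nsq_ge0.
  have q3 : nsq (cmul (a (cinv w)) (u3 w)) <= C * B ^+ 3 by rewrite nsqM ler_pM// nsq_ge0.
  have q4 : nsq (cmul (b (cinv w)) (u4 w)) <= C * B ^+ 4 by rewrite nsqM ler_pM// nsq_ge0.
  have g2 : 0 <= C * B ^+ 2 by rewrite mulr_ge0 ?sqr_ge0// ltW.
  have g3 : 0 <= C * B ^+ 3 by rewrite mulr_ge0 ?exprn_ge0// ltW.
  have g4 : 0 <= C * B ^+ 4 by rewrite mulr_ge0 ?exprn_ge0// ltW.
  rewrite nN; split; first by move: q2 g3 g4; clear; lra.
  by apply: le_trans (nsqD2 _ _) _; move: q3 q4 g2; clear; lra.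
move=> e e0.
pose N := (nsq w0 ^+ 2)^-1.
have N0 : 0 < N by rewrite invr_gt0 exprn_gt0.
pose e1 := e / (N + 3).
have e10 : 0 < e1 by rewrite divr_gt0// addr_gt0.
have eE : e1 * N + 3 * e1 = e by rewrite [3 * _]mulrC -mulrDr /e1 divfK// gt_eqF// addr_gt0.
case: (H _ e10) => -[A1 A2] /= [A1n A2n] AA.
pose kk (q : plane R * plane R) : plane R := cinv (q.1 + q.2) - cinv q.1.
have cadd : (fun q : plane R * plane R => q.1 + q.2) @ (nbhs w0, nbhs (0 : plane R)) --> w0.
  by rewrite -[X in _ --> X]addr0; apply: cvgD; [exact: cvg_fst2|exact: cvg_snd2].
have ci1 : (fun q : plane R * plane R => cinv q.1) @ (nbhs w0, nbhs (0 : plane R)) --> cinv w0.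
  by apply: cvg_cinv => //; exact: cvg_fst2.
have ci2 : (fun q : plane R * plane R => cinv (q.1 + q.2)) @ (nbhs w0, nbhs (0 : plane R)) --> cinv w0.
  exact: cvg_cinv.
have ckk : kk @ (nbhs w0, nbhs (0 : plane R)) --> (0 : plane R).
  by rewrite -[X in _ --> X](subrr (cinv w0)); exact: cvgB.
have M1 : \forall w \near w0 & h \near (0 : plane R), A1 (cinv w) by apply: near2_l; exact: ccinv.
have M2 : \forall w \near w0 & h \near (0 : plane R), A2 (kk (w, h)) by exact: (near2_cvg ckk).
have M3 : \forall w \near w0 & h \near (0 : plane R),
    (m - e1) * N - e1 < (m - e1) * (nsq (cinv w) * nsq (cinv (w + h))).
  have c : (fun q : plane R * plane R => (m - e1) * (nsq (cinv q.1) * nsq (cinv (q.1 + q.2)))) @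
      (nbhs w0, nbhs (0 : plane R)) --> (m - e1) * (nsq (cinv w0) * nsq (cinv w0)).
    by apply: cvgM; [exact: cvg_cst|apply: cvgM; exact: cvg_nsq].
  have HN : (m - e1) * (nsq (cinv w0) * nsq (cinv w0)) = (m - e1) * N.
    by rewrite nsq_cinv -expr2 exprVn.
  rewrite HN in c.
  have H3 : filter_prod (nbhs w0) (nbhs (0 : plane R)) (fun q : plane R * plane R =>
     (m - e1) * N - e1 < (m - e1) * (nsq (cinv q.1) * nsq (cinv (q.1 + q.2)))).
    by apply: (cvgr_gt _ c); rewrite gtrDl oppr_lt0.
  by apply: filterS H3 => -[w h].
have M4 : \forall h \near (0 : plane R), nsq h < e1 ^+ 2 / (C * B ^+ 4 + 4 * (C * B ^+ 5)).
  have c : nsq k @[k --> (0 : plane R)] --> nsq (0 : plane R) by exact: nsq_continuous.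
  apply: (cvgr_lt _ c); rewrite /nsq/= expr0n addr0 divr_gt0 ?exprn_gt0//.
  by rewrite addr_gt0// ?mulr_gt0// ?exprn_gt0.
have M5 : \forall w \near w0 & h \near (0 : plane R), nsq (a (cinv w)) <= C /\ nsq (b (cinv w)) <= C.
  by apply: near2_l; exact: (ccinv _ HC).
have M6 := near2_r w0 M4.
apply: (filterS _ (filterI (filterI (filterI M1 M2) (filterI M3 M6)) (filterI M5 (filterI (near2_l nn) (near2_add nn))))).
move=> [w h] /= [[[A1w A2k] [m3 hs]] [[aC bC] [/iB[wn0 uB] /iB[whn0 vB]]]].
have kE := cinv_sub wn0 whn0.
have J : p (cinv w) + (cmul (a (cinv w)) (cinv (w + h) - cinv w)).1 +
   (cmul (b (cinv w)) (cmul (cinv (w + h) - cinv w) (cinv (w + h) - cinv w))).1 +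
   (m - e1) * nsq (cinv (w + h) - cinv w) <= p (cinv w + (cinv (w + h) - cinv w)).
  exact (AA (cinv w, kk (w, h)) (conj A1w A2k)).
have kE2 : cinv w + (cinv (w + h) - cinv w) = cinv (w + h) by rewrite addrC subrK.
rewrite kE2 kE in J.
have kE' : cinv (w + h) = cinv w - cmul h (cmul (cinv w) (cinv (w + h))).
  by rewrite -kE [RHS]addrC subrK.
set v := cinv (w + h) in kE' vB m3 J *; rewrite -/v in kE.
have kuv : cmul h (cmul (cinv w) v) = cinv w - v by rewrite -[LHS]opprK -kE opprB.
set u := cinv w in kE' kuv uB m3 aC bC J *.
set al := a u in aC J *; set be := b u in bC J *.
set k := - cmul h (cmul u v) in J *.
have nN (x : plane R) : nsq (- x) = nsq x by rewrite /nsq/=; ring.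
have nk : nsq k = nsq u * nsq v * nsq h by rewrite /k nN !nsqM mulrC.
have u0 := nsq_ge0 u; have v0 := nsq_ge0 v; have h0 := nsq_ge0 h.
(* the third order remainders of the increment and of its square *)
pose r : plane R := - cmul (cmul h (cmul h h)) (cmul (cmul (cmul u u) u) v).
have kr : k = - cmul h (cmul u u) + cmul (cmul h h) (cmul (cmul u u) u) + r.
  exact: cinv_increment kE'.
pose s : plane R := cmul (- cmul h (cmul u (v + u))) (cmul (cmul h h) (cmul (cmul u u) v)).
have ks : cmul k k = cmul (cmul h h) (cmul (cmul u u) (cmul u u)) + s.
  exact: cinv_increment_sq kuv.
have hb : nsq h * (C * B ^+ 4 + 4 * (C * B ^+ 5)) <= e1 ^+ 2.
  by rewrite -ler_pdivlMr ?ltW// addr_gt0// ?mulr_gt0// ?exprn_gt0.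
have g4 : 0 <= C * B ^+ 4 by rewrite mulr_ge0 ?exprn_ge0// ltW.
have g5 : 0 <= C * B ^+ 5 by rewrite mulr_ge0 ?exprn_ge0// ltW.
have eh0 : 0 <= e1 * nsq h by rewrite mulr_ge0 ?(ltW e10).
have h4 : nsq h * (C * B ^+ 4) <= e1 ^+ 2.
  by apply: le_trans hb; rewrite ler_wpM2l// lerDl mulr_ge0.
have h5 : nsq h * (4 * (C * B ^+ 5)) <= e1 ^+ 2.
  by apply: le_trans hb; rewrite ler_wpM2l// lerDr.
have R1 : - (e1 * nsq h) <= (cmul al r).1.
  apply: fst_lower => //; rewrite exprMn /r nsqM nN !nsqM.
  apply: (@le_trans _ _ (C * (nsq h * (nsq h * nsq h) * (B * B * B * B)))).
    apply: ler_pM; rewrite ?nsq_ge0 ?mulr_ge0//.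
    apply: ler_wpM2l; first by rewrite !mulr_ge0.
    by do 3 (apply: ler_pM; rewrite ?mulr_ge0//).
  have -> : C * (nsq h * (nsq h * nsq h) * (B * B * B * B)) = nsq h * (C * B ^+ 4) * nsq h ^+ 2.
    by ring.
  by rewrite ler_wpM2r// sqr_ge0.
have R2 : - (e1 * nsq h) <= (cmul be s).1.
  apply: fst_lower => //; rewrite exprMn /s nsqM [nsq (cmul (- _) _)]nsqM nN !nsqM.
  have uv : nsq (v + u) <= 4 * B by apply: le_trans (nsqD2 _ _) _; move: uB vB; clear; lra.
  apply: (@le_trans _ _ (C * (nsq h * (B * (4 * B)) * (nsq h * nsq h * (B * B * B))))).
    apply: ler_pM; rewrite ?nsq_ge0 ?mulr_ge0 ?nsq_ge0//.
    apply: ler_pM; rewrite ?nsq_ge0 ?mulr_ge0 ?nsq_ge0//.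
      by apply: ler_wpM2l => //; apply: ler_pM; rewrite ?nsq_ge0.
    apply: ler_wpM2l; first by rewrite mulr_ge0.
    by do 2 (apply: ler_pM; rewrite ?mulr_ge0//).
  have -> : C * (nsq h * (B * (4 * B)) * (nsq h * nsq h * (B * B * B))) =
    nsq h * (4 * (C * B ^+ 5)) * nsq h ^+ 2 by ring.
  by rewrite ler_wpM2r// sqr_ge0.
have R3 : ((m - e1) * N - e1) * nsq h <= (m - e1) * nsq k.
  by rewrite nk mulrA ler_wpM2r// ltW.
have E1 : (cmul al k).1 = (cmul (- cmul al (cmul u u)) h).1 +
   (cmul (cmul al (cmul (cmul u u) u)) (cmul h h)).1 + (cmul al r).1.
  have e2 : cmul al (- cmul h (cmul u u)) = cmul (- cmul al (cmul u u)) h.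
    by clear; rewrite !cmulE/=; congr pair => /=; ring.
  have e3 : cmul al (cmul (cmul h h) (cmul (cmul u u) u)) = cmul (cmul al (cmul (cmul u u) u)) (cmul h h).
    by clear; rewrite !cmulE/=; congr pair => /=; ring.
  by rewrite kr (cmulDr al (_ + _)) (cmulDr al _ (cmul (cmul h h) _)) e2 e3.
have E2 : (cmul be (cmul k k)).1 = (cmul (cmul be (cmul (cmul u u) (cmul u u))) (cmul h h)).1 + (cmul be s).1.
  have e2 : cmul be (cmul (cmul h h) (cmul (cmul u u) (cmul u u))) =
     cmul (cmul be (cmul (cmul u u) (cmul u u))) (cmul h h).
    by clear; rewrite !cmulE/=; congr pair => /=; ring.
  by rewrite ks (cmulDr be) e2.
apply: le_trans J; rewrite E1 E2.
have -> : m / nsq w0 ^+ 2 = m * N by [].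
change (p u + (cmul (- cmul al (cmul u u)) h).1 +
  (cmul (cmul al (cmul (cmul u u) u) + cmul be (cmul (cmul u u) (cmul u u))) (cmul h h)).1 +
  (m * N - e) * nsq h <= p u + ((cmul (- cmul al (cmul u u)) h).1 +
   (cmul (cmul al (cmul (cmul u u) u)) (cmul h h)).1 + (cmul al r).1) +
   ((cmul (cmul be (cmul (cmul u u) (cmul u u))) (cmul h h)).1 + (cmul be s).1) +
   (m - e1) * nsq k).
have -> : (cmul (cmul al (cmul (cmul u u) u) + cmul be (cmul (cmul u u) (cmul u u))) (cmul h h)).1 =
  (cmul (cmul al (cmul (cmul u u) u)) (cmul h h)).1 +
  (cmul (cmul be (cmul (cmul u u) (cmul u u))) (cmul h h)).1 by rewrite cmulDl.
rewrite -eE; move: R1 R2 R3; clear.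
move: (p u) (cmul _ h).1 (cmul (cmul al _) _).1 (cmul (cmul be _) _).1 (cmul al r).1 (cmul be s).1 (nsq k) (nsq h).
move=> *; lra.
Qed.

End JetInversion.

(** * Circle means of a barrier plus a local potential *)

Section PotentialLine.
Context {R : realType}.
Notation mplane := (measurableTypeR R * measurableTypeR R)%type.
Implicit Types (x y z s : plane R) (D e : R).

(** Around z0, p bends downwards by at most what the density of w compensates. *)
Definition good_at (w : form11 R) k (p : plane R -> R) (z0 : plane R) : Prop :=
  exists l : R, (\forall z \near z0, l <= dens w k z) /\
    (\forall z \near z0, submean4 p z (- (pi * l))).

Lemma near_disc (z0 : plane R) (P : plane R -> Prop) : (\forall z \near z0, P z) ->
  exists2 r : R, 0 < r & forall z, nsq (z - z0) < r -> P z.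
Proof.
move/nbhs_ballP => [r /= r0 rP]; exists (r ^+ 2); first exact: exprn_gt0.
move=> z zr; apply: rP; rewrite -ball_normE/= distrC.
rewrite -(@ltr_pXn2r _ 2)// ?nnegrE ?(ltW r0)//.
exact: le_lt_trans (norm_le_nsq _) zr.
Qed.

Lemma disc_near (z0 z : plane R) (r D : R) : nsq (z - z0) <= r / 4 -> D <= r / 8 ->
  0 < r -> forall y, disc z D y -> nsq (y - z0) < r.
Proof.
move=> zr Dr r0 y; rewrite /disc/= => yD.
have -> : y - z0 = (y - z) + (z - z0) by rewrite addrA subrK.
by apply: le_lt_trans (nsqD2 _ _) _; move: zr Dr yD r0; clear; lra.
Qed.

(** p plus a mollified potential is submean near z0, for all small radii. *)
Lemma local_smear (w : form11 R) k V v (p : plane R -> R) z0 e : open V ->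
  local_potential w k V v -> V z0 -> good_at w k p z0 -> 0 < e ->
  \forall z \near z0 & D \near (0 : R)^'+,
    [/\ submean4 (fun z => p z + smear V v D z) z 0,
        {for z, continuous (smear V v D)} & `|smear V v D z - v z| <= e].
Proof.
move=> oV [cv wv] Vz0 [l [lw lp]] e0.
have nV : \forall z \near z0, V z by exact: open_nbhs_nbhs.
have nv : \forall z \near z0, `|v z0 - v z| < e / 2.
  have c := cv _ Vz0; move/cvgrPdist_lt : c => /(_ (e / 2)); apply.
  by rewrite divr_gt0.
have [r r0 Hr] := near_disc (filterI (filterI nV nv) (filterI lw lp)).
exists ([set z | nsq (z - z0) <= r / 4], [set D | 0 < D /\ D < r / 100]).
  split => /=; first by apply: nsq_near; rewrite divr_gt0.
  by near=> D; split; near: D; [exact: nbhs_right_gt|apply: nbhs_right_lt; rewrite divr_gt0].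
move=> [z D] [/= zr [D0 Dr]].
have D9 : 9 * D <= r / 8 by move: Dr D0; clear; lra.
have D1 : D <= r / 8 by move: Dr D0; clear; lra.
have sub9 := disc_near zr D9 r0; have sub1 := disc_near zr D1 r0.
have V9 : disc z (9 * D) `<=` V by move=> y /sub9/Hr[[]].
have V1 : disc z D `<=` V by move=> y /sub1/Hr[[]].
have zz : nsq (z - z0) < r by move: zr r0; clear; lra.
split.
- rewrite -(addNr (pi * l)); apply: submean4D; first by have [_ []] := Hr _ zz.
  apply: (@smear_submean _ w k) => // y /sub9/Hr[_ []]//.
- exact: smear_continuous.
- apply: smear_dist => // y /sub1/Hr[[_ h1] _].
  have [[_ h2] _] := Hr _ zz.
  have -> : v y - v z = (v z0 - v z) - (v z0 - v y) by ring.
  by rewrite (le_trans (ler_normB _ _))//; move: h1 h2; clear; lra.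
Unshelve. all: by end_near. Qed.

(** The mean value inequality on a disc in a complex line for p + v + g.  It holds
    with the mollified potential by the passage from local to global, with one radius
    for the whole disc by compactness; the radius then tends to 0. *)
Lemma submean_line (w : form11 R) k V v (p g : plane R -> R) (a b : plane R * plane R) :
  open V -> local_potential w k V v -> (forall z, V z -> good_at w k p z) ->
  (forall z, V z -> {for z, continuous p}) ->
  continuous g -> (forall t, submean4 g t 0) ->
  (forall s, nsq s <= 1 -> V (a.1 + cmul s b.1)) ->
  forall u : plane R -> R,
  u = (fun s => p (a.1 + cmul s b.1) + v (a.1 + cmul s b.1) + g (a.2 + cmul s b.2)) ->
  2 * pi * u 0 <= cint (fun t => u (expi t)).
Proof.
move=> oV pv gp cp cg sg inV u ue; have [cv _] := pv.
have pi0 : 0 < 2 * pi :> R := pi2_gt0.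
pose L1 s := a.1 + cmul s b.1; pose L2 s := a.2 + cmul s b.2.
have cL (A B s : plane R) : (fun s => A + cmul s B) @ s --> A + cmul s B.
  by apply: cvgD; [exact: cvg_cst|apply: cvg_cmul; [exact: cvg_id|exact: cvg_cst]].
have cp1 s : nsq s <= 1 -> {for s, continuous (fun s => p (L1 s))}.
  by move=> s1; apply: (cvg_comp L1 p (cL _ _ s)); apply: cp; exact: inV.
have cg2 s : {for s, continuous (fun s => g (L2 s))}.
  by apply: (cvg_comp L2 g (cL _ _ s)); exact: cg.
have cv1 s : nsq s <= 1 -> {for s, continuous (fun s => v (L1 s))}.
  by move=> s1; apply: (cvg_comp L1 v (cL _ _ s)); apply: cv; exact: inV.
have e1 t : nsq (expi t) <= (1 : R) by rewrite nsq_expi.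
have n01 : nsq (0 : plane R) <= 1 by rewrite /nsq/= expr0n addr0.
have onc (f : plane R -> R) : (forall s, nsq s <= 1 -> {for s, continuous f}) ->
   continuous (fun t => f (expi t)).
  by move=> cf t; apply: (@continuous_comp _ _ _ expi f t); [exact: expi_continuous|apply: cf].
have cu s : nsq s <= 1 -> {for s, continuous u}.
  by move=> s1; rewrite ue; apply: cvgD; [apply: cvgD; [exact: cp1|exact: cv1]|exact: cg2].
have main e : 0 < e -> 2 * pi * u 0 <= cint (fun t => u (expi t)) + 2 * pi * (2 * e).
  move=> e0.
  pose P D s := [/\ submean4 (fun z => p z + smear V v D z) (L1 s) 0,
        {for L1 s, continuous (smear V v D)} & `|smear V v D (L1 s) - v (L1 s)| <= e].
  have : \forall D \near (0 : R)^'+, (@udisc R) `<=` P D.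
    have /compact_near_coveringP cov := @udisc_compact R.
    apply: cov => s s1.
    have [[A B] /= [A1 B1] AB] := local_smear oV pv (inV _ s1) (gp _ (inV _ s1)) e0.
    exists (L1 @^-1` A, B); first by split => //; exact: (cL _ _ s).
    by move=> [s' D] [/= ? ?]; exact: (AB (L1 s', D)).
  move=> HD; have [D HP] : exists D, (@udisc R) `<=` P D by near (0 : R)^'+ => D; exists D; near: D.
  pose uD s := p (L1 s) + smear V v D (L1 s) + g (L2 s).
  have csm s : nsq s <= 1 -> {for s, continuous (fun s => smear V v D (L1 s))}.
    by move=> s1; apply: (cvg_comp L1 (smear V v D) (cL _ _ s)); have [] := HP _ s1.
  have cuD s : nsq s <= 1 -> {for s, continuous uD}.
    by move=> s1; apply: cvgD; [apply: cvgD; [exact: cp1|exact: csm]|exact: cg2].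
  have sm : 2 * pi * uD 0 <= cint (fun t => uD (expi t)).
    apply: submean_local_to_global => // s /ltW s1.
    rewrite -(addr0 (0 : R)); apply: submean4D.
      rewrite -(mul0r (nsq b.1)).
      by apply: (submean4_affine (p := fun z => p z + smear V v D z)); have [] := HP _ s1.
    by rewrite -(mul0r (nsq b.2)); apply: submean4_affine; exact: sg.
  have close s : nsq s <= 1 -> `|uD s - u s| <= e.
    move=> s1; rewrite ue /uD -/(L1 s) -/(L2 s).
    have -> : p (L1 s) + smear V v D (L1 s) + g (L2 s) - (p (L1 s) + v (L1 s) + g (L2 s)) =
      smear V v D (L1 s) - v (L1 s) by ring.
    by have [] := HP _ s1.
  have h1 : `|cint (fun t => uD (expi t)) - cint (fun t => u (expi t))| <= 2 * pi * e.
    by apply: cint_dist; [exact: onc|exact: onc|move=> t _; exact: close].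
  have h2 := close 0 n01.
  have h3 : 2 * pi * u 0 <= 2 * pi * uD 0 + 2 * pi * e.
    rewrite -mulrDr ler_wpM2l ?(ltW pi0)//; move: h2; rewrite ler_norml => /andP[+ _].
    by clear; lra.
  move: h1; rewrite ler_norml => /andP[_ h1].
  by move: h1 h3 sm; clear; lra.
rewrite leNgt; apply/negP => lt.
pose e := (2 * pi * u 0 - cint (fun t => u (expi t))) / (2 * pi) / 4.
have e0 : 0 < e by rewrite !divr_gt0// subr_gt0.
have := main e e0; rewrite /e.
have -> : 2 * pi * (2 * ((2 * pi * u 0 - cint (fun t => u (expi t))) / (2 * pi) / 4)) =
   (2 * pi * u 0 - cint (fun t => u (expi t))) / 2.
  have alg (P X : R) : P != 0 -> P * (2 * (X / P / 4)) = X / 2 by move=> P0; field.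
  by apply: alg; rewrite gt_eqF.
by move: lt; clear; lra.
Unshelve. all: by end_near. Qed.

End PotentialLine.

(** * Decreasing limits of barriers are plurisubharmonic *)

Section DecreasingLimit.
Context {R : realType}.

Lemma ereal_inf_range_cvg (u : nat -> R) : (forall N, u N.+1 <= u N) ->
  (fun N => (u N)%:E) @ \oo --> ereal_inf (range (fun N => (u N)%:E)).
Proof.
move=> du; apply: ereal_nonincreasing_cvgn => m n mn.
rewrite lee_fin; elim: n mn => [|n IH]; first by rewrite leqn0 => /eqP ->.
by rewrite leq_eqVlt => /orP[/eqP ->//|]; rewrite ltnS => /IH; exact: le_trans.
Qed.

(** The circle mean inequality passes to decreasing limits: monotone convergence,
    applied to C - u N with C a bound of u 0. *)
Lemma cint_ereal_inf (u : nat -> R -> R) (al : R) : (forall N, continuous (u N)) ->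
  (forall N t, u N.+1 t <= u N t) -> (forall N, 2 * pi * al <= cint (u N)) ->
  ((2 * pi * al)%:E <= \int[lebesgue_measure]_(t in `[0%R, (2 * pi)%R])
     ereal_inf (range (fun N => (u N t)%:E)))%E.
Proof.
move=> cu du ualpha; have pi0 : 0 < 2 * pi :> R := pi2_gt0.
set F := fun t : R => ereal_inf (range (fun N => (u N t)%:E)).
have mI : measurable (`[0%R, (2 * pi)%R]%classic : set (measurableTypeR R)) by exact: measurable_itv.
have [x0 _ x0max] : exists2 x0, x0 \in `[0%R, (2 * pi)%R] &
    forall t, t \in `[0%R, (2 * pi)%R] -> u 0 t <= u 0 x0.
  by apply: EVT_max; [exact: ltW|exact: continuous_subspaceT].
pose C := u 0 x0.
have du0 N t : u N t <= u 0 t by elim: N => // N IH; exact: le_trans (du _ _) IH.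
pose f N t : \bar R := (C - u N t)%:E.
have cf N : continuous (fun t => C - u N t).
  by move=> t; apply: cvgB; [exact: cvg_cst|exact: cu].
have f0 N t : `[0%R, (2 * pi)%R]%classic t -> (0 <= f N t)%E.
  move=> It; rewrite lee_fin subr_ge0; apply: le_trans (du0 _ _) _.
  by apply: x0max; rewrite inE.
have mf N : measurable_fun `[0%R, (2 * pi)%R] (f N).
  apply/measurable_EFinP; apply: measurable_funTS; exact: continuous_measurable_fun.
have nf t : `[0%R, (2 * pi)%R]%classic t -> nondecreasing_seq (f^~ t).
  move=> _; apply/nondecreasing_seqP => N; by rewrite lee_fin lerD2l lerN2.
have cvF t : f N t @[N --> \oo] --> (C%:E - F t)%E.
  apply: (@cvg_trans _ ((C%:E - (u N t)%:E)%E @[N --> \oo])); first exact: cvg_id.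
  apply: cvgeB; [by []|exact: cvg_cst|exact: ereal_inf_range_cvg].
have limf t : limn (f^~ t) = (C%:E - F t)%E by apply/cvg_lim => //; exact: cvF.
have mono := @cvg_monotone_convergence _ _ _ (@lebesgue_measure R) _ mI f mf f0 nf.
have eint : (\int[lebesgue_measure]_(t in `[0%R, (2 * pi)%R]) limn (f^~ t) =
    \int[lebesgue_measure]_(t in `[0%R, (2 * pi)%R]) (C%:E - F t))%E.
  by apply: eq_integral => t _; rewrite limf.
rewrite eint in mono.
have mG : measurable_fun `[0%R, (2 * pi)%R] (fun t => C%:E - F t)%E.
  apply: (emeasurable_fun_cvg f) => // t _; exact: cvF.
have G0 t : `[0%R, (2 * pi)%R]%classic t -> (0 <= C%:E - F t)%E.
  move=> It; rewrite -limf; apply: lime_ge; first by apply/cvg_ex; eexists; exact: cvF.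
  by apply: nearW => N; exact: f0.
have bG : (\int[lebesgue_measure]_(t in `[0%R, (2 * pi)%R]) (C%:E - F t)%E <= (2 * pi * (C - al))%:E)%E.
  rewrite -(cvg_lim _ mono)//; apply: lime_le; first by apply/cvg_ex; eexists; exact: mono.
  apply: nearW => N.
  rewrite (cint_EFin (cf N)) lee_fin.
  have -> : cint (fun t => C - u N t) = 2 * pi * C - cint (u N).
    rewrite -cint_cst -(mulN1r (cint (u N))) -cintZ// -cintD//.
    - by congr cint; apply/funext => t; rewrite mulN1r.
    - by move=> t; exact: cvg_cst.
    - by move=> t; apply: cvgM; [exact: cvg_cst|exact: cu].
  by rewrite mulrBr lerD2l lerN2.
have iG : (@lebesgue_measure R).-integrable `[0%R, (2 * pi)%R] (fun t => C%:E - F t)%E.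
  apply/integrableP; split => //.
  apply: le_lt_trans (ltry (2 * pi * (C - al))); apply: le_trans bG.
  rewrite le_eqVlt; apply/orP; left; apply/eqP; apply: eq_integral => t; rewrite inE => It; rewrite gee0_abs//; exact: G0.
have iC : (@lebesgue_measure R).-integrable `[0%R, (2 * pi)%R] (fun=> C%:E).
  by apply: (@cint_integrable R (fun=> C)) => t; exact: cvg_cst.
have -> : (\int[lebesgue_measure]_(t in `[0%R, (2 * pi)%R]) F t =
   \int[lebesgue_measure]_(t in `[0%R, (2 * pi)%R]) ((fun=> C%:E) \- (fun t => C%:E - F t)) t)%E.
  apply: eq_integral => t _ /=; case: (F t) => [r| |] //=.
  by rewrite -!EFinB; congr EFin; ring.
rewrite integralB//.
have -> : (\int[lebesgue_measure]_(t in `[0%R, (2 * pi)%R]) C%:E = (2 * pi * C)%:E)%E.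
  by rewrite (@cint_EFin R (fun=> C)) ?cint_cst// => t; exact: cvg_cst.
move: bG; case: (integral _ _ _) => [r| |] //=.
  by rewrite !lee_fin; move: pi0; clear; nra.
by move=> _; rewrite leey.
Qed.

(** The infimum over N of psi N in the P^1 variable plus g N in tau. *)
Definition decreasing_limit (psi : nat -> P1 R -> R) (g : nat -> plane R -> R)
    (y : P1 R * plane R) : \bar R :=
  ereal_inf (range (fun N => (psi N y.1 + g N y.2)%:E)).

Lemma decreasing_limit_le psi g y N :
  (decreasing_limit psi g y <= (psi N y.1 + g N y.2)%:E)%E.
Proof. by apply: ereal_inf_lbound; exists N. Qed.

Lemma ereal_inf_addr (u : nat -> R) (v : R) : (forall N, u N.+1 <= u N) ->
  (ereal_inf (range (fun N => (u N)%:E)) + v%:E)%E =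
  ereal_inf (range (fun N => (u N + v)%:E)).
Proof.
move=> du; have duv N : u N.+1 + v <= u N + v by rewrite lerD2r.
have h1 : ((u N)%:E + v%:E)%E @[N --> \oo] --> (ereal_inf (range (fun N => (u N)%:E)) + v%:E)%E.
  by apply: cvgeD; [rewrite fin_num_adde_defl|exact: ereal_inf_range_cvg|exact: cvg_cst].
have h2 := ereal_inf_range_cvg duv.
by rewrite -(cvg_lim _ h1)// -(cvg_lim _ h2).
Qed.

Lemma omega_psh_decreasing_limit (w : form11 R) psi g :
  (forall N k z, good_at w k (fun x => psi N (pt k x)) z) ->
  (forall N k, continuous (fun x : plane R => psi N (pt k x))) ->
  (forall N, continuous (g N)) -> (forall N t, submean4 (g N) t 0) ->
  (forall N p, psi N.+1 p <= psi N p) -> (forall N t, g N.+1 t <= g N t) ->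
  omega_psh w (decreasing_limit psi g).
Proof.
move=> gpsi cpsi cg sg dpsi dg; split.
  by move=> p tau _; apply: le_lt_trans (decreasing_limit_le psi g (p, tau) 0) (ltry _).
move=> k V v oV pv; have [cv _] := pv; split.
- move=> x _; apply: lte_add_pinfty; last exact: ltry.
  exact: le_lt_trans (decreasing_limit_le psi g _ 0) (ltry _).
- move=> x a [Vx _] xa.
  have : (decreasing_limit psi g (pt k x.1, x.2) < (a - v x.1)%:E)%E.
    by rewrite EFinB lteBrDr.
  move=> /ereal_inf_lt[_ [N _ <-]]; rewrite lte_fin/= => Na.
  have cN : {for x, continuous (fun y : plane R * plane R => psi N (pt k y.1) + g N y.2 + v y.1)}.
    apply: cvgD; [apply: cvgD|].
    + by apply: (cvg_comp fst (fun x => psi N (pt k x)) (cvg_fst)); exact: cpsi.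
    + by apply: (cvg_comp snd (g N) cvg_snd); exact: cg.
    + by apply: (cvg_comp fst v cvg_fst); exact: cv.
  have lt : psi N (pt k x.1) + g N x.2 + v x.1 < a by rewrite -ltrBrDr.
  have H : \forall y \near x, psi N (pt k y.1) + g N y.2 + v y.1 < a.
    by exact: (cvgr_lt _ cN).
  apply: filterS H => y ya.
  apply: le_lt_trans (leeD2r _ (decreasing_limit_le psi g (pt k y.1, y.2) N)) _.
  by rewrite -EFinD lte_fin.
- move=> a b line inU.
  have inV s : nsq s <= 1 -> V (a.1 + cmul s b.1).
    move=> s1; have [] // := inU s _.
    by rewrite cabs_le ?expr1n.
  pose U N s := psi N (pt k (a.1 + cmul s b.1)) + v (a.1 + cmul s b.1) + g N (a.2 + cmul s b.2).
  have cmul0l (x : plane R) : cmul 0 x = 0 by rewrite cmulC cmul0.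
  have FU s : (decreasing_limit psi g (pt k (a.1 + cmul s b.1)%R, (a.2 + cmul s b.2)%R) +
      (v (a.1 + cmul s b.1)%R)%:E)%E = ereal_inf (range (fun N => (U N s)%:E)).
    rewrite ereal_inf_addr; last by move=> N; rewrite lerD.
    by congr ereal_inf; apply: eq_imagel => N _; congr EFin; rewrite /U; ring.
  have dU N s : U N.+1 s <= U N s by rewrite /U lerD// lerD2r.
  have L0 : line 0 = a.
    by rewrite /line !cmul0l !addr0 -surjective_pairing.
  have := FU 0; rewrite !cmul0l !addr0 => ->.
  rewrite (_ : (\int[_]_(_ in _) _)%E = \int[lebesgue_measure]_(t in `[0%R, (2 * pi)%R])
     ereal_inf (range (fun N => (U N (expi t))%:E)))%E; last first.
    by apply: eq_integral => t _ /=; rewrite -FU.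
  have pi0 : 0 < 2 * pi :> R := pi2_gt0.
  have cU N : continuous (fun t => U N (expi t)).
    move=> t.
    have cL (A B : plane R) : (fun t => A + cmul (expi t) B) @ t --> A + cmul (expi t) B.
      apply: cvgD; first exact: cvg_cst.
      by apply: cvg_cmul; [exact: expi_continuous|exact: cvg_cst].
    have e1 : nsq (expi t) <= (1 : R) by rewrite nsq_expi.
    apply: cvgD; [apply: cvgD|].
    + by apply: (cvg_comp (fun t => a.1 + cmul (expi t) b.1) (fun x => psi N (pt k x)) (cL _ _)); exact: cpsi.
    + by apply: (cvg_comp (fun t => a.1 + cmul (expi t) b.1) v (cL _ _)); apply: cv; exact: inV.
    + by apply: (cvg_comp (fun t => a.2 + cmul (expi t) b.2) (g N) (cL _ _)); exact: cg.
  have le N : 2 * pi * U N 0 <= cint (fun t => U N (expi t)).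
    exact: (submean_line oV pv (fun z _ => gpsi N k z) (fun z _ => @cpsi N k z) (@cg N) (sg N) inV (erefl (U N))).
  case E : (ereal_inf _) => [al| |].
  + rewrite -EFinM; apply: cint_ereal_inf => // N.
    apply: le_trans (le N); rewrite ler_wpM2l ?(ltW pi0)//.
    by rewrite -lee_fin -E; apply: ereal_inf_lbound; exists N.
  + have : (ereal_inf (range (fun N => (U N 0)%:E)) <= (U 0 0)%:E)%E.
      by apply: ereal_inf_lbound; exists 0.
    by rewrite E.
  + by rewrite gt0_muleNy ?lte_fin// leNye.
Qed.

End DecreasingLimit.

(** * Truncated logarithm and wedge quadratic *)

Section TruncatedLog.
Context {R : realType}.
Implicit Types (x : R) (z : plane R) (N : nat).

(** The logarithm truncated from below at - N. *)
Definition tln N x : R := ln (Num.max x (expR (- N%:R))).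

Lemma tln_max_gt0 N x : 0 < Num.max x (expR (- N%:R)).
Proof. by rewrite lt_max expR_gt0 orbT. Qed.

Lemma tln_decr N x : tln N.+1 x <= tln N x.
Proof.
rewrite ler_ln ?posrE ?tln_max_gt0// ge_max !le_max lexx /= ler_expR lerN2 ler_nat leqnSn.
by rewrite orbT.
Qed.

Lemma tln_ge N x : 0 < x -> ln x <= tln N x.
Proof. by move=> x0; rewrite ler_ln ?posrE ?tln_max_gt0// le_max lexx. Qed.

Lemma tln_mono N x x' : x <= x' -> tln N x <= tln N x'.
Proof. by move=> xx; rewrite ler_ln ?posrE ?tln_max_gt0// ge_max !le_max xx lexx orbT. Qed.

Lemma tln_le N x x' : 1 <= x' -> x <= x' -> tln N x <= ln x'.
Proof.
move=> x1 xx; rewrite ler_ln ?posrE ?tln_max_gt0//; last exact: lt_le_trans x1.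
rewrite ge_max xx/= (le_trans _ x1)// -expR0 ler_expR oppr_le0; exact: ler0n.
Qed.

Lemma tln_large N x : expR (- N%:R) <= x -> tln N x = ln x.
Proof. by move=> h; rewrite /tln (max_idPl h). Qed.

Lemma tln_small N x : x <= expR (- N%:R) -> tln N x = - N%:R.
Proof. by move=> h; rewrite /tln (max_idPr h) expRK. Qed.

Lemma tln_nsq_continuous N : continuous (fun z => tln N (nsq z)).
Proof.
move=> z; apply: (@continuous_comp _ _ _ (fun z => Num.max (nsq z) (expR (- N%:R))) (@ln R)).
  by apply: continuous_max; [exact: nsq_continuous|exact: cvg_cst].
exact/continuous_ln/tln_max_gt0.
Qed.

Lemma jet_tln N z0 : jet (fun z => tln N (nsq z)) z0 0.
Proof.
have [small|large] := ltP (nsq z0) (expR (- N%:R)).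
  have near : \forall z \near z0, nsq z < expR (- N%:R) by exact: (cvgr_lt _ (@nsq_continuous R z0)).
  apply: (@jet_germ R (fun=> - N%:R)); last exact: jet_cst.
  by apply: filterS near => z /ltW; move=> h; rewrite tln_small.
have z00 : z0 != 0 by rewrite -nsq_gt0 (lt_le_trans _ large)// expR_gt0.
apply: (@jet_max R (fun z => ln (nsq z)) (fun=> - N%:R)); [exact: jet_ln|exact: jet_cst|].
have near : \forall z \near z0, 0 < nsq z.
  by apply: (cvgr_gt _ (@nsq_continuous R z0)); rewrite nsq_gt0.
apply: filterS near => z zp; rewrite tln_ge//.
have [h|h] := leP (nsq z) (expR (- N%:R)).
  by rewrite tln_small//; split => //; split => //; right.
rewrite tln_large ?(ltW h)//; split => //; split; last by left.
by rewrite -[leLHS]expRK ler_ln ?posrE ?expR_gt0// ltW.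
Qed.

End TruncatedLog.

Section CornerWedge.
Context {R : realType}.

(** In the wedge |y| <= m x this is the harmonic quadratic kap (x^2 - y^2), with
   kap = a (1 - m^2) / 4; the squares added outside make it positive definite. *)
Definition wedge_quad (m a x y : R) : R :=
  a * (1 - m ^+ 2) / 4 * (x ^+ 2 - y ^+ 2) +
  a * ((Num.max 0 (y - m * x)) ^+ 2 + (Num.max 0 (- y - m * x)) ^+ 2).

(** The case y >= 0.  In the wedge the harmonic part is positive definite because
    m < 1; outside, the square dominates its negative part. *)
Lemma wedge_quad_half (m a x y : R) : 0 < m -> m < 1 -> 0 < a -> 0 <= y ->
  a * (1 - m ^+ 2) ^+ 2 / 24 * (x ^+ 2 + y ^+ 2) <=
  a * (1 - m ^+ 2) / 4 * (x ^+ 2 - y ^+ 2) + a * (Num.max 0 (y - m * x)) ^+ 2.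
Proof.
move=> m0 m1 a0 y0.
set w := 1 - m ^+ 2.
have w0 : 0 < w by rewrite /w subr_gt0 expr_lt1// ltW.
have w1 : w <= 1 by rewrite /w; move: (sqr_ge0 m); lra.
suff H : w ^+ 2 / 24 * (x ^+ 2 + y ^+ 2) <= w / 4 * (x ^+ 2 - y ^+ 2) + (Num.max 0 (y - m * x)) ^+ 2.
  have := ler_wpM2l (ltW a0) H; lra.
have ww : w ^+ 2 <= w by rewrite expr2 ler_piMl// ltW.
have [y_small|y_large] := leP (y - m * x) 0.
  have x0 : 0 <= x by rewrite -(pmulr_rge0 _ m0); move: y_small y0; clear; lra.
  have yx : y ^+ 2 <= m ^+ 2 * x ^+ 2.
    by rewrite -exprMn ler_pXn2r// ?nnegrE ?mulr_ge0 ?(ltW m0)//; move: y_small; clear; lra.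
  rewrite expr0n addr0.
  have h1 : w * x ^+ 2 <= x ^+ 2 - y ^+ 2 by rewrite /w; move: yx; clear; lra.
  have h2 : y ^+ 2 <= x ^+ 2 by apply: le_trans yx _; rewrite ler_piMl ?sqr_ge0// expr_le1// ltW.
  have h3 := ler_wpM2l (ltW w0) h1.
  have h4 : w ^+ 2 * (x ^+ 2 + y ^+ 2) <= w ^+ 2 * (2 * x ^+ 2).
    by apply: ler_wpM2l; [exact: sqr_ge0|move: h2; clear; lra].
  have h5 : 0 <= w ^+ 2 * x ^+ 2 by rewrite mulr_ge0 ?sqr_ge0.
  by move: h3 h4 h5; rewrite mulrA -expr2; clear; lra.
have [x0|x0] := leP 0 x.
  set n := y - m * x in y_large *.
  have yE : y = m * x + n by rewrite /n; ring.
  have h1 : w * (2 * m * x * n) <= w ^+ 2 / 2 * x ^+ 2 + 2 * m ^+ 2 * n ^+ 2.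
    have := sqr_ge0 (w * x - 2 * m * n); clear; lra.
  have h2 : w * (x ^+ 2 - y ^+ 2) = w ^+ 2 * x ^+ 2 - w * (2 * m * x * n) - w * n ^+ 2.
    by rewrite yE /w; ring.
  have m2 : m ^+ 2 = 1 - w by rewrite /w; ring.
  have h3 : y ^+ 2 <= 2 * (m ^+ 2 * x ^+ 2) + 2 * n ^+ 2.
    by have := sqr_ge0 (m * x - n); rewrite yE; clear; lra.
  have h4 : m ^+ 2 * x ^+ 2 <= x ^+ 2 by rewrite ler_piMl ?sqr_ge0// expr_le1// ltW.
  have h5 : w ^+ 2 * (x ^+ 2 + y ^+ 2) <= w ^+ 2 * (3 * x ^+ 2 + 2 * n ^+ 2).
    by apply: ler_wpM2l; [exact: sqr_ge0|move: h3 h4; clear; lra].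
  have h6 : w ^+ 2 * n ^+ 2 <= n ^+ 2 by rewrite ler_piMl ?sqr_ge0// (le_trans ww).
  have h8 : 0 <= w ^+ 2 * x ^+ 2 by rewrite mulr_ge0 ?sqr_ge0.
  have h9 : 2 * m ^+ 2 * n ^+ 2 = 2 * n ^+ 2 - 2 * (w * n ^+ 2) by rewrite m2; ring.
  have h10 : 0 <= w * n ^+ 2 by rewrite mulr_ge0 ?sqr_ge0// ltW.
  have -> : w / 4 * (x ^+ 2 - y ^+ 2) = (w * (x ^+ 2 - y ^+ 2)) / 4 by ring.
  rewrite h2; move: h1 h5 h6 h8 h9 h10 (sqr_ge0 n); clear; lra.
have mx : m * x < 0 by rewrite pmulr_rlt0.
have h1 : y ^+ 2 <= (y - m * x) ^+ 2.
  by rewrite ler_pXn2r ?nnegrE// ?(ltW y_large)//; move: mx; clear; lra.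
have h2 : w ^+ 2 * (x ^+ 2 + y ^+ 2) <= w * (x ^+ 2 + y ^+ 2).
  by rewrite ler_wpM2r// addr_ge0 ?sqr_ge0.
have h3 : w * y ^+ 2 <= y ^+ 2 by rewrite ler_piMl ?sqr_ge0.
have h4 : 0 <= w * x ^+ 2 by rewrite mulr_ge0 ?sqr_ge0// ltW.
have h5 := sqr_ge0 y.
by move: h1 h2 h3 h4 h5; clear; lra.
Qed.

Lemma wedge_quad_ge (m a x y : R) : 0 < m -> m < 1 -> 0 < a ->
  a * (1 - m ^+ 2) ^+ 2 / 24 * (x ^+ 2 + y ^+ 2) <= wedge_quad m a x y.
Proof.
move=> m0 m1 a0; have [y0|y0] := leP 0 y.
  apply: le_trans (wedge_quad_half x m0 m1 a0 y0) _.
  by rewrite /wedge_quad lerD2l ler_wpM2l ?(ltW a0)// lerDl sqr_ge0.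
have ny0 : 0 <= - y by rewrite oppr_ge0 ltW.
have := wedge_quad_half x m0 m1 a0 ny0; rewrite !sqrrN => h.
apply: le_trans h _.
by rewrite /wedge_quad lerD2l ler_wpM2l ?(ltW a0)// lerDr sqr_ge0.
Qed.

End CornerWedge.

(** * The wedge function at the corner *)

Section WedgePlane.
Context {R : realType}.
Implicit Types (e c z k : plane R).

(** The coordinates of k in the orthonormal frame e, irot e. *)
Definition frame e k : plane R := cmul (e.1, - e.2) k.

Lemma frameE e k : frame e k = (e.1 * k.1 + e.2 * k.2, e.1 * k.2 - e.2 * k.1).
Proof. by rewrite /frame cmulE /=; congr pair; ring. Qed.

Lemma nsq_frame e k : nsq e = 1 -> nsq (frame e k) = nsq k.
Proof. by move=> e1; rewrite /frame nsqM -[RHS]mul1r -e1 /nsq /= sqrrN. Qed.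

Lemma jet_ext (p q : plane R -> R) z0 m : (forall z, p z = q z) ->
  jet p z0 m -> jet q z0 m.
Proof. by move=> /funext ->. Qed.

(** The wedge quadratic at c, in the frame e. *)
Definition wedge_fun (m a : R) e c z : R :=
  wedge_quad m a (frame e (z - c)).1 (frame e (z - c)).2.

Lemma wedge_fun_continuous m a e c : continuous (wedge_fun m a e c).
Proof.
move=> z.
have cf : (fun z => frame e (z - c)) @ z --> frame e (z - c).
  by apply: cvg_cmul; [exact: cvg_cst|apply: cvgB; [exact: cvg_id|exact: cvg_cst]].
have c1 : (fun z => (frame e (z - c)).1) @ z --> (frame e (z - c)).1 by exact: cvg_fst_comp.
have c2 : (fun z => (frame e (z - c)).2) @ z --> (frame e (z - c)).2 by exact: cvg_snd_comp.
have csq (h : plane R -> R) (l : R) : h @ z --> l -> (fun z => (h z) ^+ 2) @ z --> l ^+ 2.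
  by move=> hl; rewrite expr2; exact: cvgM.
have cpos (h : plane R -> R) (l : R) : h @ z --> l -> (fun z => (Num.max 0 (h z)) ^+ 2) @ z --> (Num.max 0 l) ^+ 2.
  move=> hl; have cm : continuous (fun x : R => Num.max 0 x).
    by move=> x; apply: continuous_max; [exact: cvg_cst|exact: cvg_id].
  have hm := cvg_comp h (fun x : R => Num.max 0 x) hl (cm l).
  exact: csq hm.
rewrite /wedge_fun /wedge_quad; apply: cvgD; apply: cvgM; try exact: cvg_cst.
  by apply: cvgB; apply: csq.
apply: cvgD; apply: cpos.
  by apply: cvgB => //; apply: cvgM => //; exact: cvg_cst.
by apply: cvgB; [exact: cvgN|apply: cvgM => //; exact: cvg_cst].
Qed.

Lemma jet_frame (al be a : R) e c z0 : nsq e = 1 -> 0 <= a ->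
  jet (fun z => a * - (Num.max 0 (al * (frame e (z - c)).1 + be * (frame e (z - c)).2)) ^+ 2) z0
    (- (a * ((al ^+ 2 + be ^+ 2) / 2))).
Proof.
move=> e1 a0; rewrite -mulrN; apply: jetZ => //.
have -> : al ^+ 2 + be ^+ 2 = (al * e.1 - be * e.2) ^+ 2 + (al * e.2 + be * e.1) ^+ 2.
  have -> : (al * e.1 - be * e.2) ^+ 2 + (al * e.2 + be * e.1) ^+ 2 =
    (al ^+ 2 + be ^+ 2) * nsq e by rewrite /nsq; ring.
  by rewrite e1 mulr1.
have := @jet_neg_sq_pos R (- ((al * e.1 - be * e.2) * c.1 + (al * e.2 + be * e.1) * c.2))
  (al * e.1 - be * e.2) (al * e.2 + be * e.1) z0.
apply: jet_ext => z; rewrite frameE /=.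
by congr (- (Num.max 0 _) ^+ 2); ring.
Qed.

Lemma jet_kap (kap : R) e c z0 :
  jet (fun z => kap * ((frame e (z - c)).1 ^+ 2 - (frame e (z - c)).2 ^+ 2)) z0 0.
Proof.
have := @jet_quad R (kap *: cmul (e.1, - e.2) (e.1, - e.2)) c z0.
apply: jet_ext => z; rewrite frameE !cmulE /=.
by rewrite /GRing.scale /=; ring.
Qed.

Lemma jet_wedge (m a : R) e c z0 : nsq e = 1 -> 0 <= a -> 0 < m -> m < 1 ->
  jet (fun z => - wedge_fun m a e c z) z0 (- (2 * a)).
Proof.
move=> e1 a0 m0 m1.
have m2 : m ^+ 2 <= 1 by rewrite expr_le1// ltW.
have j1 := @jet_kap (- (a * (1 - m ^+ 2) / 4)) e c z0.
have j2 := @jet_frame (- m) 1 a e c z0 e1 a0.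
have j3 := @jet_frame (- m) (- 1) a e c z0 e1 a0.
have := jetD (jetD j1 j2) j3.
have le : - (2 * a) <= 0 - a * (((- m) ^+ 2 + 1 ^+ 2) / 2) - a * (((- m) ^+ 2 + (- 1) ^+ 2) / 2).
  have := ler_wpM2l a0 m2; rewrite sqrrN; clear; lra.
move/(jetW le); apply: jet_ext => z.
rewrite /wedge_fun /wedge_quad.
have -> : - m * (frame e (z - c)).1 + 1 * (frame e (z - c)).2 =
  (frame e (z - c)).2 - m * (frame e (z - c)).1 by ring.
have -> : - m * (frame e (z - c)).1 + - 1 * (frame e (z - c)).2 =
  - (frame e (z - c)).2 - m * (frame e (z - c)).1 by ring.
by ring.
Qed.

(** Inside the wedge only the harmonic part is present. *)
Lemma jet_wedge_in (m a : R) e c z0 :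
  `|(frame e (z0 - c)).2| < m * (frame e (z0 - c)).1 ->
  jet (fun z => - wedge_fun m a e c z) z0 0.
Proof.
rewrite ltr_norml => /andP[h1 h2].
have := @jet_kap (- (a * (1 - m ^+ 2) / 4)) e c z0; apply: jet_germ.
have cf : (fun z => frame e (z - c)) @ z0 --> frame e (z0 - c).
  by apply: cvg_cmul; [exact: cvg_cst|apply: cvgB; [exact: cvg_id|exact: cvg_cst]].
have c1 : (fun z => (frame e (z - c)).1) @ z0 --> (frame e (z0 - c)).1 by exact: cvg_fst_comp.
have c2 : (fun z => (frame e (z - c)).2) @ z0 --> (frame e (z0 - c)).2 by exact: cvg_snd_comp.
have cm : (fun z => m * (frame e (z - c)).1) @ z0 --> m * (frame e (z0 - c)).1.
  by apply: cvgM => //; exact: cvg_cst.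
have n1 : \forall z \near z0, (frame e (z - c)).2 - m * (frame e (z - c)).1 < 0.
  by apply: (cvgr_lt _ (cvgB c2 cm)); rewrite subr_lt0.
have n2 : \forall z \near z0, - (frame e (z - c)).2 - m * (frame e (z - c)).1 < 0.
  by apply: (cvgr_lt _ (cvgB (cvgN c2) cm)); move: h1; clear; lra.
apply: filterS2 n1 n2 => z l1 l2; rewrite /wedge_fun /wedge_quad.
rewrite (max_idPl (ltW l1)) (max_idPl (ltW l2)); ring.
Qed.

End WedgePlane.

(** * The barrier at the corner *)

Section Barrier.
Context {R : realType}.
(** The data: lam is the density of the form off the domain, c the corner, e the
    bisector and m the slope of the wedge at c.  Distances to b are compared with
    u01 < u1 < u12 < u2 (squared radii), the domain lying inside the first one; the
    disc |z - c|^2 < rho2 is where the wedge piece is used, e0 and R2 bound |z|^2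
    from below and from above where needed.  t is the weight of the pole and eps
    that of the logarithm at c. *)
Context (w : form11 R) (lam : R) (b c e : plane R).
Context (u01 u1 u12 u2 rho2 e0 R2 m t eps : R).
Implicit Types (z : plane R) (N : nat).

(** The coefficient of the radial piece: its downward bend 4 bA u2 is half of
    pi lam. *)
Definition bA : R := pi * lam / (8 * u2).
(** The opposite of the barrier near infinity. *)
Definition bM : R := bA * (u12 - u1) ^+ 2.
(** The pole at 0, pushed down outside the disc of squared radius u1 around b. *)
Definition piece1 N z : R :=
  t * (tln N (nsq z) - ln R2) + bA * - (Num.max 0 (nsq (z - b) - u1)) ^+ 2.
(** The opposite of the wedge function, with a logarithm that makes it inactive at
    the corner itself, where the wedge function is not controlled. *)
Definition piece2 z : R :=
  - wedge_fun m (pi * lam / 4) e c z + eps * (ln (nsq (z - c)) - ln R2).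
(** The maximum of the pieces, each on its own region. *)
Definition barrier N z : R :=
  if (nsq (z - c) < rho2) && (z != c) then Num.max (piece1 N z) (piece2 z)
  else if nsq (z - b) < u1 then piece1 N z
  else if nsq (z - b) < u2 then Num.max (piece1 N z) (- bM) else - bM.

(** The form has density at least lam around z. *)
Definition dense_near z : Prop := \forall z' \near z, lam <= dens w Cz z'.

Context (lam0 : 0 < lam) (e1 : nsq e = 1) (m0 : 0 < m) (m1 : m < 1)
  (dens0 : forall k z, 0 <= dens w k z)
  (dense_out : forall z, u01 < nsq (z - b) -> nsq (z - b) < u2 -> dense_near z)
  (dense_wedge : forall z, nsq (z - c) < rho2 -> z != c ->
     ~ (`|(frame e (z - c)).2| < m * (frame e (z - c)).1) -> dense_near z)
  (u01_ge0 : 0 <= u01) (u01_u1 : u01 < u1) (u1_u12 : u1 < u12) (u12_u2 : u12 < u2)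
  (rho0 : 0 < rho2) (disc_in : forall z, nsq (z - c) < rho2 -> nsq (z - b) < u01)
  (e0_gt0 : 0 < e0)
  (far0 : forall z, nsq (z - c) < rho2 \/ u01 <= nsq (z - b) -> e0 <= nsq z)
  (R2_ge1 : 1 <= R2)
  (R2_ge : forall z, nsq (z - b) < u2 -> nsq z <= R2 /\ nsq (z - c) <= R2)
  (t_ge0 : 0 <= t) (tM : t * (ln R2 - ln e0) <= bM)
  (tQ : t * (ln R2 - ln e0) <= pi * lam / 4 * (1 - m ^+ 2) ^+ 2 / 24 * (rho2 / 4))
  (eps0 : 0 < eps).

Lemma bA_gt0 : 0 < bA.
Proof.
have u20 : 0 < u2 by move: u01_ge0 u01_u1 u1_u12 u12_u2; lra.
by rewrite /bA divr_gt0 ?mulr_gt0// pi_gt0.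
Qed.

Lemma piece1_le0 N z : nsq (z - b) < u2 -> piece1 N z <= 0.
Proof.
move=> /R2_ge[h _]; rewrite /piece1 mulrN.
have h1 : t * (tln N (nsq z) - ln R2) <= 0.
  by rewrite mulr_ge0_le0// subr_le0 tln_le.
have h2 : 0 <= bA * (Num.max 0 (nsq (z - b) - u1)) ^+ 2.
  by rewrite mulr_ge0 ?sqr_ge0// (ltW bA_gt0).
by move: h1 h2; lra.
Qed.

Lemma piece1_ge N z : e0 <= nsq z -> nsq (z - b) <= u1 ->
  - (t * (ln R2 - ln e0)) <= piece1 N z.
Proof.
move=> h0 h1; rewrite /piece1 (max_idPl _) ?subr_le0// expr0n oppr0 mulr0 addr0.
rewrite -mulrN ler_wpM2l// opprB lerD2r.
apply: le_trans (tln_ge N _); last exact: lt_le_trans h0.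
by rewrite ler_ln ?posrE// (lt_le_trans _ h0).
Qed.

Lemma piece1_le_bM N z : u12 <= nsq (z - b) -> nsq (z - b) < u2 -> piece1 N z <= - bM.
Proof.
move=> h1 h2; have [h _] := R2_ge h2; rewrite /piece1 mulrN.
have h3 : t * (tln N (nsq z) - ln R2) <= 0.
  by rewrite mulr_ge0_le0// subr_le0 tln_le.
have h4 : bM <= bA * (Num.max 0 (nsq (z - b) - u1)) ^+ 2.
  rewrite ler_wpM2l ?(ltW bA_gt0)// ler_pXn2r ?nnegrE ?subr_ge0 ?(ltW u1_u12)//;
    by rewrite le_max ?lerD2r ?h1 ?lexx ?orbT.
by move: h3 h4; lra.
Qed.

Lemma wedge_fun_ge z : pi * lam / 4 * (1 - m ^+ 2) ^+ 2 / 24 * nsq (z - c) <=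
  wedge_fun m (pi * lam / 4) e c z.
Proof.
rewrite -(nsq_frame (z - c) e1); apply: wedge_quad_ge => //.
by rewrite divr_gt0// mulr_gt0// pi_gt0.
Qed.

Lemma wedge_coef_ge0 : 0 <= pi * lam / 4 * (1 - m ^+ 2) ^+ 2 / 24.
Proof.
apply: divr_ge0 => //; apply: mulr_ge0; last exact: sqr_ge0.
by apply: divr_ge0 => //; rewrite mulr_ge0 ?pi_ge0 ?(ltW lam0).
Qed.

Lemma wedge_fun_ge0 z : 0 <= wedge_fun m (pi * lam / 4) e c z.
Proof.
apply: le_trans (wedge_fun_ge z); by rewrite mulr_ge0 ?nsq_ge0 ?wedge_coef_ge0.
Qed.

Lemma piece2_le z : nsq (z - c) < rho2 -> z != c ->
  piece2 z <= - wedge_fun m (pi * lam / 4) e c z.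
Proof.
move=> zc nzc; rewrite /piece2 gerDl mulr_ge0_le0 ?(ltW eps0)// subr_le0.
have zc0 : 0 < nsq (z - c) by rewrite nsq_gt0 subr_eq0.
have zb : nsq (z - b) < u2.
  by apply: lt_trans (disc_in zc) _; move: u01_u1 u1_u12 u12_u2; lra.
rewrite ler_ln ?posrE//; first by have [] := R2_ge zb.
exact: lt_le_trans R2_ge1.
Qed.

Lemma barrier_corner N : \forall z \near c, barrier N z = piece1 N z.
Proof.
have n1 : \forall z \near c, nsq (z - c) <= rho2 / 2 by apply: nsq_near; rewrite divr_gt0.
pose d := expR (ln R2 - t * (ln R2 - ln e0) / eps).
have n2 : \forall z \near c, nsq (z - c) <= d by apply: nsq_near; exact: expR_gt0.
apply: filterS2 n1 n2 => z z1 z2; rewrite /barrier.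
have zr : nsq (z - c) < rho2 by move: z1 rho0; lra.
have zb := disc_in zr; have zb1 : nsq (z - b) < u1 := lt_trans zb u01_u1.
rewrite zr /= zb1; case: (eqVneq z c) => [//|nzc] /=.
apply/max_idPl.
have zc0 : 0 < nsq (z - c) by rewrite nsq_gt0 subr_eq0.
have p1 := piece1_ge N (far0 (or_introl zr)) (ltW zb1).
apply: le_trans p1; rewrite /piece2.
have q0 := wedge_fun_ge0 z.
have l1 : ln (nsq (z - c)) <= ln R2 - t * (ln R2 - ln e0) / eps.
  by rewrite -[leRHS]expRK ler_ln ?posrE ?expR_gt0.
have l2 : eps * (ln (nsq (z - c)) - ln R2) <= - (t * (ln R2 - ln e0)).
  have -> : - (t * (ln R2 - ln e0)) = eps * (- (t * (ln R2 - ln e0) / eps)).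
    by rewrite mulrN mulrCA divff ?mulr1 ?gt_eqF.
  by rewrite ler_pM2l//; move: l1; lra.
by move: q0 l2; lra.
Qed.

(** Near the rim of the disc around c the wedge piece is not active. *)
Lemma barrier_inner N z : rho2 / 4 < nsq (z - c) -> nsq (z - b) < u1 ->
  barrier N z = piece1 N z.
Proof.
move=> z1 zb; rewrite /barrier zb; case: ifP => // /andP[zr nzc].
apply/max_idPl; apply: le_trans (piece2_le zr nzc) _.
apply: le_trans (piece1_ge N (far0 (or_introl zr)) (ltW zb)).
rewrite lerN2; apply: le_trans tQ _; apply: le_trans (wedge_fun_ge z).
by apply: ler_wpM2l; [exact: wedge_coef_ge0|exact: ltW].
Qed.

Lemma barrier_middle N z : u01 < nsq (z - b) -> nsq (z - b) < u2 ->
  barrier N z = Num.max (piece1 N z) (- bM).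
Proof.
move=> z1 z2; rewrite /barrier; have -> : (nsq (z - c) < rho2) = false.
  by apply/negbTE/negP => /disc_in h; move: z1; rewrite ltNge (ltW h).
rewrite /= z2; case: ifPn => // zu.
apply/esym/max_idPl; apply: le_trans (piece1_ge N (far0 (or_intror (ltW z1))) (ltW zu)).
by rewrite lerN2.
Qed.

Lemma barrier_outer N z : u12 < nsq (z - b) -> barrier N z = - bM.
Proof.
move=> z1; rewrite /barrier; have -> : (nsq (z - c) < rho2) = false.
  by apply/negbTE/negP => /disc_in h; move: h z1 u01_u1 u1_u12; lra.
have -> /= : (nsq (z - b) < u1) = false by apply/negbTE; rewrite -leNgt; move: z1 u1_u12; lra.
by case: ifPn => // z2; apply/max_idPr; apply: piece1_le_bM => //; exact: ltW.
Qed.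

(** Locally the barrier is one of four combinations of the pieces. *)
Lemma barrier_cases N z0 :
  [\/ (\forall z \near z0, barrier N z = piece1 N z) /\ nsq (z0 - b) < u1,
      [/\ (\forall z \near z0, barrier N z = Num.max (piece1 N z) (piece2 z)),
          nsq (z0 - c) < rho2 & z0 != c],
      (\forall z \near z0, barrier N z = Num.max (piece1 N z) (- bM)) /\
          u01 < nsq (z0 - b) < u2 |
      (\forall z \near z0, barrier N z = - bM)].
Proof.
have cn (a : plane R) : (fun z => nsq (z - a)) @ z0 --> nsq (z0 - a).
  apply: (@continuous_comp _ _ _ (fun z => z - a) nsq); last exact: nsq_continuous.
  by apply: cvgB; [exact: cvg_id|exact: cvg_cst].
have [zb|zb] := ltP (nsq (z0 - b)) u1.
  have [zc|nzc] := eqVneq z0 c.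
    by apply: Or41; split => //; rewrite zc; exact: barrier_corner.
  have [zc|zc] := ltP (nsq (z0 - c)) rho2.
    apply: Or42; split => //.
    have n1 : \forall z \near z0, nsq (z - c) < rho2 by exact: (cvgr_lt _ (cn c)).
    have n2 : \forall z \near z0, 0 < nsq (z - c).
      by apply: (cvgr_gt _ (cn c)); rewrite nsq_gt0 subr_eq0.
    apply: filterS2 n1 n2 => z z1 z2; rewrite /barrier z1 -subr_eq0 -nsq_gt0 z2.
    by [].
  apply: Or41; split => //.
  have n1 : \forall z \near z0, rho2 / 4 < nsq (z - c).
    by apply: (cvgr_gt _ (cn c)); move: zc rho0; lra.
  have n2 : \forall z \near z0, nsq (z - b) < u1 by exact: (cvgr_lt _ (cn b)).
  by apply: filterS2 n1 n2 => z; exact: barrier_inner.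
have [z2|z2] := ltP (nsq (z0 - b)) u2.
  have z1 : u01 < nsq (z0 - b) by exact: lt_le_trans zb.
  apply: Or43; split; last by rewrite z1.
  have n1 : \forall z \near z0, u01 < nsq (z - b) by exact: (cvgr_gt _ (cn b)).
  have n2 : \forall z \near z0, nsq (z - b) < u2 by exact: (cvgr_lt _ (cn b)).
  by apply: filterS2 n1 n2 => z; exact: barrier_middle.
apply: Or44.
have n1 : \forall z \near z0, u12 < nsq (z - b).
  by apply: (cvgr_gt _ (cn b)); exact: lt_le_trans z2.
by apply: filterS n1 => z; exact: barrier_outer.
Qed.

(** Around z0 the function p does not bend downwards, up to traceless terms, or else
   the form has density lam there and p bends by at most half of what that allows. *)
Definition tame (p : plane R -> R) z0 : Prop :=
  (\forall z \near z0, jet p z 0) \/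
  (dense_near z0 /\ \forall z \near z0, jet p z (- (pi * lam / 2))).

Lemma pilam_ge0 : 0 <= pi * lam / 2.
Proof. by rewrite divr_ge0// mulr_ge0 ?pi_ge0 ?(ltW lam0). Qed.

Lemma near_near (P : plane R -> Prop) z0 : (\forall z \near z0, P z) ->
  \forall z \near z0, \forall z' \near z, P z'.
Proof. exact: nbhs_interior. Qed.

Lemma tame_jet p z0 : tame p z0 -> \forall z \near z0, jet p z (- (pi * lam / 2)).
Proof.
case => [|[]//]; apply: filterS => z; apply: jetW; by rewrite oppr_le0 pilam_ge0.
Qed.

Lemma tame_max p q u z0 : tame p z0 -> tame q z0 ->
  (\forall z \near z0, u z = Num.max (p z) (q z)) -> tame u z0.
Proof.
move=> tp tq uE.
have near : \forall z \near z0, p z <= u z /\ q z <= u z /\ (u z = p z \/ u z = q z).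
  apply: filterS uE => z ->; rewrite !le_max !lexx orbT; split => //; split => //.
  by case: leP; [right|left].
have jm mm : (\forall z \near z0, jet p z mm) -> (\forall z \near z0, jet q z mm) ->
    \forall z \near z0, jet u z mm.
  by apply: filterS3 (near_near near) => z nz j1 j2; exact: jet_max j1 j2 nz.
have jp := tame_jet tp; have jq := tame_jet tq.
case: tp => [tp|[dn _]]; last by right; split => //; exact: jm.
case: tq => [tq|[dn _]]; last by right; split => //; exact: jm.
by left; exact: jm.
Qed.

Lemma tame_germ p q z0 : (\forall z \near z0, p z = q z) -> tame p z0 -> tame q z0.
Proof.
move=> /near_near pq [h|[dn h]]; [left|right; split => //];
  by apply: filterS2 pq h => z; exact: jet_germ.
Qed.

Lemma tame_cst (x : R) z0 : tame (fun=> x) z0.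
Proof. by left; apply: filterE => z; exact: jet_cst. Qed.

Lemma jet_piece1_log N z0 : jet (fun z => t * (tln N (nsq z) - ln R2)) z0 0.
Proof.
rewrite -(mulr0 t); apply: jetZ => //; rewrite -(addr0 0).
by apply: jetD; [exact: jet_tln|exact: jet_cst].
Qed.

Lemma nsq_sub_cvg (a z0 : plane R) : (fun z => nsq (z - a)) @ z0 --> nsq (z0 - a).
Proof.
apply: (@continuous_comp _ _ _ (fun z => z - a) nsq); last exact: nsq_continuous.
by apply: cvgB; [exact: cvg_id|exact: cvg_cst].
Qed.

Lemma tame_piece1_in N z0 : nsq (z0 - b) < u1 -> tame (piece1 N) z0.
Proof.
move=> zb; apply: (@tame_germ (fun z => t * (tln N (nsq z) - ln R2))).
  have n1 : \forall z \near z0, nsq (z - b) < u1 by exact: (cvgr_lt _ (@nsq_sub_cvg b z0)).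
  apply: filterS n1 => z z1; rewrite /piece1 (max_idPl _) ?subr_le0 ?(ltW z1)//.
  by rewrite expr0n oppr0 mulr0 addr0.
by left; apply: filterE => z; exact: jet_piece1_log.
Qed.

Lemma tame_piece1_out N z0 : u01 < nsq (z0 - b) -> nsq (z0 - b) < u2 -> tame (piece1 N) z0.
Proof.
move=> h1 h2; right; split; first exact: dense_out.
have u20 : 0 < u2 by move: u01_ge0 u01_u1 u1_u12 u12_u2; lra.
have u1_ge0 : 0 <= u1 by move: u01_ge0 u01_u1; lra.
have n1 : \forall z \near z0, nsq (z - b) < u2 by exact: (cvgr_lt _ (@nsq_sub_cvg b z0)).
apply: filterS n1 => z z2.
have := jetD (jet_piece1_log N z) (jetZ (ltW bA_gt0) (jet_neg_sq_disc u1_ge0 z2)).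
suff -> : 0 + bA * - (4 * u2) = - (pi * lam / 2) by [].
have alg (p u : R) : u != 0 -> 0 + p / (8 * u) * - (4 * u) = - (p / 2) by move=> ?; field.
by apply: alg; rewrite gt_eqF.
Qed.

Lemma tame_piece2 z0 : nsq (z0 - c) < rho2 -> z0 != c -> tame piece2 z0.
Proof.
move=> zr nzc.
have n1 : \forall z \near z0, 0 < nsq (z - c).
  by apply: (cvgr_gt _ (@nsq_sub_cvg c z0)); rewrite nsq_gt0 subr_eq0.
have jl : \forall z \near z0, jet (fun z => eps * (ln (nsq (z - c)) - ln R2)) z 0.
  apply: filterS n1 => z; rewrite nsq_gt0 => zc.
  rewrite -(mulr0 eps); apply: jetZ; first exact: ltW.
  rewrite -(addr0 0); apply: jetD; last exact: jet_cst.
  by apply: (@jet_shift R (fun z => ln (nsq z))); exact: jet_ln.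
have [inside|outside] := pselect (`|(frame e (z0 - c)).2| < m * (frame e (z0 - c)).1).
  left.
  have cf : (fun z => frame e (z - c)) @ z0 --> frame e (z0 - c).
    by apply: cvg_cmul; [exact: cvg_cst|apply: cvgB; [exact: cvg_id|exact: cvg_cst]].
  have c1 : (fun z => (frame e (z - c)).1) @ z0 --> (frame e (z0 - c)).1 by exact: cvg_fst_comp.
  have c2 : (fun z => (frame e (z - c)).2) @ z0 --> (frame e (z0 - c)).2 by exact: cvg_snd_comp.
  have cg : (fun z => `|(frame e (z - c)).2| - m * (frame e (z - c)).1) @ z0 -->
      `|(frame e (z0 - c)).2| - m * (frame e (z0 - c)).1.
    by apply: cvgB; [exact: cvg_norm|apply: cvgM => //; exact: cvg_cst].
  have ng : \forall z \near z0, `|(frame e (z - c)).2| - m * (frame e (z - c)).1 < 0.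
    by apply: (cvgr_lt _ cg); rewrite subr_lt0.
  apply: filterS2 ng jl => z; rewrite subr_lt0 => zi jz.
  by rewrite -(addr0 0); apply: jetD jz; exact: jet_wedge_in.
right; split; first exact: dense_wedge.
have a0 : 0 <= pi * lam / 4 by rewrite divr_ge0// mulr_ge0 ?pi_ge0 ?(ltW lam0).
apply: filterS jl => z jz.
have := jetD (jet_wedge c z e1 a0 m0 m1) jz.
by congr jet; rewrite addr0; field.
Qed.

Lemma barrier_tame N z0 : tame (barrier N) z0.
Proof.
case: (barrier_cases N z0) => [[h zb]|[h zr nzc]|[h /andP[z1 z2]]|h].
- by apply: tame_germ (tame_piece1_in N zb); apply: filterS h.
- apply: tame_max (tame_piece1_in N _) (tame_piece2 zr nzc) h.
  exact: lt_trans (disc_in zr) u01_u1.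
- exact: tame_max (tame_piece1_out N z1 z2) (tame_cst (- bM) z0) h.
- by apply: tame_germ (tame_cst (- bM) z0); apply: filterS h.
Qed.

Lemma piece1_continuous N : continuous (piece1 N).
Proof.
move=> z; apply: cvgD.
  apply: cvgM; first exact: cvg_cst.
  by apply: cvgB; [exact: tln_nsq_continuous|exact: cvg_cst].
apply: cvgM; [exact: cvg_cst|apply: cvgN].
have c1 : (fun z => nsq (z - b) - u1) @ z --> nsq (z - b) - u1.
  apply: cvgB; last exact: cvg_cst.
  apply: (@continuous_comp _ _ _ (fun z => z - b) nsq); last exact: nsq_continuous.
  by apply: cvgB; [exact: cvg_id|exact: cvg_cst].
have c2 : (fun z => Num.max 0 (nsq (z - b) - u1)) @ z --> Num.max 0 (nsq (z - b) - u1).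
  have cm : continuous (fun x : R => Num.max 0 x).
    by move=> x; apply: continuous_max; [exact: cvg_cst|exact: cvg_id].
  exact: (cvg_comp _ (fun x : R => Num.max 0 x) c1 (cm _)).
by rewrite expr2; exact: cvgM.
Qed.

Lemma piece2_continuous z : z != c -> {for z, continuous piece2}.
Proof.
move=> nzc; apply: cvgD; first by apply: cvgN; exact: wedge_fun_continuous.
apply: cvgM; first exact: cvg_cst.
apply: cvgB; last exact: cvg_cst.
have c1 : (fun z => nsq (z - c)) @ z --> nsq (z - c).
  apply: (@continuous_comp _ _ _ (fun z => z - c) nsq); last exact: nsq_continuous.
  by apply: cvgB; [exact: cvg_id|exact: cvg_cst].
apply: (cvg_comp (fun z => nsq (z - c)) (@ln R) c1); apply: continuous_ln.
by rewrite nsq_gt0 subr_eq0.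
Qed.

Lemma cvg_germ (p q : plane R -> R) z0 : (\forall z \near z0, q z = p z) ->
  {for z0, continuous p} -> {for z0, continuous q}.
Proof.
move=> qp cp; rewrite /prop_for /continuous_at (nbhs_singleton qp).
apply: cvg_trans cp; apply: near_eq_cvg; by apply: filterS qp => z ->.
Qed.

Lemma barrier_continuous N : continuous (barrier N).
Proof.
move=> z0; case: (barrier_cases N z0) => [[h zb]|[h zr nzc]|[h _]|h]; apply: cvg_germ h _.
- exact: piece1_continuous.
- by apply: continuous_max; [exact: piece1_continuous|exact: piece2_continuous].
- by apply: continuous_max; [exact: piece1_continuous|exact: cvg_cst].
- exact: cvg_cst.
Qed.

Lemma barrier_le0 N z : barrier N z <= 0.
Proof.
have M0 : - bM <= 0 by rewrite oppr_le0 mulr_ge0 ?sqr_ge0 ?(ltW bA_gt0).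
have zu2 : nsq (z - b) < u1 -> nsq (z - b) < u2 by move: u1_u12 u12_u2; lra.
rewrite /barrier; case: ifPn => [/andP[zr nzc]|_].
  rewrite ge_max; apply/andP; split.
    by apply/piece1_le0/zu2/(lt_trans (disc_in zr)).
  by apply: le_trans (piece2_le zr nzc) _; rewrite oppr_le0 wedge_fun_ge0.
case: ifPn => [zb|_]; first exact/piece1_le0/zu2.
by case: ifPn => // zb; rewrite ge_max M0 piece1_le0.
Qed.

Lemma barrier_decr N z : barrier N.+1 z <= barrier N z.
Proof.
have p1 : piece1 N.+1 z <= piece1 N z by rewrite lerD2r ler_wpM2l// lerD2r tln_decr.
rewrite /barrier; case: ifP => _; first by rewrite ge_max !le_max p1 lexx orbT.
by case: ifP => // _; case: ifP => // _; rewrite ge_max !le_max p1 lexx orbT.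
Qed.

Lemma barrier_origin : \forall z \near (0 : plane R), forall N, barrier N z = piece1 N z.
Proof.
have n1 : \forall z \near (0 : plane R), nsq (z - 0) <= e0 / 2 by apply: nsq_near; rewrite divr_gt0.
apply: filterS n1 => z; rewrite subr0 => z1 N; rewrite /barrier.
have small : nsq z < e0 by move: z1 e0_gt0; lra.
have -> : (nsq (z - c) < rho2) = false.
  by apply/negbTE/negP => h; have := far0 (or_introl h); rewrite leNgt small.
suff -> : nsq (z - b) < u1 by [].
rewrite ltNge; apply/negP => h; have := far0 (or_intror (le_trans (ltW u01_u1) h)).
by rewrite leNgt small.
Qed.

Lemma barrier_ge2 N z : nsq (z - c) < rho2 -> z != c -> piece2 z <= barrier N z.
Proof. by move=> zr nzc; rewrite /barrier zr nzc le_max lexx orbT. Qed.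

(** The barrier on P^1. *)
Definition barrierP1 N (p : P1 R) : R := if p is Some z then barrier N z else - bM.

Lemma barrierP1_infty N : \forall x \near (0 : plane R), barrierP1 N (pt Cw x) = - bM.
Proof.
have n1 : \forall x \near (0 : plane R), nsq (x - 0) <= (2 * u12 + 2 * nsq b + 1)^-1 / 2.
  apply: nsq_near; rewrite divr_gt0// invr_gt0.
  by have := nsq_ge0 b; move: u01_ge0 u01_u1 u1_u12; lra.
apply: filterS n1 => x; rewrite subr0 => x1 /=; case: eqVneq => // x0 /=.
apply: barrier_outer.
have xp : 0 < nsq x by rewrite nsq_gt0.
have D : nsq (cinv x) <= 2 * nsq (cinv x - b) + 2 * nsq b.
  by rewrite -{1}(subrK b (cinv x)); exact: nsqD2.
have P : 0 < 2 * u12 + 2 * nsq b + 1.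
  by have := nsq_ge0 b; move: u01_ge0 u01_u1 u1_u12; lra.
have E : 2 * u12 + 2 * nsq b + 1 < nsq (cinv x).
  rewrite nsq_cinv -[ltLHS]invrK ltf_pV2 ?posrE ?invr_gt0//.
  by apply: le_lt_trans x1 _; rewrite ltr_pdivrMr// ltr_pMr ?invr_gt0// ltr1n.
by move: D E; lra.
Qed.

Lemma barrierP1_continuous N k : continuous (fun x : plane R => barrierP1 N (pt k x)).
Proof.
case: k; first exact: barrier_continuous.
move=> x; have [->|x0] := eqVneq x 0.
  exact: cvg_germ (barrierP1_infty N) (cvg_cst _).
have nx : \forall y \near x, barrierP1 N (pt Cw y) = barrier N (cinv y).
  have n0 : \forall y \near x, 0 < nsq y.
    by apply: (cvgr_gt _ (@nsq_continuous R x)); rewrite nsq_gt0.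
  by apply: filterS n0 => y; rewrite nsq_gt0 /= => /negbTE ->.
apply: cvg_germ nx _.
have ci : (fun y => cinv y) @ x --> cinv x by apply: cvg_cinv => //; exact: cvg_id.
exact: (cvg_comp _ _ ci (@barrier_continuous N (cinv x))).
Qed.

Lemma good_of_jet k (p : plane R -> R) z0 : (\forall z \near z0, jet p z 0) -> good_at w k p z0.
Proof.
move=> h; exists 0; split; first by apply: filterE => z; exact: dens0.
by apply: filterS h => z; rewrite mulr0 oppr0; exact: jet_submean.
Qed.

Lemma good_germ k (p q : plane R -> R) z0 : (\forall z \near z0, p z = q z) ->
  good_at w k p z0 -> good_at w k q z0.
Proof.
move=> pq [l [dl sl]]; exists l; split => //.
apply: filterS2 (near_near pq) sl => z pqz sz ep ep0.
have [[A B] /= [An Bn] AB] := sz ep ep0.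
have [[A1 B1] /= [An1 Bn1] AB1] : \forall x \near z & h \near (0 : plane R), p (x + h) = q (x + h).
  exact: near2_add pqz.
have BN : \forall h \near (0 : plane R), (B `&` B1) h /\ (B `&` B1) (irot h) /\
    B1 (- h) /\ B1 (- irot h).
  have BB : nbhs (0 : plane R) (B `&` B1) by exact: filterI.
  have cN : -%R @ (0 : plane R) --> (0 : plane R).
    by rewrite -[X in _ --> X]oppr0; apply: cvgN; exact: cvg_id.
  have ci := @cvg_irot0 R.
  have ciN : (fun h : plane R => - irot h) @ (0 : plane R) --> (0 : plane R).
    by rewrite -[X in _ --> X]oppr0; exact: cvgN.
  have h1 : \forall h \near (0 : plane R), B1 (- h) := cN _ Bn1.
  have h2 : \forall h \near (0 : plane R), B1 (- irot h) := ciN _ Bn1.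
  have h3 : \forall h \near (0 : plane R), (B `&` B1) (irot h) := ci _ BB.
  by apply: filterS3 (filterI BB h3) h1 h2 => h [].
exists (A `&` A1 `&` [set x | p x = q x], [set h | (B `&` B1) h /\ (B `&` B1) (irot h) /\
    B1 (- h) /\ B1 (- irot h)]); first by split => //; apply: filterI => //; exact: filterI.
move=> [x h] [/= [[Ax Ax1] pqx] [[Bh B1h] [[_ B1i] [B1n B1ni]]]].
have := AB (x, h) (conj Ax Bh); rewrite /= pqx.
have E k' : B1 k' -> p (x + k') = q (x + k') by move=> ?; exact: (AB1 (x, k')).
by rewrite !E.
Qed.

Lemma tame_good p z0 : tame p z0 -> good_at w Cz p z0.
Proof.
case => [|[dl h]]; first exact: good_of_jet.
exists lam; split => //; apply: filterS h => z h; apply/jet_submean/jetW/h.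
by have := pilam_ge0; lra.
Qed.

(** In the chart at infinity both the density and the jets are divided by |x|^4 up to
    the variation of |x|^4 near x0, which the factor 1 / 2 in tame absorbs. *)
Lemma tame_good_inv p x0 : x0 != 0 -> tame p (cinv x0) ->
  good_at w Cw (fun x => p (cinv x)) x0.
Proof.
move=> x00 tp.
have ci : cinv y @[y --> x0] --> cinv x0 by apply: cvg_cinv => //; exact: cvg_id.
have xp : 0 < nsq x0 by rewrite nsq_gt0.
have n0 : \forall y \near x0, 0 < nsq y.
  by exact: (cvgr_gt _ (@nsq_continuous R x0)).
case: tp => [h|[dl h]].
  apply: good_of_jet; have hi : \forall y \near x0, jet p (cinv y) 0 := ci _ h.
  apply: filterS2 n0 hi => y; rewrite nsq_gt0 => y0 /(jet_inv y0).
  by rewrite mul0r.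
set X := nsq x0 ^+ 2.
have X0 : 0 < X by rewrite exprn_gt0.
have cX : (fun y => nsq y ^+ 2) @ x0 --> X.
  by rewrite /X expr2; apply: cvgM; exact: nsq_continuous.
have n1 : \forall y \near x0, nsq y ^+ 2 < 4 / 3 * X.
  by apply: (cvgr_lt _ cX); move: X0; lra.
have n2 : \forall y \near x0, 2 / 3 * X < nsq y ^+ 2.
  by apply: (cvgr_gt _ cX); move: X0; lra.
exists (3 / 4 * lam / X); split.
  have di : \forall y \near x0, lam <= dens w Cz (cinv y) := ci _ dl.
  apply: filterS3 n0 n1 di => y y0 y1 dy.
  rewrite dens_glue -?nsq_gt0//=.
  have -> : cabs y ^+ 4 = nsq y ^+ 2 by rewrite -cabs_sqr -exprM.
  have Y0 : 0 < nsq y ^+ 2 by rewrite exprn_gt0.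
  rewrite ler_pdivlMr// mulrAC ler_pdivrMr//.
  have := ler_wpM2r (ltW X0) dy; have := ler_pM2l lam0 (nsq y ^+ 2) (4 / 3 * X).
  by rewrite (ltW y1) => /idP; lra.
have hi : \forall y \near x0, jet p (cinv y) (- (pi * lam / 2)) := ci _ h.
apply: filterS3 n0 n2 hi => y; rewrite nsq_gt0 => y0 y2 jy.
apply/jet_submean/jetW/(jet_inv y0 jy).
have Y0 : 0 < nsq y ^+ 2 by apply: le_lt_trans y2; rewrite mulr_ge0// ltW.
rewrite mulNr lerN2 ler_pdivrMr//.
have P0 := pilam_ge0.
have -> : pi * (3 / 4 * lam / X) * nsq y ^+ 2 = (pi * lam / 2 * (3 / 2)) * nsq y ^+ 2 / X.
  have alg (v l u Y : R) : u != 0 -> v * (3 / 4 * l / u) * Y = v * l / 2 * (3 / 2) * Y / u.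
    by move=> ?; field.
  by apply: alg; rewrite gt_eqF.
by rewrite ler_pdivlMr//; have := ler_wpM2l P0 (ltW y2); lra.
Qed.

Lemma barrierP1_good N k z : good_at w k (fun x => barrierP1 N (pt k x)) z.
Proof.
case: k; first exact: tame_good (barrier_tame N z).
have [->|z0] := eqVneq z 0.
  apply: (@good_germ _ (fun=> - bM)).
    by apply: filterS (barrierP1_infty N) => x ->.
  by apply: good_of_jet; apply: filterE => x; exact: jet_cst.
have nx : \forall y \near z, barrier N (cinv y) = barrierP1 N (pt Cw y).
  have n0 : \forall y \near z, 0 < nsq y.
    by apply: (cvgr_gt _ (@nsq_continuous R z)); rewrite nsq_gt0.
  by apply: filterS n0 => y; rewrite nsq_gt0 /= => /negbTE ->.
by apply: good_germ nx _; apply: tame_good_inv (barrier_tame N _).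
Qed.

Context (t_le1 : t <= 1).

(** The rest of the pole, carried by tau. *)
Definition pole_part N (tau : plane R) : R := (1 - t) * tln N (nsq tau).

(** The candidate. *)
Definition barrier_sup : P1 R * plane R -> \bar R := decreasing_limit barrierP1 pole_part.

Lemma barrier_sup_psh : omega_psh w barrier_sup.
Proof.
have t1 : 0 <= 1 - t by rewrite subr_ge0.
apply: omega_psh_decreasing_limit.
- by move=> N k z; exact: barrierP1_good.
- by move=> N k; exact: barrierP1_continuous.
- move=> N z; apply: cvgM; [exact: cvg_cst|exact: tln_nsq_continuous].
- by move=> N z; apply: jet_submean; rewrite -(mulr0 (1 - t)); apply: jetZ => //; exact: jet_tln.
- by move=> N [z|] //=; exact: barrier_decr.
- by move=> N z; rewrite ler_wpM2l// tln_decr.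
Qed.

Lemma barrier_sup_le0 p (tau : plane R) : cabs tau < 1 -> (barrier_sup (p, tau) <= 0)%E.
Proof.
move=> tau1; apply: le_trans (decreasing_limit_le _ _ _ 0) _; rewrite lee_fin /=.
have h : tln 0 (nsq tau) <= 0.
  rewrite -ln1; apply: tln_le => //.
  by rewrite -(expr1n _ 2) -cabs_sqr ler_pXn2r ?nnegrE ?cabs_ge0// ltW.
have h2 : (1 - t) * tln 0 (nsq tau) <= 0 by rewrite mulr_ge0_le0// subr_ge0.
have h3 : barrierP1 0 p <= 0.
  case: p => [z|] /=; first exact: barrier_le0.
  by rewrite oppr_le0 mulr_ge0 ?sqr_ge0 ?(ltW bA_gt0).
by rewrite -(addr0 0) lerD.
Qed.

Lemma barrier_sup_boundary : boundary_le0 barrier_sup.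
Proof.
move=> k x tau _; apply: ge_ereal_inf.
exists (ereal_sup [set barrier_sup (pt k y.1, y.2) | y in [set y : plane R * plane R | cabs y.2 < 1]]).
  exists [set y : plane R * plane R | cabs y.2 < 1] => //.
  by apply: withinT.
apply: ge_ereal_sup => _ [y y1 <-]; exact: barrier_sup_le0.
Qed.

(** The two logarithms have total weight 1 and are both at most
    ln (|z|^2 + |tau|^2). *)
Lemma barrier_sup_lelong : lelong_ge1 0 barrier_sup.
Proof.
have t1 : 0 <= 1 - t by rewrite subr_ge0.
move=> c' c'1; exists 0.
have n1 : \forall z \near (0 : plane R), nsq (z - 0) <= 1 / 2 by apply: nsq_near.
have n0 : \forall z \near (0 : plane R), nsq (z - 0) <= 1 / 2 /\ forall N, barrier N z = piece1 N z.
  exact: filterI n1 barrier_origin.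
exists ([set z : plane R | nsq (z - 0) <= 1 / 2 /\ forall N, barrier N z = piece1 N z],
  [set tau : plane R | nsq (tau - 0) <= 1 / 2]) => //.
move=> [z tau] [/= [z1 zE] tau1]; rewrite subr0 in z1; rewrite subr0 in tau1.
rewrite subr0 !cabs_sqr adde0; set S := nsq z + nsq tau.
have S1 : S <= 1 by rewrite /S; move: z1 tau1; lra.
have zS : nsq z <= S by rewrite lerDl nsq_ge0.
have tS : nsq tau <= S by rewrite lerDr nsq_ge0.
have key N : (barrier_sup (Some z, tau) <= (tln N S)%:E)%E.
  apply: le_trans (decreasing_limit_le _ _ _ N) _; rewrite lee_fin /= zE /piece1 /pole_part.
  have h1 := ler_wpM2l t_ge0 (tln_mono N zS).
  have h2 := ler_wpM2l t1 (tln_mono N tS).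
  have h3 : 0 <= bA * (Num.max 0 (nsq (z - b) - u1)) ^+ 2 by rewrite mulr_ge0 ?sqr_ge0 ?(ltW bA_gt0).
  have h4 : 0 <= t * ln R2 by rewrite mulr_ge0// ln_ge0.
  by rewrite mulrN; move: h1 h2 h3 h4; lra.
have [S0|Sp] := leP S 0.
  have S00 : S = 0 by apply/eqP; rewrite eq_le S0 addr_ge0 ?nsq_ge0.
  have keyN N : (barrier_sup (Some z, tau) <= (- N%:R)%:E)%E.
    by have := key N; rewrite S00 tln_small// ltW// expR_gt0.
  case E : (barrier_sup _) => [v| |]; last by rewrite leNye.
    have := keyN (Num.bound `|v|); rewrite E lee_fin => h.
    rewrite lerNr in h; have := lt_le_trans (archi_boundP (normr_ge0 v)) h.
    by rewrite ltNge -normrN ler_norm.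
  by have := keyN 0; rewrite E.
have [N hN] : exists N : nat, expR (- N%:R) <= S.
  have [N hN] : exists N : nat, - ln S <= N%:R.
    exists (Num.bound `|ln S|); apply: le_trans (ltW (archi_boundP (normr_ge0 _))).
    by rewrite -normrN ler_norm.
  exists N; rewrite -[leRHS]lnK ?posrE// ler_expR; move: hN; lra.
apply: le_trans (key N) _; rewrite tln_large// -EFinM lee_fin.
have lS : ln S <= 0 by rewrite -ln1 ler_ln ?posrE.
by have := ler_wnM2r lS (ltW c'1); rewrite mul1r.
Qed.

Lemma barrier_envelope_ge z (tau : plane R) : nsq (z - c) < rho2 -> z != c ->
  0 < nsq tau -> cabs tau < 1 ->
  ((piece2 z + (1 - t) * ln (nsq tau))%:E <= envelope w (0 : plane R)%R (Some z, tau))%E.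
Proof.
move=> zr nzc tau0 tau1; rewrite /envelope /= tau1.
apply: (@le_trans _ _ (barrier_sup (Some z, tau))); last first.
  apply: ereal_sup_ubound; exists barrier_sup => //; split.
  - exact: barrier_sup_psh.
  - exact: barrier_sup_boundary.
  - exact: barrier_sup_lelong.
apply: le_ereal_inf_tmp => _ [N _ <-]; rewrite lee_fin /=.
apply: lerD; first exact: barrier_ge2.
by rewrite ler_wpM2l ?subr_ge0// tln_ge.
Qed.

End Barrier.

(** * A lower bound of the envelope at the corner *)

Section CornerBound.
Context {R : realType}.
Implicit Types (z c b e : plane R).

(** The open wedge with apex c, bisector e and slope m. *)
Definition in_wedge (m : R) e c z : Prop := `|(frame e (z - c)).2| < m * (frame e (z - c)).1.

Lemma frame_cvg e c z0 : frame e (z - c) @[z --> z0] --> frame e (z0 - c).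
Proof. by apply: cvg_cmul; [exact: cvg_cst|apply: cvgB; [exact: cvg_id|exact: cvg_cst]]. Qed.

(** A point outside the wedge of slope m, other than the apex, has a
   neighbourhood outside any narrower wedge. *)
Lemma not_in_wedge_near (m m' : R) e c z0 : nsq e = 1 -> 0 < m' -> m' < m -> z0 != c ->
  ~ in_wedge m e c z0 -> \forall z \near z0, ~ in_wedge m' e c z.
Proof.
move=> e1 m'0 m'm nzc /negP; rewrite -leNgt => out.
have lt : m' * (frame e (z0 - c)).1 < `|(frame e (z0 - c)).2|.
  have [xp|xn] := ltP 0 (frame e (z0 - c)).1.
    by apply: lt_le_trans out; rewrite ltr_pM2r.
  have [xn'|xz] := ltP (frame e (z0 - c)).1 0.
    by apply: lt_le_trans (normr_ge0 _); rewrite pmulr_rlt0.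
  have x0 : (frame e (z0 - c)).1 = 0 by apply/eqP; rewrite eq_le xn xz.
  rewrite x0 mulr0 normr_gt0; apply: contra nzc => /eqP y0.
  by rewrite -subr_eq0 -nsq_eq0 -(nsq_frame _ e1) /nsq x0 y0 expr0n addr0.
have c1 : (fun z => (frame e (z - c)).1) @ z0 --> (frame e (z0 - c)).1.
  by have cf := @frame_cvg e c z0; exact: cvg_fst_comp.
have c2 : (fun z => (frame e (z - c)).2) @ z0 --> (frame e (z0 - c)).2.
  by have cf := @frame_cvg e c z0; exact: cvg_snd_comp.
have cg : (fun z => m' * (frame e (z - c)).1 - `|(frame e (z - c)).2|) @ z0 -->
    m' * (frame e (z0 - c)).1 - `|(frame e (z0 - c)).2|.
  by apply: cvgB; [apply: cvgM => //; exact: cvg_cst|exact: cvg_norm].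
have ng : \forall z \near z0, m' * (frame e (z - c)).1 - `|(frame e (z - c)).2| < 0.
  by apply: (cvgr_lt _ cg); rewrite subr_lt0.
apply: filterS ng => z; rewrite subr_lt0 /in_wedge => h1 h2.
by have := lt_trans h1 h2; rewrite ltxx.
Qed.

Lemma closure_in_disc (Om : set (plane R)) b (r : R) c : bounded_set Om -> closure Om c ->
  closure Om `<=` eball b r ->
  exists2 u0 : R, 0 <= u0 < r ^+ 2 & forall z, closure Om z -> nsq (z - b) <= u0.
Proof.
move=> bO cO sub.
have cr : 0 < r by apply: le_lt_trans (cabs_ge0 _) (sub _ cO).
have [M [_ HM]] := bO.
have bcl z : closure Om z -> `|z| <= M + 1.
  have cl : closed [set z : plane R | `|z| <= M + 1].
    have -> : [set z : plane R | `|z| <= M + 1] = Num.norm @^-1` [set x : R | x <= M + 1] by [].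
    by apply: closed_comp; [move=> x _; exact: norm_continuous|exact: closed_le].
  have s1 : Om `<=` [set z : plane R | `|z| <= M + 1].
    by move=> y Oy; apply: (HM (M + 1)) => //; rewrite ltrDl.
  by move=> zO; have := closureS s1 zO; move/closure_id : cl => <-.
have cK : compact (closure Om) by apply: closed_bounded_compact bcl; exact: closed_closure.
have cf : {within closure Om, continuous (fun z => nsq (z - b))}.
  apply: continuous_subspaceT => z.
  apply: (@continuous_comp _ _ _ (fun z => z - b) nsq); last exact: nsq_continuous.
  by apply: cvgB; [exact: cvg_id|exact: cvg_cst].
have [x0 x0O x0max] := compact_EVT_max (ex_intro _ c cO) cK cf.
exists (nsq (x0 - b)); last by move=> z zO; apply: x0max; rewrite inE.
rewrite nsq_ge0 /=; rewrite inE in x0O; have := sub _ x0O; rewrite /eball /=.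
by rewrite cabs_lt// ltW.
Qed.

(** The barrier with all parameters chosen: radii between the domain and the ball,
    a disc around the corner, then t small. *)
Lemma envelope_corner_bound (w : form11 R) (Om : set (plane R)) (c b e : plane R)
    (r lam m' : R) : open Om -> bounded_set Om -> Om 0 -> closure Om c -> ~ Om c ->
  0 < lam -> semipositive w -> closure Om `<=` eball b r ->
  (forall z, eball b r z -> dens w Cz z = lam * (1 - \1_Om z)) ->
  nsq e = 1 -> 0 < m' -> m' < 1 -> (\forall z \near c, Om z -> in_wedge m' e c z) ->
  exists t rho2 m a R2 : R, [/\ 0 < t <= 1, 0 < rho2 & forall eps z tau, 0 < eps ->
    nsq (z - c) < rho2 -> z != c -> 0 < nsq tau -> cabs tau < 1 ->
    ((- wedge_fun m a e c z + eps * (ln (nsq (z - c)) - ln R2) +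
       (1 - t) * ln (nsq tau))%:E <= envelope w (0 : plane R)%R (Some z, tau))%E].
Proof.
move=> oOm bOm Om0 clc nOc lam0 w0 sub densE e1 m'0 m'1 wedge.
have [u0 /andP[u0_ge0 u0r] u0P] := closure_in_disc bOm clc sub.
have r0 : 0 <= r by apply: le_trans (cabs_ge0 _) (ltW (sub _ clc)).
pose dl := (r ^+ 2 - u0) / 5.
have dl0 : 0 < dl by rewrite divr_gt0// subr_gt0.
pose u01 := u0 + dl; pose u1 := u0 + 2 * dl; pose u12 := u0 + 3 * dl; pose u2 := u0 + 4 * dl.
have rE : r ^+ 2 = u0 + 5 * dl by rewrite /dl; field.
have u2r : u2 < r ^+ 2 by rewrite rE /u2; move: dl0; clear; lra.
pose m := (1 + m') / 2.
have m0 : 0 < m by rewrite /m; lra.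
have m1 : m < 1 by rewrite /m; lra.
have m'm : m' < m by rewrite /m; lra.
have densl z : nsq (z - b) < u2 -> ~ Om z -> lam <= dens w Cz z.
  move=> zb nO; rewrite densE; last by rewrite /eball/= cabs_lt//; exact: lt_trans u2r.
  by rewrite indicE memNset//= subr0 mulr1.
have cc0 : c != 0 by apply: contra_notN nOc => /eqP ->.
have nc : 0 < nsq c by rewrite nsq_gt0.
have n1 : \forall z \near c, nsq (z - b) < u01.
  have cn := @nsq_sub_cvg R b c.
  by apply: (cvgr_lt _ cn); apply: le_lt_trans (u0P _ clc) _; rewrite /u01 ltrDl.
have n2 : \forall z \near c, nsq c / 2 < nsq z.
  by apply: (cvgr_gt _ (@nsq_continuous R c)); move: nc; clear; lra.
have [rho2 rho20 Hrho] := near_disc (filterI (filterI n1 n2) wedge).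
have n3 : \forall z \near (0 : plane R), nsq (z - b) < u01.
  have cn := @nsq_sub_cvg R b (0 : plane R).
  apply: (cvgr_lt _ cn); apply: le_lt_trans (u0P _ (subset_closure Om0)) _.
  by rewrite /u01 ltrDl.
have [e0' e0'0 He0] := near_disc n3.
pose e0 := Num.min (nsq c / 2) e0'.
have e00 : 0 < e0 by rewrite lt_min e0'0 andbT divr_gt0.
pose R2 := 2 * u2 + 2 * nsq b + 2 * nsq (b - c) + 1 + e0.
have R2E : e0 + 1 <= R2.
  by have := nsq_ge0 b; have := nsq_ge0 (b - c); rewrite /R2 /u2; move: u0_ge0 dl0; clear; lra.
have far z : nsq (z - c) < rho2 \/ u01 <= nsq (z - b) -> e0 <= nsq z.
  case => [zr|zb]; rewrite ge_min.
    by have [[_ /ltW ->] _] := Hrho _ zr.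
  apply/orP; right; rewrite leNgt; apply/negP => h.
  by have := He0 z; rewrite subr0 => /(_ h); rewrite ltNge zb.
have R2P z : nsq (z - b) < u2 -> nsq z <= R2 /\ nsq (z - c) <= R2.
  move=> zb.
  have h1 : nsq z <= 2 * nsq (z - b) + 2 * nsq b by rewrite -{1}(subrK b z); exact: nsqD2.
  have h2 : nsq (z - c) <= 2 * nsq (z - b) + 2 * nsq (b - c).
    by have := nsqD2 (z - b) (b - c); rewrite addrA subrK.
  have := nsq_ge0 b; have := nsq_ge0 (b - c); rewrite /R2; move: zb h1 h2 e00; clear.
  by move=> *; split; lra.
pose K := ln R2 - ln e0.
have K0 : 0 <= K.
  rewrite subr_ge0 ler_ln ?posrE//; move: R2E e00; clear; lra.
have bM0 : 0 < bM lam u1 u12 u2.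
  rewrite mulr_gt0//; last by rewrite exprn_gt0// /u12 /u1; move: dl0; clear; lra.
  rewrite divr_gt0 ?mulr_gt0 ?pi_gt0// /u2; move: dl0 u0_ge0; clear; lra.
have m2 : 0 < 1 - m ^+ 2 by rewrite subr_gt0 expr_lt1// ltW.
pose q := pi * lam / 4 * (1 - m ^+ 2) ^+ 2 / 24 * (rho2 / 4).
have q0 : 0 < q.
  apply: mulr_gt0; last by rewrite divr_gt0.
  apply: divr_gt0 => //; apply: mulr_gt0; last by rewrite exprn_gt0.
  by apply: divr_gt0 => //; rewrite mulr_gt0 ?pi_gt0.
pose t := Num.min 1 (Num.min (bM lam u1 u12 u2 / (K + 1)) (q / (K + 1))).
have K1 : 0 < K + 1 by rewrite ltr_wpDl.
have t0 : 0 < t by rewrite !lt_min ltr01 !divr_gt0.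
have tK x : 0 < x -> t <= x / (K + 1) -> t * K <= x.
  move=> x0; rewrite ler_pdivlMr// => h; apply: le_trans h.
  by rewrite ler_wpM2l ?(ltW t0)// lerDl.
have t1 : t <= 1 by rewrite ge_min lexx.
exists t, rho2, m, (pi * lam / 4), R2; split => //; first by rewrite t0.
move=> eps z tau eps0 zr nzc tau0 tau1.
apply: (@barrier_envelope_ge R w lam b c e u01 u1 u12 u2 rho2 e0 R2 m t eps) => //.
- move=> z' z1 z2; rewrite /dense_near.
  have cn := @nsq_sub_cvg R b z'.
  have h1 : \forall y \near z', u01 < nsq (y - b) by exact: (cvgr_gt _ cn).
  have h2 : \forall y \near z', nsq (y - b) < u2 by exact: (cvgr_lt _ cn).
  apply: filterS2 h1 h2 => y y1 y2; apply: densl => // /subset_closure/u0P.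
  by move: y1; rewrite /u01; move: dl0; clear; lra.
- move=> z' zr' nzc' out; rewrite /dense_near.
  have h1 := not_in_wedge_near e1 m'0 m'm nzc' out.
  have h2 : \forall y \near z', nsq (y - c) < rho2 by exact: (cvgr_lt _ (@nsq_sub_cvg R c z')).
  apply: filterS2 h1 h2 => y y1 /Hrho[[yb _] yw]; apply: densl.
    by apply: lt_trans yb _; rewrite /u01 /u2; move: dl0; clear; lra.
  by move/yw.
- by rewrite /u01; move: u0_ge0 dl0; clear; lra.
- by rewrite /u01 /u1; move: dl0; clear; lra.
- by rewrite /u12 /u1; move: dl0; clear; lra.
- by rewrite /u12 /u2; move: dl0; clear; lra.
- by move=> z' /Hrho[[]].
- by move: R2E e00; clear; lra.
- exact: ltW.
- by apply: tK => //; rewrite !ge_min lexx orbT.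
- by apply: tK => //; rewrite !ge_min lexx !orbT.
Qed.

End CornerBound.

Section PuncturedDisc.
Context {R : realType}.

Lemma cabs_gt0E (x : plane R) : (0 < cabs x) = (0 < nsq x).
Proof. by rewrite cabsE sqrtr_gt0. Qed.

Lemma cabs_lt1E (x : plane R) : (cabs x < 1) = (nsq x < 1).
Proof. by rewrite cabs_lt// expr1n. Qed.

Lemma cabs_le1E (x : plane R) : (cabs x <= 1) = (nsq x <= 1).
Proof. by rewrite cabs_le// expr1n. Qed.

(** Continuity relative to 0 < |tau| <= 1 is plain continuity for |tau| < 1. *)
Lemma punctured_continuous (h : plane R * plane R -> R) :
  {within [set y : plane R * plane R | 0 < cabs y.2 <= 1], continuous h} ->
  forall y, 0 < nsq y.2 -> nsq y.2 < 1 -> {for y, continuous h}.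
Proof.
move=> ch y y0 y1.
pose U := [set y : plane R * plane R | 0 < nsq y.2] `&` [set y | nsq y.2 < 1].
have cn : continuous (fun y : plane R * plane R => nsq y.2).
  move=> q; apply: (@continuous_comp _ _ _ snd nsq); last exact: nsq_continuous.
  exact: cvg_snd.
have oU : open U.
  apply: openI.
    by apply: (@open_comp _ _ (fun y : plane R * plane R => nsq y.2) [set x : R | 0 < x]) => //; exact: open_gt.
  by apply: (@open_comp _ _ (fun y : plane R * plane R => nsq y.2) [set x : R | x < 1]) => //; exact: open_lt.
have US : U `<=` [set y : plane R * plane R | 0 < cabs y.2 <= 1].
  by move=> q [/= q0 q1]; rewrite cabs_gt0E q0 cabs_le1E ltW.
have := continuous_subspaceW US ch; rewrite continuous_open_subspace//; apply.
by rewrite inE.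
Qed.

Lemma le_of_eps (x y v : R) : (forall eps : R, 0 < eps -> x + eps * y <= v) -> x <= v.
Proof.
move=> H; apply/ler_addgt0Pr => d d0.
have P : 0 < d / (`|y| + 1) by rewrite divr_gt0// ltr_wpDl.
have := H _ P; rewrite -lerBrDr; move/le_trans; apply; rewrite lerD2l.
have h : d / (`|y| + 1) * `|y| <= d.
  by rewrite mulrAC ler_pdivrMr ?ltr_wpDl// ler_wpM2l ?(ltW d0)// lerDl.
have h2 : - (d / (`|y| + 1) * `|y|) <= d / (`|y| + 1) * y.
  by rewrite -mulrN ler_wpM2l ?(ltW P)// lerNl -normrN ler_norm.
by move: h h2; clear; lra.
Qed.

(** Letting eps tend to 0 and then z tend to the corner. *)
Lemma corner_value (w : form11 R) (Om : set (plane R)) (c b e : plane R)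
    (r lam m' : R) (f : P1 R * plane R -> R) : open Om -> bounded_set Om -> Om 0 ->
  closure Om c -> ~ Om c -> 0 < lam -> semipositive w -> closure Om `<=` eball b r ->
  (forall z, eball b r z -> dens w Cz z = lam * (1 - \1_Om z)) ->
  nsq e = 1 -> 0 < m' -> m' < 1 -> (\forall z \near c, Om z -> in_wedge m' e c z) ->
  (forall p tau, 0 < cabs tau <= 1 -> envelope w 0 (p, tau) = (f (p, tau))%:E) ->
  {within [set y : plane R * plane R | 0 < cabs y.2 <= 1],
     continuous (fun y : plane R * plane R => f (Some y.1, y.2))} ->
  exists2 t, 0 < t <= 1 & forall tau, 0 < nsq tau -> nsq tau < 1 ->
    (1 - t) * ln (nsq tau) <= f (Some c, tau).
Proof.
move=> oOm bOm Om0 clc nOc lam0 w0 sub densE e1 m'0 m'1 wedge fE cf.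
have [t [rho2 [m [a [R2 [t0 rho20 H]]]]]] := envelope_corner_bound oOm bOm Om0 clc nOc lam0 w0
  sub densE e1 m'0 m'1 wedge.
exists t => // tau tau0 tau1.
have low z : nsq (z - c) < rho2 -> z != c ->
    - wedge_fun m a e c z + (1 - t) * ln (nsq tau) <= f (Some z, tau).
  move=> zr nzc; apply: (@le_of_eps _ (ln (nsq (z - c)) - ln R2)) => eps eps0.
  have tau1' : cabs tau < 1 by rewrite cabs_lt1E.
  have := H eps z tau eps0 zr nzc tau0 tau1'; rewrite fE ?cabs_gt0E ?tau0 ?(ltW tau1')// lee_fin.
  by rewrite addrAC.
rewrite leNgt; apply/negP => lt.
have c1 : (fun z : plane R => f (Some z, tau)) @ c --> f (Some c, tau).
  have cc := punctured_continuous cf (y := (c, tau)) tau0 tau1.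
  have i1 : (fun z : plane R => z) @ c --> c by exact: cvg_id.
  have i2 : (fun z : plane R => tau) @ c --> tau by exact: cvg_cst.
  exact: (cvg_comp (fun z : plane R => (z, tau)) (fun y : plane R * plane R => f (Some y.1, y.2)) (cvg_pair i1 i2) cc).
have c2 : (fun z : plane R => f (Some z, tau) + wedge_fun m a e c z) @ c --> f (Some c, tau) + wedge_fun m a e c c.
  by apply: cvgD => //; exact: wedge_fun_continuous.
have wc : wedge_fun m a e c c = 0.
  by rewrite /wedge_fun subrr frameE /= /wedge_quad !mulr0 !addr0 !subr0 !mulr0 oppr0 addr0 maxxx expr0n /= subrr addr0 !mulr0 addr0.
have n1 : \forall z \near c, f (Some z, tau) + wedge_fun m a e c z < (1 - t) * ln (nsq tau).
  by apply: (cvgr_lt _ c2); rewrite wc addr0.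
have n2 : \forall z \near c, nsq (z - c) < rho2.
  by apply: (cvgr_lt _ (@nsq_sub_cvg R c c)); rewrite subrr /nsq/= expr0n addr0.
have cadd : (fun h : plane R => c + h) @ (0 : plane R) --> c.
  by rewrite -[X in _ --> X]addr0; apply: cvgD; [exact: cvg_cst|exact: cvg_id].
have [h h0 [hl hr]] := near0_pick (cadd _ (filterI n1 n2)).
have nzc : c + h != c by rewrite -subr_eq0 addrAC subrr add0r -nsq_gt0.
by have := low _ hr nzc; rewrite addrC lerBlDr leNgt hl.
Qed.

End PuncturedDisc.

(** * Near the corner the domain lies in an acute wedge *)

Section CornerWedgeGeometry.
Context {R : realType}.
Implicit Types (z c e p q : plane R).

Lemma frame_expi (phi be : R) : frame (expi phi) (expi be) = expi (be - phi).
Proof. by rewrite frameE /expi /= cosB sinB; congr pair; ring. Qed.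

Lemma frameZ e (s : R) z : frame e (s *: z) = s *: frame e z.
Proof. by rewrite !frameE; apply: injective_projections; rewrite /= /GRing.scale /=; ring. Qed.

(** Points of a regular arc near its end point c: those with small parameter are in
    any wedge around the tangent, the others are away from c by injectivity. *)
Lemma arc_in_wedge (g : R -> plane R) c (phi be m : R) : regular_arc g -> g 0 = c ->
  (g^`())%classic 0 = cabs ((g^`())%classic 0) *: expi be ->
  `|sin (be - phi)| < m * cos (be - phi) ->
  exists2 rho : R, 0 < rho & forall t, 0 <= t <= 1 -> nsq (g t - c) < rho ->
    `|(frame (expi phi) (g t - c)).2| <= m * (frame (expi phi) (g t - c)).1.
Proof.
move=> [dg _ ng ig] g0 gv wedge.
have v0 : 0 < cabs ((g^`())%classic 0).
  rewrite cabs_gt0E nsq_gt0; apply: ng; by rewrite lexx ler01.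
have cg : (fun h : R => h^-1 *: (g h - c)) @ 0^' --> (g^`())%classic 0.
  have d := dg 0; rewrite derive1E.
  have -> : (fun h : R => h^-1 *: (g h - c)) =
      (fun h : R => h^-1 *: ((g \o shift 0) (h *: (1 : R)) - g 0)).
    by apply/funext => h /=; rewrite g0 addr0 /GRing.scale /= mulr1.
  exact: d.
have cf : (fun h : R => frame (expi phi) (h^-1 *: (g h - c))) @ 0^' -->
    frame (expi phi) ((g^`())%classic 0).
  by apply: cvg_cmul; [exact: cvg_cst|exact: cg].
have c1 : (fun h : R => (frame (expi phi) (h^-1 *: (g h - c))).1) @ 0^' -->
    (frame (expi phi) ((g^`())%classic 0)).1 by exact: cvg_fst_comp.
have c2 : (fun h : R => (frame (expi phi) (h^-1 *: (g h - c))).2) @ 0^' -->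
    (frame (expi phi) ((g^`())%classic 0)).2 by exact: cvg_snd_comp.
have cl : (fun h : R => m * (frame (expi phi) (h^-1 *: (g h - c))).1 -
      `|(frame (expi phi) (h^-1 *: (g h - c))).2|) @ 0^' -->
    m * (frame (expi phi) ((g^`())%classic 0)).1 - `|(frame (expi phi) ((g^`())%classic 0)).2|.
  by apply: cvgB; [apply: cvgM => //; exact: cvg_cst|exact: cvg_norm].
have pos : 0 < m * (frame (expi phi) ((g^`())%classic 0)).1 - `|(frame (expi phi) ((g^`())%classic 0)).2|.
  rewrite gv frameZ frame_expi /= /GRing.scale /= normrM (gtr0_norm v0) subr_gt0.
  by rewrite mulrCA ltr_pM2l.
have near0 : \forall h \near 0^', 0 < m * (frame (expi phi) (h^-1 *: (g h - c))).1 -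
      `|(frame (expi phi) (h^-1 *: (g h - c))).2| by exact: (cvgr_gt _ cl).
have [dl dl0 Hdl] := near0.
have cont : continuous g by move=> t; apply: differentiable_continuous; apply/derivable1_diffP; exact: dg.
have near_part t : 0 <= t -> t < dl -> `|(frame (expi phi) (g t - c)).2| <= m * (frame (expi phi) (g t - c)).1.
  rewrite le_eqVlt => /orP[/eqP <- _|t0 tdl].
    by rewrite g0 subrr frameE /= !mulr0 addr0 subr0 normr0 mulr0.
  have tb : ball (0 : R) dl t by rewrite -ball_normE /= sub0r normrN gtr0_norm.
  have H : 0 < m * (frame (expi phi) (t^-1 *: (g t - c))).1 -
      `|(frame (expi phi) (t^-1 *: (g t - c))).2| := Hdl t tb (lt0r_neq0 t0).
  move: H; rewrite frameZ; set x := frame _ _.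
  have -> : (t^-1 *: x).1 = t^-1 * x.1 by [].
  have -> : (t^-1 *: x).2 = t^-1 * x.2 by [].
  rewrite normrM gtr0_norm ?invr_gt0// mulrCA -mulrBr pmulr_rgt0 ?invr_gt0// subr_gt0.
  exact: ltW.
have [dl1|dl1] := ltP 1 dl.
  exists 1 => // t /andP[t0 t1] _; apply: near_part => //; exact: le_lt_trans dl1.
have cn : continuous (fun t => nsq (g t - c)).
  move=> t; apply: (@continuous_comp _ _ _ (fun t => g t - c) nsq); last exact: nsq_continuous.
  by apply: cvgB; [exact: cont|exact: cvg_cst].
have [t0 t0I t0min] := EVT_min dl1 (continuous_subspaceT cn).
move: t0I; rewrite in_itv /= => /andP[t0d t01].
have t0p : 0 < t0 by exact: lt_le_trans t0d.
exists (nsq (g t0 - c)).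
  rewrite nsq_gt0 subr_eq0; apply/eqP; rewrite -g0 => /ig.
  rewrite (ltW t0p) t01 lexx ler01 => /(_ isT isT) E.
  by move: t0p; rewrite E ltxx.
move=> t /andP[tp t1] tr; apply: near_part => //; rewrite ltNge; apply/negP => dt.
by have := t0min t; rewrite in_itv /= dt t1 => /(_ isT); rewrite leNgt tr.
Qed.

(** A segment that avoids the boundary stays on one side of it. *)
Lemma segment_avoids_boundary (Om : set (plane R)) p q : open Om -> Om p ->
  (forall s : R, 0 <= s <= 1 -> ~ boundary Om (p + s *: (q - p))) -> Om q.
Proof.
move=> oOm Op nb.
pose ga (s : R) := p + s *: (q - p).
have cga : continuous ga.
  by move=> s; apply: cvgD; [exact: cvg_cst|apply: cvgZl; exact: cvg_id].
pose B := [set s : R | 0 <= s <= 1 /\ Om (ga s)].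
have AE : `[0, 1]%classic = [set s : R | 0 <= s <= 1].
  by apply/seteqP; split => s /=; rewrite in_itv.
have : B = `[0, 1]%classic.
  have := @segment_connected R 0 1; apply.
  - by exists 0; split; [rewrite lexx ler01|rewrite /ga scale0r addr0].
  - exists (ga @^-1` Om); first by apply: open_comp => // s _; exact: cga.
    by rewrite AE; apply/seteqP; split => s [].
  - exists (ga @^-1` closure Om).
      by apply: closed_comp; [move=> s _; exact: cga|exact: closed_closure].
    rewrite AE; apply/seteqP; split => s [s01 Os]; split => //.
      exact: subset_closure.
    apply: contrapT => nOs; apply: (nb s s01); split => //.
    by move=> /interior_subset.
move=> BE; have : B 1 by rewrite BE AE /= ler01 lexx.
by move=> [_]; rewrite /ga scale1r addrC subrK.
Qed.

(** Near c the boundary lies in a closed wedge of slope m < 1.  A point of the domain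
    outside that wedge could be joined, without meeting the boundary, to the points
    opposite to the bisector, which are not in the domain. *)
Lemma corner_in_wedge (Om : set (plane R)) c theta : open Om -> corner_point Om c theta ->
  theta < pi / 2 -> [/\ closure Om c, ~ Om c & exists e m', [/\ nsq e = 1, 0 < m', m' < 1 &
    \forall z \near c, Om z -> in_wedge m' e c z]].
Proof.
move=> oOm [[clc nic] [/andP[th0 th2] [g1 [g2 [al [[rg1 rg2] [g10 g20] bd [t1 t2] [_ out]]]]]]] acute.
have nOc : ~ Om c by move=> Oc; apply: nic; exact: open_nbhs_nbhs.
split => //; pose eta := theta / 2; pose phi := al + eta.
have pi0 := @pi_gt0 R.
have eta0 : 0 < eta by rewrite divr_gt0.
have co : 0 < cos eta by apply: cos_gt0_pihalf; rewrite /eta; move: th0 acute pi0; clear; lra.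
have si : 0 < sin eta by apply: sin_gt0_pi; rewrite /eta; move: th0 acute pi0; clear; lra.
have sc : sin eta < cos eta.
  rewrite -(@ltr_pXn2r _ 2) ?nnegrE ?(ltW co) ?(ltW si)//.
  have h : 0 < cos theta by apply: cos_gt0_pihalf; move: th0 acute pi0; clear; lra.
  have E : cos theta = cos eta ^+ 2 - sin eta ^+ 2.
    by rewrite (_ : theta = eta + eta) ?cosD ?expr2// /eta -splitr.
  by rewrite -subr_gt0 -E.
pose k := sin eta / cos eta.
have k0 : 0 < k by rewrite divr_gt0.
have k1 : k < 1 by rewrite ltr_pdivrMr// mul1r.
pose m := (1 + k) / 2; pose m' := (1 + m) / 2.
have km : k < m by rewrite /m; lra.
have m0 : 0 < m by rewrite /m; lra.
have mm' : m < m' by rewrite /m' /m; lra.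
have m'1 : m' < 1 by rewrite /m' /m; lra.
have sm : sin eta < m * cos eta by rewrite -ltr_pdivrMr.
have w1 : `|sin (al - phi)| < m * cos (al - phi).
  have -> : al - phi = - eta by rewrite /phi; ring.
  by rewrite sinN cosN normrN gtr0_norm.
have w2 : `|sin (al + theta - phi)| < m * cos (al + theta - phi).
  have -> : al + theta - phi = eta by rewrite /phi /eta; field.
  by rewrite gtr0_norm.
have [r1 r10 H1] := arc_in_wedge rg1 g10 t1 w1.
have [r2 r20 H2] := arc_in_wedge rg2 g20 t2 w2.
have [r3 r30 H3] := near_disc bd.
pose rho := Num.min r1 (Num.min r2 r3).
have rho0 : 0 < rho by rewrite !lt_min r10 r20.
have bdw z : nsq (z - c) < rho -> boundary Om z ->
    `|(frame (expi phi) (z - c)).2| <= m * (frame (expi phi) (z - c)).1.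
  rewrite !lt_min => /and3P[z1 z2 z3] /(H3 z z3)[] [t]; rewrite /= in_itv /= => t01 E.
    by move: z1; rewrite -E; exact: H1.
  by move: z2; rewrite -E; exact: H2.
exists (expi phi), m'; split => //; first exact: nsq_expi.
  exact: lt_trans mm'.
have ray : \forall t \near 0^'+, ~ Om (c + t *: expi (al + (eta + pi))).
  by apply: out; rewrite /eta; move: th0 th2 pi0; clear; lra.
have [t [t0 [trho nray]]] : exists t : R, 0 < t /\ (t ^+ 2 < rho /\ ~ Om (c - t *: expi phi)).
  near (0 : R)^'+ => t; exists t; split; first by near: t; exact: nbhs_right_gt.
  split.
    near: t; have ct : (fun t : R => t ^+ 2) @ (0 : R) --> (0 : R) ^+ 2.
      by rewrite !expr2; apply: cvgM; exact: cvg_id.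
    have h : \forall t \near (0 : R), t ^+ 2 < rho by apply: (cvgr_lt _ ct); rewrite expr0n.
    exact: cvg_within h.
  have -> : c - t *: expi phi = c + t *: expi (al + (eta + pi)).
    congr (_ + _); rewrite addrA -/phi /expi cosDpi sinDpi.
    by apply: injective_projections; rewrite /= /GRing.scale /=; ring.
  by near: t; exact: ray.
(* Outside the closed wedge, the half plane bounded by one of its sides contains
   both z and the points opposite to the bisector. *)
have half (sg : R) z : sg = 1 \/ sg = -1 -> nsq (z - c) < rho ->
    m * (frame (expi phi) (z - c)).1 < sg * (frame (expi phi) (z - c)).2 -> ~ Om z.
  move=> sgn zr zh Oz; apply: nray.
  apply: (segment_avoids_boundary oOm Oz) => s /andP[s0 s1].
  set y := _ + _; have yE : y - c = (1 - s) *: (z - c) + (s * t) *: (- expi phi).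
    by rewrite /y; apply: injective_projections; rewrite /= /GRing.scale /=; ring.
  have fe : frame (expi phi) (y - c) = (1 - s) *: frame (expi phi) (z - c) - (s * t, 0).
    rewrite yE; set d := z - c; rewrite !frameE /expi.
    apply: injective_projections; rewrite /= /GRing.scale /=; last by ring.
    by rewrite -[s * t in RHS]mulr1 -(cos2Dsin2 phi); ring.
  have s1' : 0 <= 1 - s by rewrite subr_ge0.
  have yr : nsq (y - c) < rho.
    have conv (a b a' b' u : R) : 0 <= u -> u <= 1 ->
        ((1 - u) * a + u * a') ^+ 2 + ((1 - u) * b + u * b') ^+ 2 <=
        (1 - u) * (a ^+ 2 + b ^+ 2) + u * (a' ^+ 2 + b' ^+ 2).
      move=> u0 u1; have h : 0 <= (1 - u) * u * ((a - a') ^+ 2 + (b - b') ^+ 2).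
        by rewrite !mulr_ge0 ?subr_ge0// addr_ge0 ?sqr_ge0.
      by move: h; clear; lra.
    have := conv (z - c).1 (z - c).2 (- (t * (expi phi).1)) (- (t * (expi phi).2)) s s0 s1.
    have -> : (- (t * (expi phi).1)) ^+ 2 + (- (t * (expi phi).2)) ^+ 2 = t ^+ 2.
      rewrite -[RHS]mulr1 -(nsq_expi phi) /nsq; ring.
    rewrite -/(nsq (z - c)) yE /nsq /= /GRing.scale /= => h.
    have -> : (1 - s) * (z.1 - c.1) + s * t * - cos phi =
       (1 - s) * (z.1 - c.1) + s * - (t * cos phi) by ring.
    have -> : (1 - s) * (z.2 - c.2) + s * t * - sin phi =
       (1 - s) * (z.2 - c.2) + s * - (t * sin phi) by ring.
    apply: le_lt_trans h _.
    move: zr; rewrite /nsq /= => zr.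
    have := ler_wpM2l s1' (ltW zr); have := ler_wpM2l s0 (ltW trho).
    have [se|sp] := eqVneq s 0; first by rewrite se; move: zr; clear; lra.
    have sp' : 0 < s by rewrite lt0r sp.
    have := trho; rewrite -(ltr_pM2l sp'); clear; lra.
  move=> /(bdw _ yr); apply/negP; rewrite -ltNge fe /= /GRing.scale /=.
  have key : 0 < sg * ((1 - s) * (frame (expi phi) (z - c)).2 - 0) -
      m * ((1 - s) * (frame (expi phi) (z - c)).1 - s * t).
    have -> : sg * ((1 - s) * (frame (expi phi) (z - c)).2 - 0) -
      m * ((1 - s) * (frame (expi phi) (z - c)).1 - s * t) =
      (1 - s) * (sg * (frame (expi phi) (z - c)).2 - m * (frame (expi phi) (z - c)).1) + m * (s * t) by ring.
    have [se|sp] := eqVneq s 0.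
      by rewrite se subr0 mul1r !mul0r mulr0 addr0 subr_gt0.
    have sp' : 0 < s by rewrite lt0r sp.
    apply: ltr_wpDl; first by apply: mulr_ge0 => //; rewrite subr_ge0 ltW.
    exact: (mulr_gt0 m0 (mulr_gt0 sp' t0)).
  apply: (@lt_le_trans _ _ (sg * ((1 - s) * (frame (expi phi) (z - c)).2 - 0))).
    by rewrite -subr_gt0.
  by case: sgn => ->; rewrite ?mul1r ?mulN1r ?ler_norm// -normrN ler_norm.
have n1 : \forall z \near c, nsq (z - c) < rho.
  by apply: (cvgr_lt _ (@nsq_sub_cvg R c c)); rewrite subrr /nsq/= expr0n addr0.
apply: filterS n1 => z zr Oz; rewrite /in_wedge.
have zw : `|(frame (expi phi) (z - c)).2| <= m * (frame (expi phi) (z - c)).1.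
  rewrite ler_norml; apply/andP; split.
    rewrite lerNl leNgt; apply/negP => h.
    by apply: (half (-1) z _ zr _ Oz); [right|rewrite mulN1r].
  rewrite leNgt; apply/negP => h.
  by apply: (half 1 z _ zr _ Oz); [left|rewrite mul1r].
have xp : 0 < (frame (expi phi) (z - c)).1.
  rewrite lt_def -(pmulr_rge0 _ m0) (le_trans _ zw)// andbT.
  apply/eqP => x0; move: zw; rewrite x0 mulr0 normr_le0 => /eqP y0.
  apply: nOc; suff <- : z = c by [].
  apply/eqP; rewrite -subr_eq0 -nsq_eq0 -(nsq_frame _ (nsq_expi phi)) /nsq x0 y0.
  by rewrite expr0n addr0.
by apply: le_lt_trans zw _; rewrite ltr_pM2r.
Unshelve. all: by end_near. Qed.

End CornerWedgeGeometry.

(** * Trigonometric integrals *)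

Section TrigIntegrals.
Context {R : realType}.

Let cc : continuous (@cos R). Proof. exact: continuous_cos. Qed.
Let cs : continuous (@sin R). Proof. exact: continuous_sin. Qed.
Let cMul (f g : R -> R) : continuous f -> continuous g -> continuous (fun t => f t * g t).
Proof. by move=> cf cg t; apply: cvgM; [exact: cf|exact: cg]. Qed.

Let hpi : 0 <= @pi R / 2 <= 2 * pi.
Proof. by have := @pi_gt0 R; move=> h; apply/andP; split; lra. Qed.
Let hpi' : 0 <= @pi R <= 2 * pi.
Proof. by have := @pi_gt0 R; move=> h; apply/andP; split; lra. Qed.

Let cosper (t : R) : cos (t + 2 * pi) = cos t.
Proof. by rewrite mulr_natl cosD2pi. Qed.
Let sinper (t : R) : sin (t + 2 * pi) = sin t.
Proof. by rewrite mulr_natl sinD2pi. Qed.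

Lemma cint_cos : cint (@cos R) = 0.
Proof.
have := cint_shift hpi' cc cosper.
rewrite (_ : (fun t => cos (t + pi)) = fun t => -1 * cos t); last by apply/funext => t; rewrite cosDpi mulN1r.
by rewrite cintZ//; lra.
Qed.

Lemma cint_sin : cint (@sin R) = 0.
Proof.
have := cint_shift hpi' cs sinper.
rewrite (_ : (fun t => sin (t + pi)) = fun t => -1 * sin t); last by apply/funext => t; rewrite sinDpi mulN1r.
by rewrite cintZ//; lra.
Qed.

Lemma cint_cos_sin : cint (fun t : R => cos t * sin t) = 0.
Proof.
have := cint_shift hpi (cMul cc cs) (fun t => congr2 _ (cosper t) (sinper t)).
rewrite (_ : (fun t => cos (t + pi / 2) * sin (t + pi / 2)) = fun t => -1 * (cos t * sin t)).
  by rewrite cintZ; [lra|exact: cMul].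
by apply/funext => t; rewrite cosDpihalf sinDpihalf; ring.
Qed.

Lemma cint_cos2 : cint (fun t : R => cos t * cos t) = pi.
Proof.
have h := cint_shift hpi (cMul cc cc) (fun t => congr2 _ (cosper t) (cosper t)).
have e : (fun t => cos (t + pi / 2) * cos (t + pi / 2)) = (fun t : R => sin t * sin t).
  by apply/funext => t; rewrite cosDpihalf; ring.
rewrite e in h.
have := @cint_cst R 1.
rewrite (_ : (fun=> 1) = fun t : R => cos t * cos t + sin t * sin t); last first.
  by apply/funext => t; rewrite -(cos2Dsin2 t) !expr2.
by rewrite cintD; [rewrite h; lra|exact: cMul|exact: cMul].
Qed.

Lemma cint_sin2 : cint (fun t : R => sin t * sin t) = pi.
Proof.
have h := cint_shift hpi (cMul cc cc) (fun t => congr2 _ (cosper t) (cosper t)).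
have e : (fun t => cos (t + pi / 2) * cos (t + pi / 2)) = (fun t : R => sin t * sin t).
  by apply/funext => t; rewrite cosDpihalf; ring.
by rewrite e cint_cos2 in h.
Qed.

Lemma cint_trig (a b c d e k : R) :
  cint (fun t : R => a + b * cos t + c * sin t + d * (cos t * cos t) +
    e * (cos t * sin t) + k * (sin t * sin t)) = 2 * pi * a + pi * (d + k).
Proof.
have cZ (x : R) (f : R -> R) : continuous f -> continuous (fun t => x * f t).
  by move=> cf t; apply: cvgM; [exact: cvg_cst|exact: cf].
have cD (f g : R -> R) : continuous f -> continuous g -> continuous (fun t => f t + g t).
  by move=> cf cg t; apply: cvgD; [exact: cf|exact: cg].
have ca : continuous (fun _ : R => a) by move=> t; exact: cvg_cst.
have c1 := cZ b _ cc; have c2 := cZ c _ cs; have c3 := cZ d _ (cMul cc cc).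
have c4 := cZ e _ (cMul cc cs); have c5 := cZ k _ (cMul cs cs).
have d1 := cD _ _ ca c1; have d2 := cD _ _ d1 c2; have d3 := cD _ _ d2 c3; have d4 := cD _ _ d3 c4.
rewrite cintD// cintD// cintD// cintD// cintD// !cintZ//; try exact: cMul.
by rewrite cint_cst cint_cos cint_sin cint_cos2 cint_cos_sin cint_sin2; ring.
Qed.

End TrigIntegrals.

Section IntegralMonotone.
Context {R : realType}.

(** The integral is monotone without any measurability assumption. *)
Lemma le_integral_any (f1 f2 : R -> \bar R) (D : set R) :
  (forall t, D t -> (f1 t <= f2 t)%E) ->
  (\int[@lebesgue_measure R]_(t in D) f1 t <= \int[@lebesgue_measure R]_(t in D) f2 t)%E.
Proof.
move=> f12; rewrite /integral.
have f12D t : ((f1 \_ D) t <= (f2 \_ D) t)%E.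
  by rewrite /patch; case: ifPn => // tD; apply: f12; rewrite -inE.
apply: leeB; apply: ereal_sup_le => _ [h hf <-]; exists h => // t;
  apply: le_trans (hf t) _.
  by rewrite !funeposE ge_max !le_max f12D lexx orbT.
by rewrite !funenegE ge_max !le_max leeN2 f12D lexx orbT.
Qed.

End IntegralMonotone.

(** * The slope of the envelope at tau = 1 *)

Section BoundarySlope.
Context {R : realType}.
Implicit Types (z : plane R).

(** F stands for the envelope in the finite chart and g for its derivative in the
    direction of the real part of tau. *)
Context (F g : plane R * plane R -> R).
Context (F0 : forall z tau, nsq tau = 1 -> F (z, tau) = 0)
  (cF : {within [set y : plane R * plane R | 0 < cabs y.2 <= 1], continuous F})
  (cg : {within [set y : plane R * plane R | 0 < cabs y.2 <= 1], continuous g})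
  (dF : forall y : plane R * plane R, 0 < cabs y.2 < 1 -> is_derive y (0, (1, 0)) F (g y)).

(** The derivative of F in the direction of the real part of tau, at tau = 1. *)
Definition slope z : R := g (z, (1, 0)).

Lemma within_punctured (h : plane R * plane R -> R) y :
  {within [set y : plane R * plane R | 0 < cabs y.2 <= 1], continuous h} ->
  0 < nsq y.2 <= 1 -> forall d : R, 0 < d -> exists2 r : R, 0 < r & forall z tau,
    nsq (z - y.1) < r -> nsq (tau - y.2) < r -> 0 < nsq tau <= 1 -> `|h (z, tau) - h y| < d.
Proof.
move=> /subspace_continuousP ch y01 d d0.
have Sy : [set y : plane R * plane R | 0 < cabs y.2 <= 1] y by rewrite /= cabs_gt0E cabs_le1E.
have hy := ch y Sy; move/cvgrPdist_lt : hy => /(_ d d0) hy.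
have [[A B] /= [An Bn] AB] := hy.
have [r1 r10 H1] := near_disc An; have [r2 r20 H2] := near_disc Bn.
exists (Num.min r1 r2); first by rewrite lt_min r10.
move=> z tau; rewrite !lt_min => /andP[z1 _] /andP[_ t2] t01; rewrite distrC.
apply: (AB (z, tau)); first by split; [exact: H1|exact: H2].
by rewrite /= cabs_gt0E cabs_le1E.
Qed.

Lemma sqrt1_bounds (x : R) : x ^+ 2 <= 1 ->
  1 - x ^+ 2 <= Num.sqrt (1 - x ^+ 2) /\ Num.sqrt (1 - x ^+ 2) <= 1.
Proof.
move=> x1; have h0 : 0 <= 1 - x ^+ 2 by rewrite subr_ge0.
have h1 : Num.sqrt (1 - x ^+ 2) <= 1.
  by rewrite -[leRHS]sqrtr1 ler_sqrt// gerBl sqr_ge0.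
split => //; rewrite -{1}(sqr_sqrtr h0) expr2 ler_piMr// sqrtr_ge0.
Qed.

(** The mean value theorem on the horizontal segment from (a, b) to the unit circle,
    where F vanishes. *)
Lemma slice_mvt z (a b : R) : 0 < a -> a ^+ 2 + b ^+ 2 < 1 ->
  exists2 x, a < x < Num.sqrt (1 - b ^+ 2) &
    F (z, (a, b)) = - ((Num.sqrt (1 - b ^+ 2) - a) * g (z, (x, b))).
Proof.
move=> a0 ab; set s := Num.sqrt (1 - b ^+ 2).
have b1 : 0 < 1 - b ^+ 2 by have := sqr_ge0 a; move: ab; clear - F0 cF cg dF; lra.
have sE : s ^+ 2 = 1 - b ^+ 2 by rewrite sqr_sqrtr// ltW.
have s0 : 0 <= s by exact: sqrtr_ge0.
have as_ : a < s by rewrite -(@ltr_pXn2r _ 2) ?nnegrE ?(ltW a0)// sE; move: ab; clear - F0 cF cg dF; lra.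
pose ph (x : R) := F (z, (x, b)).
have n01 x : a <= x -> x <= s -> 0 < nsq ((x, b) : plane R) <= 1.
  move=> ax xs; have x0 : 0 < x by exact: lt_le_trans ax.
  have xx : x ^+ 2 <= 1 - b ^+ 2 by rewrite -sE ler_pXn2r ?nnegrE// ltW.
  rewrite /nsq /=; apply/andP; split; last by move: xx; clear - F0 cF cg dF; lra.
  by rewrite ltr_pwDl ?sqr_ge0// exprn_gt0.
have dph x : x \in `]a, s[ -> is_derive x (1 : R) ph (g (z, (x, b))).
  rewrite in_itv /= => /andP[ax xs].
  have x0 : 0 < x by exact: lt_trans ax.
  have in01 : 0 < cabs ((x, b) : plane R) < 1.
    have /andP[h _] := n01 x (ltW ax) (ltW xs).
    rewrite cabs_gt0E h cabs_lt1E /nsq /=.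
    have xx : x ^+ 2 < 1 - b ^+ 2 by rewrite -sE ltr_pXn2r ?nnegrE// ltW.
    by move: xx; clear - F0 cF cg dF; lra.
  have := dF (y := (z, (x, b))) in01; move/is_derive_line => h.
  apply/is_derive_line; move: h.
  suff -> : (fun t : R => F ((z, (x, b)) + t *: (0, (1, 0)))) = (fun t : R => ph (x + t *: 1)) by [].
  apply/funext => t; rewrite /ph; congr F.
  by rewrite [RHS]surjective_pairing; apply: injective_projections => //=;
    rewrite ?scaler0 ?addr0//; apply: injective_projections => //=; rewrite scaler0 addr0.
have cph : {within `[a, s], continuous ph}.
  apply/subspace_continuousP => x; rewrite /= in_itv /= => /andP[ax xs].
  apply/cvgrPdist_lt => d d0.
  have [r r0 Hr] := within_punctured (y := (z, (x, b))) cF (n01 x ax xs) d0.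
  have cx : (fun x' : R => (x' - x) ^+ 2) @ x --> (x - x) ^+ 2.
    by rewrite expr2; apply: cvgM; (apply: cvgB; [exact: cvg_id|exact: cvg_cst]).
  have near_x : \forall x' \near x, (x' - x) ^+ 2 < r.
    by apply: (cvgr_lt _ cx); rewrite subrr expr0n.
  rewrite near_withinE; apply: filterS near_x => x' xx'.
  rewrite /= in_itv /= => /andP[ax' xs']; rewrite distrC; apply: Hr; last exact: n01.
    by rewrite subrr /nsq /= expr0n addr0.
  by rewrite /nsq /= subrr expr0n addr0.
have [x /[!in_itv] xI E] := MVT as_ dph cph.
exists x => //; have Fs : ph s = 0 by apply: F0; rewrite /nsq /= sE subrK.
by move: E; rewrite Fs sub0r /ph => E; rewrite mulrC -E opprK.
Qed.

Lemma nsq_one_c_in01 : 0 < nsq (one_c : plane R) <= 1.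
Proof. by rewrite nsq_one_c ltr01 lexx. Qed.

Lemma slope_near z0 (d : R) : 0 < d -> exists2 r : R, 0 < r & forall z, nsq (z - z0) < r ->
  `|slope z - slope z0| < d.
Proof.
move=> d0; have [r r0 H] := within_punctured (y := (z0, one_c)) cg nsq_one_c_in01 d0.
exists r => // z zr; apply: H => //=; last exact: nsq_one_c_in01.
by rewrite subrr /nsq /= expr0n addr0.
Qed.

Lemma slope_continuous : continuous slope.
Proof.
move=> z0; apply/cvgrPdist_lt => d d0; have [r r0 H] := slope_near z0 d0.
have n1 : \forall z \near z0, nsq (z - z0) < r.
  by apply: (cvgr_lt _ (@nsq_sub_cvg R z0 z0)); rewrite subrr /nsq/= expr0n addr0.
by apply: filterS n1 => z zr; rewrite distrC; exact: H.
Qed.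

(** F (z, tau) is equivalent to minus the horizontal distance to the circle times the
    slope, uniformly near (z0, 1). *)
Lemma slope_asymp z0 (d : R) : 0 < d -> exists2 r : R, 0 < r & forall z (a b : R),
  nsq (z - z0) < r -> (a - 1) ^+ 2 + b ^+ 2 < r -> 0 < a -> a ^+ 2 + b ^+ 2 < 1 ->
  `|F (z, (a, b)) + (Num.sqrt (1 - b ^+ 2) - a) * slope z| <= d * (Num.sqrt (1 - b ^+ 2) - a).
Proof.
move=> d0; have d20 : 0 < d / 2 by rewrite divr_gt0.
have [r1 r10 H1] := within_punctured (y := (z0, one_c)) cg nsq_one_c_in01 d20.
have [r2 r20 H2] := slope_near z0 d20.
exists (Num.min r1 r2); first by rewrite lt_min r10.
move=> z a b; rewrite lt_min => /andP[z1 z2]; rewrite lt_min => /andP[ab1 _] a0 ab.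
have [x /andP[ax xs] ->] := slice_mvt z a0 ab.
set s := Num.sqrt _ in xs *.
have b1 : b ^+ 2 <= 1 by have := sqr_ge0 a; move: ab; clear - F0 cF cg dF; lra.
have [_ s1] := sqrt1_bounds b1; rewrite -/s in s1.
have x1 : x < 1 by exact: lt_le_trans s1.
have sE : s ^+ 2 = 1 - b ^+ 2 by rewrite sqr_sqrtr// subr_ge0.
have x0 : 0 < x by exact: lt_trans ax.
have xx : x ^+ 2 <= s ^+ 2 by rewrite ler_pXn2r ?nnegrE// ltW// (lt_trans x0).
have xa : (x - 1) ^+ 2 <= (a - 1) ^+ 2.
  have h : 0 <= (x - a) * (2 - x - a) by rewrite mulr_ge0//; move: ax x1; clear - F0 cF cg dF; lra.
  by move: h; clear - F0 cF cg dF; lra.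
have h1 : `|g (z, (x, b)) - g (z0, one_c)| < d / 2.
  apply: H1 => //=.
    by rewrite /nsq /= subr0; apply: le_lt_trans ab1; rewrite lerD2r.
  rewrite /nsq /=; apply/andP; split; last by move: xx sE; clear - F0 cF cg dF; lra.
  by rewrite ltr_pwDl ?sqr_ge0// exprn_gt0.
have h2 := H2 z z2.
have -> : - ((s - a) * g (z, (x, b))) + (s - a) * slope z =
    (s - a) * ((slope z - slope z0) - (g (z, (x, b)) - g (z0, one_c))).
  by rewrite /slope; ring.
have sa : 0 < s - a by move: ax xs; clear - F0 cF cg dF; lra.
rewrite normrM (gtr0_norm sa) mulrC ler_pM2r//.
by apply: le_trans (ler_normB _ _) _; move: h1 h2; clear - F0 cF cg dF; lra.
Qed.

(** F (z, 1 - eps q) is - eps Re(q) slope z + o(eps), uniformly on a disc. *)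
Lemma slope_line (A B : plane R) (q : plane R -> plane R) (d : R) : 0 < d ->
  (forall s, nsq s <= 1 -> 1 / 2 <= (q s).1 <= 3 / 2 /\ nsq (q s) <= 9 / 4) ->
  \forall eps \near (0 : R)^'+, forall s, nsq s <= 1 ->
    `|F (A + cmul s B, one_c - eps *: q s) + eps * (q s).1 * slope (A + cmul s B)| <= d * eps.
Proof.
move=> d0 qb.
pose P (eps : R) s := nsq s <= 1 ->
    `|F (A + cmul s B, one_c - eps *: q s) + eps * (q s).1 * slope (A + cmul s B)| <= d * eps.
suff H : \forall eps \near (0 : R)^'+, (@udisc R) `<=` P eps 
  by apply: filterS H => eps He s s1; exact: He.
have /compact_near_coveringP cov := @udisc_compact R.
apply: cov => s0 s01.
have d40 : 0 < d / 4 by rewrite divr_gt0.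
have [r r0 H] := slope_asymp (A + cmul s0 B) d40.
have [r' r'0 H'] := slope_near (A + cmul s0 B) ltr01.
pose M := `|slope (A + cmul s0 B)| + 1.
have M0 : 0 < M by rewrite ltr_wpDl.
pose e1 := Num.min (1 / 9) (Num.min (r / 9) (Num.min 1 (2 * d / (9 * M)))).
have d2 : 0 < 2 * d by rewrite mulr_gt0.
have M9 : 0 < 9 * M by rewrite mulr_gt0.
have e10 : 0 < e1 by rewrite /e1 !lt_min ltr01 !divr_gt0.
have cL : (fun s => nsq (A + cmul s B - (A + cmul s0 B))) @ s0 -->
    nsq (A + cmul s0 B - (A + cmul s0 B)).
  apply: (cvg_comp _ nsq _ (@nsq_continuous R _)).
  apply: cvgB; last exact: cvg_cst.
  by apply: cvgD; [exact: cvg_cst|apply: cvg_cmul; [exact: cvg_id|exact: cvg_cst]].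
have L0 : nsq (A + cmul s0 B - (A + cmul s0 B)) = 0 by rewrite subrr /nsq /= expr0n addr0.
have n1 : \forall s \near s0, nsq (A + cmul s B - (A + cmul s0 B)) < r.
  by apply: (cvgr_lt _ cL); rewrite L0.
have n2 : \forall s \near s0, nsq (A + cmul s B - (A + cmul s0 B)) < r'.
  by apply: (cvgr_lt _ cL); rewrite L0.
exists ([set s | nsq (A + cmul s B - (A + cmul s0 B)) < r /\
    nsq (A + cmul s B - (A + cmul s0 B)) < r'], [set eps | 0 < eps /\ eps < e1]).
  split; first exact: filterI.
  near=> eps; split; near: eps; [exact: nbhs_right_gt|exact: nbhs_right_lt].
move=> [s eps] [/= [sr sr'] [eps0 epse]] s1.
have [q12 qn] := qb s s1; move: q12 => /andP[q1 q1'].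
move: epse; rewrite !lt_min => /and4P[ea eb ec ed].
set z := A + cmul s B in sr sr' *.
pose a := 1 - eps * (q s).1; pose b := - (eps * (q s).2).
have qE : one_c - eps *: q s = (a, b).
  by apply: injective_projections; rewrite /= /GRing.scale /= ?sub0r.
have ee : eps ^+ 2 <= eps by rewrite expr2 ler_piMl ?(ltW eps0)// ltW.
have ee9 : eps ^+ 2 <= eps / 9.
  by rewrite expr2 ler_wpM2l ?(ltW eps0)// ltW// -[9^-1]mul1r.
have en : eps ^+ 2 * nsq (q s) <= eps ^+ 2 * (9 / 4) by rewrite ler_wpM2l ?sqr_ge0.
have abE : a ^+ 2 + b ^+ 2 = 1 - 2 * (eps * (q s).1) + eps ^+ 2 * nsq (q s).
  by rewrite /a /b /nsq; ring.
have eq1 : eps / 2 <= eps * (q s).1.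
  by have := ler_wpM2l (ltW eps0) q1; clear - F0 cF cg dF; lra.
have eq2 : eps * (q s).1 <= 3 / 2 * eps.
  by have := ler_wpM2l (ltW eps0) q1'; clear - F0 cF cg dF; lra.
have ab : a ^+ 2 + b ^+ 2 < 1 by rewrite abE; move: en eq1 ee9 eps0; clear - F0 cF cg dF; lra.
have a0 : 0 < a by rewrite /a; move: eq2 ea; clear - F0 cF cg dF; lra.
have abr : (a - 1) ^+ 2 + b ^+ 2 < r.
  have -> : (a - 1) ^+ 2 + b ^+ 2 = eps ^+ 2 * nsq (q s) by rewrite /a /b /nsq; ring.
  by move: en ee eb r0; clear - F0 cF cg dF; lra.
have h1 := H z a b sr abr a0 ab.
have bb : b ^+ 2 <= eps ^+ 2 * (9 / 4).
  apply: le_trans en; have -> : b ^+ 2 = eps ^+ 2 * (q s).2 ^+ 2 by rewrite /b; ring.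
  by rewrite ler_wpM2l ?sqr_ge0// /nsq lerDr sqr_ge0.
have b1 : b ^+ 2 <= 1 by have := sqr_ge0 a; move: ab; clear - F0 cF cg dF; lra.
have [sl su] := sqrt1_bounds b1; set sq := Num.sqrt _ in h1 sl su.
have Mz : `|slope z| <= M.
  have := H' z sr'; have := ler_normD (slope z - slope (A + cmul s0 B)) (slope (A + cmul s0 B)).
  by rewrite subrK /M; clear - F0 cF cg dF; lra.
rewrite qE.
have -> : F (z, (a, b)) + eps * (q s).1 * slope z =
  (F (z, (a, b)) + (sq - a) * slope z) + (1 - sq) * slope z by rewrite /a; ring.
apply: le_trans (ler_normD _ _) _.
have h2 : `|(1 - sq) * slope z| <= eps * (9 / 4 * eps) * M.
  rewrite normrM ler_pM//; rewrite ger0_norm ?subr_ge0//; move: sl bb; clear - F0 cF cg dF; lra.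
have h3 : eps * (9 / 4 * eps) * M <= eps * (d / 2).
  rewrite -mulrA ler_pM2l//; move: ed; rewrite ltr_pdivlMr ?mulr_gt0//; clear - F0 cF cg dF; lra.
have h4 : d / 4 * (sq - a) <= d / 4 * (3 / 2 * eps).
  by rewrite ler_pM2l// /a; move: su eq2; clear - F0 cF cg dF; lra.
move: h1 h2 h3 h4; have : 0 < d * eps by rewrite mulr_gt0. clear - F0 cF cg dF; lra.
Unshelve. all: by end_near. Qed.

End BoundarySlope.

(** * A tilted mean value inequality for the slope *)

Section SlopeMean.
Context {R : realType}.
Implicit Types (z s A B kap : plane R).

(** The direction 1 + kap s / 2, of real part between 1/2 and 3/2 on the disc. *)
Definition tilt kap s : plane R := one_c + 2^-1 *: cmul kap s.

Lemma tilt_fst kap s : (tilt kap s).1 = 1 + (cmul kap s).1 / 2.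
Proof. by rewrite /tilt /= /GRing.scale /= mulrC. Qed.

Lemma tilt_bounds kap s : nsq kap = 1 -> nsq s <= 1 ->
  1 / 2 <= (tilt kap s).1 <= 3 / 2 /\ nsq (tilt kap s) <= 9 / 4.
Proof.
move=> k1 s1; have ks : nsq (cmul kap s) <= 1 by rewrite nsqM k1 mul1r.
set p := cmul kap s in ks *; rewrite /tilt -/p.
have p1 : `|p.1| <= 1.
  rewrite -(@ler_pXn2r _ 2) ?nnegrE// expr1n real_normK ?num_real//.
  by apply: le_trans ks; rewrite /nsq lerDl sqr_ge0.
move: p1; rewrite ler_norml => /andP[p1 p1'].
have -> : (one_c + 2^-1 *: p).1 = 1 + p.1 / 2 by rewrite /= /GRing.scale /= mulrC.
split; first by apply/andP; split; move: p1 p1'; clear; lra.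
have -> : nsq (one_c + 2^-1 *: p) = 1 + p.1 + nsq p / 4.
  by rewrite /nsq /= /GRing.scale /=; field.
by move: ks p1'; clear; lra.
Qed.

Lemma tilt_continuous kap : continuous (tilt kap).
Proof.
move=> s; apply: cvgD; first exact: cvg_cst.
by apply: cvgZr; apply: cvg_cmul; [exact: cvg_cst|exact: cvg_id].
Qed.

Lemma near_one_in01 (q : plane R) (eps : R) : 0 < eps -> eps <= 1 / 9 ->
  1 / 2 <= q.1 -> nsq q <= 9 / 4 -> 0 < nsq (one_c - eps *: q) < 1.
Proof.
move=> e0 e9 q1 qn.
have E : nsq (one_c - eps *: q) = 1 - 2 * (eps * q.1) + eps ^+ 2 * nsq q.
  by rewrite /nsq /= /GRing.scale /=; ring.
have h1 := ler_wpM2l (ltW e0) q1.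
have h2 : eps ^+ 2 * nsq q <= eps ^+ 2 * (9 / 4) by rewrite ler_wpM2l ?sqr_ge0.
have h3 : eps ^+ 2 <= eps * (1 / 9) by rewrite expr2 ler_wpM2l ?(ltW e0).
apply/andP; split; last by rewrite E; move: h1 h2 h3 e0; clear; lra.
rewrite nsq_gt0; apply/eqP => h.
have h4 : nsq (eps *: q) = 1.
  by rewrite -(subKr one_c (eps *: q)) h subr0 nsq_one_c.
have h5 : nsq (eps *: q) = eps ^+ 2 * nsq q by rewrite /nsq /= /GRing.scale /=; ring.
by move: h2 h3 h4 h5 e9; clear; lra.
Qed.

(** Where the form vanishes, 0 is a local potential. *)
Lemma zero_potential (w : form11 R) (Om : set (plane R)) :
  (forall z, Om z -> dens w Cz z = 0) -> local_potential w Cz Om (fun=> 0).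
Proof.
move=> d0; split; first by move=> x _; exact: cvg_cst.
move=> phi _.
have -> : \int[leb2]_(x in Om) (0 * ddc phi x) = \int[leb2]_(x in Om) 0.
  by apply: eq_Rintegral => x _; rewrite mul0r.
by apply: eq_Rintegral => x; rewrite inE => /d0 ->; rewrite mulr0.
Qed.

Section Envelope.
Context (w : form11 R) (Om : set (plane R)) (f : P1 R * plane R -> R).
Let F (y : plane R * plane R) : R := f (Some y.1, y.2).
Context (oOm : open Om) (dens0 : forall z, Om z -> dens w Cz z = 0)
  (fE : forall p tau, 0 < cabs tau <= 1 -> envelope w 0 (p, tau) = (f (p, tau))%:E)
  (cF : {within [set y : plane R * plane R | 0 < cabs y.2 <= 1], continuous F}).

(** Candidates lie below f, which is their supremum. *)
Lemma candidate_le Psi z (tau : plane R) : candidate w 0 Psi -> 0 < nsq tau -> nsq tau < 1 ->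
  (Psi (Some z, tau) <= (F (z, tau))%:E)%E.
Proof.
move=> cP t0 t1; rewrite -fE; last by rewrite cabs_gt0E t0 cabs_le1E ltW.
by rewrite /envelope cabs_lt1E /= t1; apply: ereal_sup_ubound; exists Psi.
Qed.

Lemma mean_continuous A B kap (eps : R) : nsq kap = 1 -> 0 < eps -> eps <= 1 / 9 ->
  continuous (fun t => F (A + cmul (expi t) B, one_c - eps *: tilt kap (expi t))).
Proof.
move=> k1 e0 e9.
have t01 s : nsq s <= 1 -> 0 < nsq (one_c - eps *: tilt kap s) < 1.
  move=> s1; have [/andP[h1 _] h2] := tilt_bounds k1 s1; exact: near_one_in01.
have e1 t : nsq (expi t) <= (1 : R) by rewrite nsq_expi.
move=> t.
have i1 : (fun t => A + cmul (expi t) B) @ t --> A + cmul (expi t) B.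
  apply: cvgD; first exact: cvg_cst.
  by apply: cvg_cmul; [exact: expi_continuous|exact: cvg_cst].
have i2 : (fun t => one_c - eps *: tilt kap (expi t)) @ t --> one_c - eps *: tilt kap (expi t).
  apply: cvgB; first exact: cvg_cst.
  apply: cvgZr; apply: (cvg_comp expi (tilt kap)); first exact: expi_continuous.
  exact: tilt_continuous.
have /andP[h0 h1] := t01 _ (e1 t).
have cc := punctured_continuous cF (y := (A + cmul (expi t) B, one_c - eps *: tilt kap (expi t))) h0 h1.
exact: (cvg_comp (fun t => (A + cmul (expi t) B, one_c - eps *: tilt kap (expi t))) F (cvg_pair i1 i2) cc).
Qed.

(** Each candidate has the mean value inequality on the disc, and lies below f. *)
Lemma envelope_mean A B kap (eps : R) : nsq kap = 1 -> 0 < eps -> eps <= 1 / 9 ->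
  (forall s, nsq s <= 1 -> Om (A + cmul s B)) ->
  2 * pi * F (A, one_c - eps *: one_c) <=
    cint (fun t => F (A + cmul (expi t) B, one_c - eps *: tilt kap (expi t))).
Proof.
move=> k1 e0 e9 inOm; have pi0 : 0 < 2 * pi :> R := pi2_gt0.
have t01 s : nsq s <= 1 -> 0 < nsq (one_c - eps *: tilt kap s) < 1.
  move=> s1; have [/andP[h1 _] h2] := tilt_bounds k1 s1; exact: near_one_in01.
have tilt0 : tilt kap 0 = one_c by rewrite /tilt cmul0 scaler0 addr0.
have n00 : nsq (0 : plane R) <= 1 by rewrite /nsq /= expr0n addr0.
have c01 : 0 < nsq (one_c - eps *: one_c : plane R) < 1 by have := t01 _ n00; rewrite tilt0.
have e1 t : nsq (expi t) <= (1 : R) by rewrite nsq_expi.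
have cont := @mean_continuous A B kap eps k1 e0 e9.
have /andP[c0 c1] := c01.
suff H : (envelope w (0 : plane R)%R (Some A, (one_c - eps *: one_c)%R) <=
    (cint (fun t => F (A + cmul (expi t) B, one_c - eps *: tilt kap (expi t))) / (2 * pi))%:E)%E.
  by move: H; rewrite fE ?lee_fin ?ler_pdivlMr// 1?mulrC// cabs_gt0E c0 cabs_le1E ltW.
rewrite /envelope cabs_lt1E /= c1; apply: ge_ereal_sup => _ [Psi cP <-].
have [[_ pshP] _ _] := cP.
have [_ _ mv] := pshP Cz Om (fun=> 0) oOm (zero_potential dens0).
have := mv (A, one_c - eps *: one_c) (B, - (eps / 2) *: kap).
have lineE s : one_c - eps *: one_c + cmul s (- (eps / 2) *: kap) = one_c - eps *: tilt kap s.
  rewrite /tilt !cmulE; apply: injective_projections; rewrite /= /GRing.scale /=; ring.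
move=> /=; set U := (forall s, _ -> _ /\ _).
have hU : U.
  move=> s; rewrite cabs_le1E => s1; split; first exact: inOm.
  by rewrite lineE cabs_lt1E; have /andP[] := t01 s s1.
move=> /(_ hU) {hU U}; rewrite adde0 => mv1.
have mv2 : ((2 * pi)%:E * Psi (Some A, (one_c - eps *: one_c)%R) <=
    (cint (fun t => F (A + cmul (expi t) B, one_c - eps *: tilt kap (expi t))))%:E)%E.
  apply: le_trans mv1 _; rewrite -(cint_EFin cont); apply: le_integral_any => t _.
  rewrite adde0 lineE; have /andP[h0 h1] := t01 _ (e1 t); exact: candidate_le.
move: mv2; case: (Psi _) => [v| |] //=.
- by rewrite -EFinM !lee_fin ler_pdivlMr// mulrC.
- by rewrite gt0_muley ?lte_fin.
- by move=> _; exact: leNye.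
Qed.

Context (g : plane R * plane R -> R)
  (cg : {within [set y : plane R * plane R | 0 < cabs y.2 <= 1], continuous g})
  (dF : forall y : plane R * plane R, 0 < cabs y.2 < 1 -> is_derive y (0, (1, 0)) F (g y)).

Lemma F_boundary z tau : nsq tau = 1 -> F (z, tau) = 0.
Proof.
move=> t1; have := @fE (Some z) tau; rewrite cabs_gt0E cabs_le1E t1 ltr01 lexx => /(_ isT).
by rewrite /envelope cabs_lt1E /= t1 ltxx => -[].
Qed.

Lemma slope_mean A B kap : nsq kap = 1 -> (forall s, nsq s <= 1 -> Om (A + cmul s B)) ->
  cint (fun t => (tilt kap (expi t)).1 * slope g (A + cmul (expi t) B)) <= 2 * pi * slope g A.
Proof.
move=> k1 inOm; have pi0 : 0 < 2 * pi :> R := pi2_gt0.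
have cs : continuous (fun t => (tilt kap (expi t)).1 * slope g (A + cmul (expi t) B)).
  move=> t; apply: cvgM.
    have h : (fun t => tilt kap (expi t)) @ t --> tilt kap (expi t).
      by apply: (cvg_comp expi (tilt kap)); [exact: expi_continuous|exact: tilt_continuous].
    exact: cvg_fst_comp.
  apply: (cvg_comp (fun t => A + cmul (expi t) B) (slope g)); last exact: slope_continuous.
  apply: cvgD; first exact: cvg_cst.
  by apply: cvg_cmul; [exact: expi_continuous|exact: cvg_cst].
apply/ler_addgt0Pr => d0 d00.
pose d := d0 / (2 * pi) / 2.
have dp : 0 < d by rewrite !divr_gt0.
have near1 := slope_line F_boundary cF cg dF A B dp (fun s => tilt_bounds k1 (s := s)).
have [eps [e0 e9 He]] : exists eps : R, [/\ 0 < eps, eps <= 1 / 9 & forall s, nsq s <= 1 ->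
    `|F (A + cmul s B, one_c - eps *: tilt kap s) + eps * (tilt kap s).1 * slope g (A + cmul s B)| <= d * eps].
  near (0 : R)^'+ => eps; exists eps; split; near: eps => //.
  - exact: nbhs_right_gt.
  - by apply: nbhs_right_le; rewrite divr_gt0.
have n00 : nsq (0 : plane R) <= 1 by rewrite /nsq /= expr0n addr0.
have e1 t : nsq (expi t) <= (1 : R) by rewrite nsq_expi.
have tilt0 : tilt kap 0 = one_c by rewrite /tilt cmul0 scaler0 addr0.
have := He 0 n00; rewrite tilt0 cmulC cmul0 addr0 mulr1 ler_norml => /andP[low _].
have mean := envelope_mean k1 e0 e9 inOm.
have up : cint (fun t => F (A + cmul (expi t) B, one_c - eps *: tilt kap (expi t))) <=
    cint (fun t => - eps * ((tilt kap (expi t)).1 * slope g (A + cmul (expi t) B)) + d * eps).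
  apply: le_cint; [exact: mean_continuous|..].
    move=> t; apply: cvgD; last exact: cvg_cst.
    by apply: cvgM; [exact: cvg_cst|exact: cs].
  move=> t _; have := He _ (e1 t); rewrite ler_norml => /andP[_ h].
  by rewrite mulNr mulrA [leRHS]addrC lerBrDr.
have cst : cint (fun t => - eps * ((tilt kap (expi t)).1 * slope g (A + cmul (expi t) B)) + d * eps) =
   - eps * cint (fun t => (tilt kap (expi t)).1 * slope g (A + cmul (expi t) B)) + 2 * pi * (d * eps).
  rewrite cintD; [by rewrite (cintZ (- eps) cs) cint_cst|..]; first by move=> t; apply: cvgM; [exact: cvg_cst|exact: cs].
  by move=> t; exact: cvg_cst.
have h1 : 2 * pi * (- (d * eps) - eps * slope g A) <= 2 * pi * F (A, one_c - eps *: one_c).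
  by rewrite ler_pM2l// lerBlDr.
have h2 := le_trans h1 (le_trans mean up); rewrite cst in h2.
have dE : 2 * (2 * pi * (d * eps)) = d0 * eps.
  have alg (p : R) : p != 0 -> 2 * (p * (d0 / p / 2 * eps)) = d0 * eps by move=> ?; field.
  by apply: alg; rewrite gt_eqF.
rewrite -(ler_pM2l e0); move: h2 dE; move: (cint _) => I; lra.
Unshelve. all: by end_near. Qed.

End Envelope.
End SlopeMean.

(** * The slope is constant on the domain *)

Section TiltedMean.
Context {R : realType}.
Implicit Types (x y z p s A B kap : plane R) (Om : set (plane R)) (G : plane R -> R).

(** The mean value inequality weighted by Re (tilt kap), on all discs in Om. *)
Definition tilted_supermean Om G : Prop := forall A B kap, nsq kap = 1 ->
  (forall s, nsq s <= 1 -> Om (A + cmul s B)) ->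
  cint (fun t => (tilt kap (expi t)).1 * G (A + cmul (expi t) B)) <= 2 * pi * G A.

Lemma trig_continuous (a b c d e k : R) :
  continuous (fun t : R => a + b * cos t + c * sin t + d * (cos t * cos t) +
    e * (cos t * sin t) + k * (sin t * sin t)).
Proof.
have cZ (x : R) (h : R -> R) : continuous h -> continuous (fun t => x * h t).
  by move=> ch t; apply: cvgM; [exact: cvg_cst|exact: ch].
have cD (h h' : R -> R) : continuous h -> continuous h' -> continuous (fun t => h t + h' t).
  by move=> ch ch' t; apply: cvgD; [exact: ch|exact: ch'].
have cM (h h' : R -> R) : continuous h -> continuous h' -> continuous (fun t => h t * h' t).
  by move=> ch ch' t; apply: cvgM; [exact: ch|exact: ch'].
have cc : continuous (@cos R) := @continuous_cos R.
have cs : continuous (@sin R) := @continuous_sin R.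
have ca : continuous (fun _ : R => a) by move=> t; exact: cvg_cst.
exact: (cD _ _ (cD _ _ (cD _ _ (cD _ _ (cD _ _ ca (cZ b _ cc)) (cZ c _ cs))
  (cZ d _ (cM _ _ cc cc))) (cZ e _ (cM _ _ cc cs))) (cZ k _ (cM _ _ cs cs))).
Qed.

Lemma nsq_polar (d : plane R) (rho t : R) : nsq (d + cmul (expi t) (rho, 0)) =
  nsq d + 2 * rho * (d.1 * cos t + d.2 * sin t) + rho ^+ 2.
Proof.
rewrite [in RHS](_ : rho ^+ 2 = rho ^+ 2 * (cos t ^+ 2 + sin t ^+ 2)).
  by rewrite cmulE /nsq /expi /=; ring.
by rewrite cos2Dsin2 mulr1.
Qed.

(** A tilted mean sees the first order term of a paraboloid touching G from
   below, so that it can only touch at its vertex. *)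
Lemma paraboloid_touch Om G x0 y (K : R) : open Om -> Om x0 -> continuous G ->
  tilted_supermean Om G -> 0 < K ->
  (\forall x \near x0, G x0 + K * nsq (x0 - y) <= G x + K * nsq (x - y)) -> x0 = y.
Proof.
move=> oOm Ox0 cG mean K0 touch; apply/eqP; rewrite -subr_eq0; apply/negPn/negP => d0.
set d := x0 - y in d0 touch.
pose D := cabs d; have DD : D ^+ 2 = nsq d := cabs_sqr d.
have D0 : 0 < D by rewrite /D cabs_gt0E nsq_gt0.
have nO : \forall x \near x0, Om x by exact: open_nbhs_nbhs.
have [r r0 Hr] := near_disc (filterI nO touch).
pose rho := Num.min (Num.min 1 (r / 2)) (D / 4).
have rho0 : 0 < rho by rewrite !lt_min ltr01 !divr_gt0.
have rhoD : rho <= D / 4 by rewrite ge_min lexx orbT.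
have rho1 : rho <= 1 by rewrite !ge_min lexx.
have rhor : rho <= r / 2 by rewrite !ge_min lexx orbT.
have rho2 : rho ^+ 2 < r.
  by apply: (@le_lt_trans _ _ rho); [rewrite expr2 ler_piMl// ltW|move: rhor r0; clear; lra].
pose kap : plane R := (- d.1 / D, d.2 / D).
have k1 : nsq kap = 1.
  have -> : nsq kap = nsq d / D ^+ 2 by rewrite /nsq /=; field; rewrite gt_eqF.
  by rewrite -DD divff// expf_neq0// gt_eqF.
have ins s : nsq s <= 1 -> nsq (x0 + cmul s (rho, 0) - x0) < r.
  move=> s1; rewrite addrAC subrr add0r nsqM; apply: le_lt_trans rho2.
  have -> : nsq ((rho, 0) : plane R) = rho ^+ 2 by rewrite /nsq /= expr0n addr0.
  by rewrite ler_piMl ?sqr_ge0.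
have inOm s : nsq s <= 1 -> Om (x0 + cmul s (rho, 0)) by move=> /ins/Hr[].
have := mean x0 (rho, 0) kap k1 inOm.
pose G0 := G x0.
have low : cint (fun t => (G0 - K * rho ^+ 2) +
     (kap.1 / 2 * (G0 - K * rho ^+ 2) - 2 * K * rho * d.1) * cos t +
     (- kap.2 / 2 * (G0 - K * rho ^+ 2) - 2 * K * rho * d.2) * sin t +
     (- K * rho * d.1 * kap.1) * (cos t * cos t) +
     (K * rho * (d.1 * kap.2 - d.2 * kap.1)) * (cos t * sin t) +
     (K * rho * d.2 * kap.2) * (sin t * sin t)) <=
   cint (fun t => (tilt kap (expi t)).1 * G (x0 + cmul (expi t) (rho, 0))).
  apply: le_cint.
  - exact: trig_continuous.
  - move=> t; apply: cvgM.
      have h : (fun t => tilt kap (expi t)) @ t --> tilt kap (expi t).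
        by apply: (cvg_comp expi (tilt kap)); [exact: expi_continuous|exact: tilt_continuous].
      exact: cvg_fst_comp.
    apply: (cvg_comp (fun t => x0 + cmul (expi t) (rho, 0)) G); last exact: cG.
    apply: cvgD; first exact: cvg_cst.
    by apply: cvg_cmul; [exact: expi_continuous|exact: cvg_cst].
  - move=> t _.
    have e1 : nsq (expi t) <= (1 : R) by rewrite nsq_expi.
    have [/andP[t12 _] _] := tilt_bounds k1 e1.
    have [_ h] := Hr _ (ins _ e1).
    set x := x0 + cmul (expi t) (rho, 0) in h *.
    have E : nsq (x - y) = nsq d + 2 * rho * (d.1 * cos t + d.2 * sin t) + rho ^+ 2.
      have -> : x - y = d + cmul (expi t) (rho, 0) by rewrite /x /d addrAC.
      exact: nsq_polar.
    have low : G0 - K * (2 * rho * (d.1 * cos t + d.2 * sin t) + rho ^+ 2) <= G x.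
      by move: h; rewrite E -/G0; clear; lra.
    apply: (@le_trans _ _ ((tilt kap (expi t)).1 * (G0 - K * (2 * rho * (d.1 * cos t + d.2 * sin t) + rho ^+ 2)))).
      rewrite tilt_fst cmulE /expi /= le_eqVlt; apply/orP; left; apply/eqP; field.
      by rewrite gt_eqF.
    by apply: ler_wpM2l; [move: t12; clear; lra|exact: low].
rewrite cint_trig in low; move=> /(le_trans low).
have -> : - K * rho * d.1 * kap.1 + K * rho * d.2 * kap.2 = K * rho * D.
  have -> : - K * rho * d.1 * kap.1 + K * rho * d.2 * kap.2 = K * rho * (nsq d / D).
    by rewrite /nsq /=; field; rewrite gt_eqF.
  by rewrite -DD expr2 mulfK// gt_eqF.
have -> : 2 * pi * (G0 - K * rho ^+ 2) + pi * (K * rho * D) =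
   2 * pi * G0 + pi * (K * rho * (D - 2 * rho)) by ring.
rewrite -/G0 gerDl leNgt; move/negP; apply.
by rewrite !mulr_gt0 ?pi_gt0// subr_gt0; move: rhoD rho0; clear; lra.
Qed.

(** For K large the minimum over a disc of G + K |. - y|^2 is interior, hence is
    attained at y. *)
Lemma supermean_quadratic Om G p (r : R) : open Om -> continuous G -> tilted_supermean Om G ->
  0 < r -> (forall x, nsq (x - p) <= r -> Om x) ->
  exists2 K : R, 0 < K & forall x y, nsq (x - p) <= r / 16 -> nsq (y - p) <= r / 16 ->
    `|G x - G y| <= K * nsq (x - y).
Proof.
move=> oOm cG mean r0 sub.
have cK : compact [set x : plane R | nsq (x - p) <= r] by exact: disc_compact.
have ne : [set x : plane R | nsq (x - p) <= r] !=set0.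
  by exists p; rewrite /= subrr /nsq /= expr0n addr0 ltW.
have cN : {within [set x : plane R | nsq (x - p) <= r], continuous (fun x => `|G x|)}.
  by apply: continuous_subspaceT => x; apply: cvg_norm; exact: cG.
have [xm _ xmax] := compact_EVT_max ne cK cN.
pose M := `|G xm| + 1.
have bM x : nsq (x - p) <= r -> `|G x| < M.
  by move=> xr; apply: le_lt_trans (xmax x _) _; rewrite ?inE// ltrDl.
have M0 : 0 < M by rewrite ltr_wpDl.
pose K := 8 * M / r.
have K0 : 0 < K by rewrite divr_gt0 ?mulr_gt0.
have half x y : nsq (x - p) <= r / 16 -> nsq (y - p) <= r / 16 -> G y - G x <= K * nsq (x - y).
  move=> xr yr.
  have yr1 : nsq (y - p) <= r by move: yr r0; clear; lra.
  have cP : {within [set x : plane R | nsq (x - p) <= r], continuous (fun x => G x + K * nsq (x - y))}.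
    apply: continuous_subspaceT => z; apply: cvgD; first exact: cG.
    by apply: cvgM; [exact: cvg_cst|exact: nsq_sub_cvg].
  have [x0 x0r x0min] := compact_EVT_min ne cK cP.
  rewrite inE /= in x0r.
  have yy : nsq (y - y) = 0 by rewrite subrr /nsq /= expr0n addr0.
  have x0y : G x0 + K * nsq (x0 - y) <= G y.
    by have := x0min y; rewrite inE /= yy mulr0 addr0; apply.
  have x0in : nsq (x0 - p) < r.
    rewrite lt_neqAle x0r andbT; apply/eqP => x0E.
    have h1 : nsq (x0 - p) <= 2 * nsq (x0 - y) + 2 * nsq (y - p).
      by have := nsqD2 (x0 - y) (y - p); rewrite addrA subrK.
    have h2 : K * (r / 4) <= K * nsq (x0 - y).
      by rewrite ler_pM2l//; move: h1 yr r0; rewrite x0E; clear; lra.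
    have h3 : K * (r / 4) = 2 * M by rewrite /K; field; rewrite gt_eqF.
    have := bM x0 x0r; have := bM y yr1; rewrite !ltr_norml => /andP[_ h4] /andP[h5 _].
    by move: x0y h2 h3 h4 h5; clear; lra.
  have nx : \forall x \near x0, G x0 + K * nsq (x0 - y) <= G x + K * nsq (x - y).
    have n1 : \forall x \near x0, nsq (x - p) < r.
      by exact: (cvgr_lt _ (@nsq_sub_cvg R p x0)).
    by apply: filterS n1 => z zr; apply: x0min; rewrite inE /= ltW.
  have E := paraboloid_touch oOm (sub _ x0r) cG mean K0 nx.
  have := x0min x; rewrite inE /= => /(_ _); rewrite E yy mulr0 addr0.
  by rewrite lerBlDl; apply; move: xr r0; clear; lra.
exists K => // x y xr yr; rewrite ler_norml; apply/andP; split; last first.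
  have := half y x yr xr; rewrite -(opprB x y) (_ : nsq (- (x - y)) = nsq (x - y))//.
  by rewrite /nsq /= !sqrrN.
by rewrite lerNl opprB; exact: half.
Qed.

(** Halving the segment halves the constant of a quadratic estimate. *)
Lemma supermean_locally_constant Om G p : open Om -> continuous G -> tilted_supermean Om G ->
  Om p -> \forall x \near p, G x = G p.
Proof.
move=> oOm cG mean Op.
have nO : \forall x \near p, Om x by exact: open_nbhs_nbhs.
have [r r0 Hr] := near_disc nO.
have r20 : 0 < r / 2 by rewrite divr_gt0.
have sub x : nsq (x - p) <= r / 2 -> Om x by move=> h; apply: Hr; move: h r0; clear; lra.
have [K K0 H] := supermean_quadratic oOm cG mean r20 sub.
have halving n x y : nsq (x - p) <= r / 2 / 16 -> nsq (y - p) <= r / 2 / 16 ->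
    `|G x - G y| <= K / 2 ^+ n * nsq (x - y).
  elim: n x y => [|n IH] x y xr yr; first by rewrite expr0 divr1; exact: H.
  pose z : plane R := ((x.1 + y.1) / 2, (x.2 + y.2) / 2).
  have xz : nsq (x - z) = nsq (x - y) / 4 by rewrite /nsq /=; field.
  have zy : nsq (z - y) = nsq (x - y) / 4 by rewrite /nsq /=; field.
  have zr : nsq (z - p) <= r / 2 / 16.
    have : nsq (z - p) + nsq (x - y) / 4 = (nsq (x - p) + nsq (y - p)) / 2.
      by rewrite /nsq /=; field.
    by have := nsq_ge0 (x - y); move: xr yr; clear; lra.
  have h1 := IH x z xr zr; have h2 := IH z y zr yr; rewrite xz in h1; rewrite zy in h2.
  have -> : G x - G y = (G x - G z) + (G z - G y) by ring.
  apply: le_trans (ler_normD _ _) _; apply: le_trans (lerD h1 h2) _.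
  rewrite exprS le_eqVlt; apply/orP; left; apply/eqP; field.
  by rewrite expf_neq0.
have n1 : \forall x \near p, nsq (x - p) <= r / 2 / 16 by apply: nsq_near; rewrite !divr_gt0.
apply: filterS n1 => x xr; apply/eqP; rewrite -subr_eq0 -normr_le0 leNgt; apply/negP => pos.
have pr : nsq (p - p) <= r / 2 / 16 by rewrite subrr /nsq /= expr0n addr0 !divr_ge0// ltW.
pose v := K * nsq (x - p) / `|G x - G p|.
have v0 : 0 <= v by rewrite divr_ge0// mulr_ge0 ?nsq_ge0// ltW.
have h := halving (Num.bound v) x p xr pr.
have b1 := archi_boundP v0.
have b2 : (Num.bound v)%:R < 2 ^+ (Num.bound v) :> R by rewrite -natrX ltr_nat ltn_expl.
have : v < 2 ^+ (Num.bound v) := lt_trans b1 b2.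
rewrite ltr_pdivrMr// -ltr_pdivrMl ?exprn_gt0//.
by rewrite mulrC mulrAC ltNge h.
Qed.

Lemma supermean_constant Om G p z : open Om -> connected Om -> continuous G ->
  tilted_supermean Om G -> Om p -> closure Om z -> G z = G p.
Proof.
move=> oOm cOm cG mean Op zO.
have cl : closed [set x | G x = G p].
  have -> : [set x | G x = G p] = G @^-1` [set v | v = G p] by [].
  by apply: closed_comp; [move=> x _; exact: cG|exact: closed_eq].
have E : Om `&` [set x | G x = G p] = Om.
  apply: cOm.
  - by exists p.
  - exists (Om `&` [set x | G x = G p]); last by rewrite setIA setIid.
    rewrite openE => x [Ox xp]; rewrite /interior.
    have h := supermean_locally_constant oOm cG mean Ox.
    have nO : \forall y \near x, Om y by exact: open_nbhs_nbhs.
    by apply: filterS2 nO h => y yO yx; split => //=; rewrite yx.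
  - by exists [set x | G x = G p].
have sub : Om `<=` [set x | G x = G p] by move=> x; rewrite -{1}E => -[].
by have := closureS sub zO; move/closure_id : cl => <-.
Qed.

End TiltedMean.

(** * The Green function bound over the pole *)

Section LogMajorant.
Context {R : realType}.
Implicit Types (x y tau A B s : plane R).

(** An upper semicontinuous function attains its maximum on a compact set. *)
Lemma usc_max (K : set (plane R)) (Phi : plane R -> \bar R) x0 : compact K -> K x0 ->
  (forall x, K x -> (Phi x < +oo)%E) ->
  (forall x (a : R), K x -> (Phi x < a%:E)%E -> \forall y \near x, K y -> (Phi y < a%:E)%E) ->
  exists2 x, K x & forall y, K y -> (Phi y <= Phi x)%E.
Proof.
move=> cK Kx0 fin usc; apply: contrapT => no.
have above x : K x -> exists2 y, K y & (Phi x < Phi y)%E.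
  move=> Kx; apply: contrapT => H; apply: no; exists x => // y Ky.
  by rewrite leNgt; apply/negP => h; apply: H; exists y.
pose Fs : set_system (plane R) :=
  [set A | exists2 y0, K y0 & forall y, K y -> (Phi y0 <= Phi y)%E -> A y].
have FF : Filter Fs.
  split; first by exists x0.
  - move=> A B [ya Kya HA] [yb Kyb HB].
    have [h|h] := leP (Phi ya) (Phi yb).
      by exists yb => // y Ky hy; split; [apply: HA => //; exact: le_trans h hy|exact: HB].
    by exists ya => // y Ky hy; split; [exact: HA|apply: HB => //; exact: le_trans (ltW h) hy].
  - by move=> A B AB [ya Kya HA]; exists ya => // y Ky hy; apply: AB; exact: HA.
pose P y x := K x -> (Phi x < Phi y)%E.
have H : \forall y \near Fs, K `<=` P y.
  have /compact_near_coveringP cov := cK.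
  apply: cov => x Kx; have [y0 Ky0 lt] := above x Kx.
  have := lt; case E : (Phi y0) (fin y0 Ky0) => [a| |] // _ lta; last by rewrite ltNge leNye in lta.
  exists ([set x' | K x' -> (Phi x' < a%:E)%E], [set y | K y /\ (Phi y0 <= Phi y)%E]).
    split; first exact: usc.
    by exists y0 => // y Ky hy.
  move=> [x' y] [/= h1 [Ky h2]] Kx'; apply: lt_le_trans (h1 Kx') _.
  by rewrite -E.
have [y0 Ky0 Hy0] := H.
by have := Hy0 y0 Ky0 (lexx _) y0 Ky0 Ky0; rewrite ltxx.
Qed.

Lemma annulus_compact (r0 : R) : compact [set y : plane R | r0 <= nsq y <= 1].
Proof.
apply: (@subclosed_compact _ _ (@udisc R)); last 2 first.
- exact: udisc_compact.
- by move=> y /= /andP[].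
have -> : [set y : plane R | r0 <= nsq y <= 1] = nsq @^-1` [set v | r0 <= v] `&` @udisc R.
  by apply/seteqP; split => y /=; [move=> /andP[]|move=> [-> ?]].
apply: closedI; last exact: udisc_closed.
by apply: closed_comp; [move=> x _; exact: nsq_continuous|exact: closed_ge].
Qed.

Section Majorant.
(** u is subharmonic in the unit disc, with boundary values at most 0 and a
    logarithmic pole at 0. *)
Context (u : plane R -> \bar R)
  (u_fin : forall tau, nsq tau < 1 -> (u tau < +oo)%E)
  (u_usc : forall tau (a : R), nsq tau < 1 -> (u tau < a%:E)%E -> \forall y \near tau, (u y < a%:E)%E)
  (u_mean : forall A B, (forall s, nsq s <= 1 -> nsq (A + cmul s B) < 1) ->
     ((2 * pi)%R%:E * u A <=
      \int[lebesgue_measure]_(t in `[0%R, (2 * pi)%R]) u (A + cmul (expi t) B)%R)%E)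
  (u_boundary : forall tau (a : R), nsq tau = 1 -> 0 < a ->
     \forall y \near tau, nsq y < 1 -> (u y < a%:E)%E)
  (u_pole : forall c' : R, c' < 1 -> exists M : R, \forall y \near (0 : plane R),
     (u y <= c'%:E * lne (nsq y)%:E + M%:E)%E).

Let psi (eps : R) tau : R := - ((1 - eps) * ln (nsq tau)) + eps * nsq tau.

(** At an interior maximum of u - (1 - eps) ln |tau|^2 + eps |tau|^2 the mean value
   inequality fails, because ln |tau|^2 is harmonic and |tau|^2 is not. *)
Lemma no_interior_max (eps m : R) tau : 0 < eps -> eps < 1 -> 0 < nsq tau -> nsq tau < 1 ->
  u tau = (m - psi eps tau)%:E ->
  (\forall y \near tau, (u y <= (m - psi eps y)%:E)%E) -> False.
Proof.
move=> e0 e1 t0 t1 ut near.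
have nlt : \forall y \near tau, nsq y < 1 by exact: (cvgr_lt _ (@nsq_continuous R tau)).
have [r r0 Hr] := near_disc (filterI nlt near).
pose rho := Num.min (Num.min (1 / 8) (r / 2)) (eps * nsq tau / 64).
have rho0 : 0 < rho by rewrite !lt_min !divr_gt0// mulr_gt0.
have rho8 : rho <= 8^-1 by rewrite !ge_min mul1r lexx.
have rho1 : rho <= 1 by move: rho8; clear - u_fin u_usc u_mean u_boundary u_pole; lra.
have rhor : rho <= r / 2 by rewrite !ge_min lexx orbT.
have rhoe : rho <= eps * nsq tau / 64 by rewrite !ge_min lexx !orbT.
have rho2 : rho ^+ 2 < r.
  apply: (@le_lt_trans _ _ rho); last by move: rhor r0; clear - u_fin u_usc u_mean u_boundary u_pole; lra.
  by rewrite expr2 ler_piMl ?(ltW rho0).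
have ins s : nsq s <= 1 -> nsq (tau + cmul s (cmul (rho, 0) tau) - tau) < r.
  move=> s1; rewrite addrAC subrr add0r !nsqM; apply: le_lt_trans rho2.
  have -> : nsq ((rho, 0) : plane R) = rho ^+ 2 by rewrite /nsq /= expr0n addr0.
  rewrite mulrCA ler_piMr ?sqr_ge0//.
  by rewrite -[leRHS]mulr1 ler_pM ?nsq_ge0// ltW.
have disc1 s : nsq s <= 1 -> nsq (tau + cmul s (cmul (rho, 0) tau)) < 1 by move=> /ins/Hr[].
have mean := u_mean disc1.
pose T (t : R) : R := (m + (1 - eps) * (ln (nsq tau) + 63 * rho ^+ 3) - eps * nsq tau * (1 + rho ^+ 2)) +
  ((1 - eps) * 2 * rho - eps * nsq tau * (2 * rho)) * cos t + 0 * sin t +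
  (- (1 - eps) * rho ^+ 2) * (cos t * cos t) + 0 * (cos t * sin t) +
  ((1 - eps) * rho ^+ 2) * (sin t * sin t).
have cT : continuous T by exact: trig_continuous.
have bound t : (u (tau + cmul (expi t) (cmul (rho, 0) tau))%R <= (T t)%:E)%E.
  have e11 : nsq (expi t) <= (1 : R) by rewrite nsq_expi.
  have [_ h] := Hr _ (ins _ e11); apply: le_trans h _; rewrite lee_fin.
  set z : plane R := (rho * cos t, rho * sin t).
  have zE : tau + cmul (expi t) (cmul (rho, 0) tau) = cmul tau (one_c + z).
    rewrite !cmulE /z /expi /one_c; apply: injective_projections => /=; ring.
  have nz : nsq z = rho ^+ 2.
    have -> : nsq z = rho ^+ 2 * (cos t ^+ 2 + sin t ^+ 2) by rewrite /nsq /=; ring.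
    by rewrite cos2Dsin2 mulr1.
  have nz' : nsq z <= rho ^+ 2 by rewrite nz.
  have := ln_taylor rho0 rho8 nz'; rewrite nz ler_norml => /andP[_ up].
  have nc : nsq (one_c + z) = 1 + 2 * rho * cos t + rho ^+ 2.
    by rewrite -nz /nsq /=; ring.
  have ncp : 0 < nsq (one_c + z).
    rewrite nc; have := cos_geN1 t => c1.
    have h1 := ler_wpM2l (ltW rho0) c1; have := sqr_ge0 rho.
    by move: h1 rho8; clear - u_fin u_usc u_mean u_boundary u_pole; lra.
  rewrite zE /psi nsqM (lnM (x := nsq tau) (y := nsq (one_c + z))) ?posrE//.
  have up' : ln (nsq (one_c + z)) <=
      2 * rho * cos t - rho ^+ 2 * (cos t * cos t - sin t * sin t) + 63 * rho ^+ 3.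
    have -> : 2 * rho * cos t - rho ^+ 2 * (cos t * cos t - sin t * sin t) + 63 * rho ^+ 3 =
      2 * z.1 - (z.1 ^+ 2 - z.2 ^+ 2) + 63 * rho * rho ^+ 2 by rewrite /z /=; ring.
    by rewrite -lerBlDl.
  have e10 : 0 <= 1 - eps by rewrite subr_ge0 ltW.
  have := ler_wpM2l e10 up'; rewrite /T nc; clear; move: (ln _) (ln _) => *; lra.
have I1 : (\int[lebesgue_measure]_(t in `[0%R, (2 * pi)%R]) u (tau + cmul (expi t) (cmul (rho, 0) tau))%R <= (cint T)%:E)%E.
  by rewrite -(cint_EFin cT); apply: le_integral_any => t _; exact: bound.
have := le_trans mean I1; rewrite ut -EFinM lee_fin /T cint_trig.
have pi0 := @pi_gt0 R.
have -> : pi * (- (1 - eps) * rho ^+ 2 + (1 - eps) * rho ^+ 2) = 0 :> R by ring.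
rewrite addr0 ler_pM2l ?mulr_gt0// /psi => h.
have h1 : eps * nsq tau * rho ^+ 2 <= (1 - eps) * 63 * rho ^+ 3 by move: h; clear - u_fin u_usc u_mean u_boundary u_pole; lra.
have h2 : (1 - eps) * 63 * rho ^+ 3 <= 63 * rho * rho ^+ 2.
  have -> : (1 - eps) * 63 * rho ^+ 3 = (1 - eps) * (63 * rho * rho ^+ 2) by ring.
  rewrite ler_piMl ?mulr_ge0 ?sqr_ge0 ?(ltW rho0)//; move: e0; clear - u_fin u_usc u_mean u_boundary u_pole; lra.
have := le_trans h1 h2; rewrite ler_pM2r ?exprn_gt0// => h3.
by move: rhoe h3 rho0; clear - u_fin u_usc u_mean u_boundary u_pole; lra.
Qed.

Lemma log_majorant_eps (eps : R) tau0 : 0 < eps -> eps < 1 -> 0 < nsq tau0 -> nsq tau0 < 1 ->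
  (u tau0 <= ((1 - eps) * ln (nsq tau0) + eps)%:E)%E.
Proof.
move=> e0 e1 t00 t01; rewrite leNgt; apply/negP => big.
have cpsi y : 0 < nsq y -> {for y, continuous (psi eps)}.
  move=> y0; apply: cvgD.
    apply: cvgN; apply: cvgM; first exact: cvg_cst.
    apply: (cvg_comp nsq (@ln R) (@nsq_continuous R y)); exact: continuous_ln.
  by apply: cvgM; [exact: cvg_cst|exact: nsq_continuous].
pose Phi y : \bar R := if nsq y < 1 then (u y + (psi eps y)%:E)%E else eps%:E.
have Phi0 : (eps%:E < Phi tau0)%E.
  rewrite /Phi t01; apply: (@lt_le_trans _ _ (((1 - eps) * ln (nsq tau0) + eps + psi eps tau0)%:E)).
    rewrite lte_fin /psi.
    have h : 0 < eps * nsq tau0 by rewrite mulr_gt0.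
    by move: h; clear - u_fin u_usc u_mean u_boundary u_pole; lra.
  by rewrite EFinD leeD2r// ltW.
(* near the origin the pole of order 1 - eps / 2 dominates *)
have [r0 r00 [r0t r0P]] : exists2 r0 : R, 0 < r0 & r0 < nsq tau0 /\
    forall y, nsq y = r0 -> (Phi y <= eps%:E)%E.
  have c'1 : 1 - eps / 2 < 1 by move: e0; clear - u_fin u_usc u_mean u_boundary u_pole; lra.
  have [M near] := u_pole c'1.
  have [r rp Hr] := near_disc near.
  pose d := expR (- (2 * `|M| / eps)).
  have d0 : 0 < d by exact: expR_gt0.
  pose r0 := Num.min (Num.min (r / 2) (nsq tau0 / 2)) (Num.min d 2^-1).
  have r00 : 0 < r0 by rewrite !lt_min d0 invr_gt0 !divr_gt0// ltr0n.
  have h1 : r0 <= r / 2 by rewrite !ge_min lexx.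
  have h2 : r0 <= nsq tau0 / 2 by rewrite !ge_min lexx orbT.
  have h3 : r0 <= d by rewrite !ge_min lexx !orbT.
  have h4 : r0 <= 2^-1 by rewrite !ge_min lexx !orbT.
  exists r0 => //; split; first by move: h2 t00; clear - u_fin u_usc u_mean u_boundary u_pole; lra.
  move=> y yr; have y1 : nsq y < 1 by rewrite yr; move: h4; clear - u_fin u_usc u_mean u_boundary u_pole; lra.
  have yp : 0 < nsq y by rewrite yr.
  have yr' : nsq (y - 0) < r by rewrite subr0 yr; move: h1 rp; clear - u_fin u_usc u_mean u_boundary u_pole; lra.
  have := Hr y yr'; rewrite lne_EFin// -EFinM -EFinD => h.
  rewrite /Phi y1; apply: le_trans (leeD2r _ h) _; rewrite -EFinD lee_fin /psi.
  have l1 : ln (nsq y) <= - (2 * `|M| / eps).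
    by rewrite yr -[leRHS]expRK ler_ln ?posrE.
  have l2 : eps / 2 * ln (nsq y) <= - `|M|.
    have e20 : 0 <= eps / 2 by move: e0; clear - u_fin u_usc u_mean u_boundary u_pole; lra.
    have := ler_wpM2l e20 l1; have -> // : eps / 2 * - (2 * `|M| / eps) = - `|M|.
    by field; rewrite gt_eqF.
  have l3 : eps * nsq y <= eps by rewrite ler_piMr ?(ltW e0)// ltW.
  have l4 := ler_norm M.
  by move: l2 l3 l4; clear - u_fin u_usc u_mean u_boundary u_pole; lra.
pose K := [set y : plane R | r0 <= nsq y <= 1].
have Kt0 : K tau0 by rewrite /K /= !ltW.
have finPhi y : K y -> (Phi y < +oo)%E.
  move=> Ky; rewrite /Phi; case: ifPn => [y1|_]; last exact: ltry.
  by apply: lte_add_pinfty; [exact: u_fin|exact: ltry].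
have uscPhi y (a : R) : K y -> (Phi y < a%:E)%E -> \forall y' \near y, K y' -> (Phi y' < a%:E)%E.
  move=> /= /andP[yr y1]; have yp : 0 < nsq y by exact: lt_le_trans yr.
  rewrite {1}/Phi; case: ifPn => [ylt|ynlt].
    have nlt : \forall y' \near y, nsq y' < 1 by exact: (cvgr_lt _ (@nsq_continuous R y)).
    rewrite -lteBrDr// -EFinB => ua.
    have [b ub ba] : exists2 b : R, (u y < b%:E)%E & b < a - psi eps y.
      case E : (u y) ua => [v| |] // ua.
        exists ((v + (a - psi eps y)) / 2); rewrite ?lte_fin in ua *; first by move: ua; clear - u_fin u_usc u_mean u_boundary u_pole; lra.
        by move: ua; clear - u_fin u_usc u_mean u_boundary u_pole; lra.
      exists (a - psi eps y - 1); first exact: ltNyr.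
      by rewrite gtrBl.
    have n1 := u_usc ylt ub.
    have n2 : \forall y' \near y, psi eps y' < a - b.
      by apply: (cvgr_lt _ (cpsi y yp)); move: ba; clear - u_fin u_usc u_mean u_boundary u_pole; lra.
    apply: filterS3 nlt n1 n2 => y' y'1 uy' py' _; rewrite /Phi y'1.
    rewrite -lteBrDr// -EFinB; apply: lt_trans uy' _; rewrite lte_fin; move: py'; clear - u_fin u_usc u_mean u_boundary u_pole; lra.
  have yE : nsq y = 1 by apply/eqP; rewrite eq_le y1 leNgt.
  rewrite lte_fin => ea.
  pose d := (a - eps) / 2; have d0 : 0 < d by rewrite divr_gt0// subr_gt0.
  have n1 := u_boundary yE d0.
  have n2 : \forall y' \near y, psi eps y' < eps + d.
    apply: (cvgr_lt _ (cpsi y yp)); rewrite /psi yE ln1; move: d0; clear - u_fin u_usc u_mean u_boundary u_pole; lra.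
  apply: filterS2 n1 n2 => y' uy' py' _; rewrite /Phi; case: ifPn => [y'1|_]; last by rewrite lte_fin.
  apply: (@lt_le_trans _ _ (d%:E + (eps + d)%:E)%E).
    by apply: lteD; [exact: uy'|rewrite lte_fin].
  by rewrite -EFinD lee_fin /d; clear - u_fin u_usc u_mean u_boundary u_pole; lra.
have [tau /= /andP[tr t1] tmax] := usc_max (@annulus_compact r0) Kt0 finPhi uscPhi.
have big' : (eps%:E < Phi tau)%E by apply: lt_le_trans Phi0 _; exact: tmax.
have tlt : nsq tau < 1.
  by move: big'; rewrite /Phi; case: ifPn => //; rewrite ltxx.
have tgt : r0 < nsq tau.
  rewrite lt_neqAle tr andbT; apply/eqP => E.
  by have := lt_le_trans big' (r0P tau (esym E)); rewrite ltxx.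
have tp : 0 < nsq tau by exact: lt_trans tgt.
have Ktau : K tau by rewrite /K /= tr t1.
case E : (Phi tau) big' (finPhi tau Ktau) => [m| |] // _ _.
have ut : u tau = (m - psi eps tau)%:E.
  move: E; rewrite /Phi tlt; case: (u tau) => [v| |] //= [<-].
  by congr EFin; ring.
apply: (no_interior_max e0 e1 tp tlt ut).
have n1 : \forall y \near tau, nsq y < 1 by exact: (cvgr_lt _ (@nsq_continuous R tau)).
have n2 : \forall y \near tau, r0 < nsq y by exact: (cvgr_gt _ (@nsq_continuous R tau)).
apply: filterS2 n1 n2 => y y1 y2.
have := tmax y; rewrite E /Phi y1 (ltW y1) (ltW y2) => /(_ isT).
by rewrite EFinB leeBrDr.
Qed.

(** A subharmonic function with logarithmic pole and boundary values at most 0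
   is at most the Green function of the disc. *)
Lemma log_majorant tau : 0 < nsq tau -> nsq tau < 1 -> (u tau <= (ln (nsq tau))%:E)%E.
Proof.
move=> t0 t1; have L0 : ln (nsq tau) <= 0 by rewrite -ln1 ler_ln ?posrE// ltW.
have key eps := @log_majorant_eps eps tau.
case E : (u tau) (u_fin t1) => [v| |] // _; last exact: leNye.
rewrite lee_fin; apply: (@le_of_eps _ _ (- (1 - ln (nsq tau)))) => eps e0.
have small (e : R) : 0 < e -> e < 1 -> v + e * - (1 - ln (nsq tau)) <= ln (nsq tau).
  by move=> ep e1; have := key e ep e1 t0 t1; rewrite E lee_fin; clear - u_fin u_usc u_mean u_boundary u_pole; lra.
have [e1|e1] := ltP eps 1; first exact: small.
have h : v + 2^-1 * - (1 - ln (nsq tau)) <= ln (nsq tau) by apply: small; clear - u_fin u_usc u_mean u_boundary u_pole; lra.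
apply: le_trans h; rewrite lerD2l ler_wnM2r//; last by move: e1; clear - u_fin u_usc u_mean u_boundary u_pole; lra.
by move: L0; clear - u_fin u_usc u_mean u_boundary u_pole; lra.
Qed.

End Majorant.
End LogMajorant.

(** * The contradiction at the corner *)

Section Conclusion.
Context {R : realType}.

(** Over the pole each candidate is below the Green function of the disc. *)
Lemma candidate_le_log (w : form11 R) (Om : set (plane R)) Psi (tau : plane R) : open Om -> Om 0 ->
  (forall z, Om z -> dens w Cz z = 0) -> candidate w 0 Psi -> 0 < nsq tau -> nsq tau < 1 ->
  (Psi (Some (0 : plane R)%R, tau) <= (ln (nsq tau))%:E)%E.
Proof.
move=> oOm Om0 d0 [[fin pshP] bd pole] t0 t1.
have [_ usc mean] := pshP Cz Om (fun=> 0) oOm (zero_potential d0).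
have slice (x : plane R) (P : plane R * plane R -> Prop) : (\forall y \near ((0 : plane R), x), P y) ->
    \forall y \near x, P (0, y).
  move=> [[A B] /= [An Bn] AB]; apply: filterS Bn => y By; apply: AB; split => //=.
  exact: nbhs_singleton An.
apply: (@log_majorant R (fun tau => Psi (Some (0 : plane R)%R, tau))) => //.
- by move=> x x1; apply: fin; rewrite cabs_lt1E.
- move=> x a x1 xa; have := usc (0, x) a; rewrite /= adde0 => H.
  have U0 : Om 0 /\ cabs x < 1 by rewrite cabs_lt1E.
  have := slice x _ (H U0 xa); apply: filterS => y; by rewrite /= adde0.
- move=> A B inD; have := mean (0, A) (0, B).
  move=> /=; set U := (forall s, _ -> _ /\ _).
  have hU : U by move=> s; rewrite cabs_le1E cmul0 addr0 cabs_lt1E => s1; split => //; exact: inD.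
  move=> /(_ hU) {hU U}; rewrite adde0 => h; apply: le_trans h _.
  by apply: le_integral_any => t _; rewrite adde0 cmul0 addr0.
- move=> x a x1 a0.
  have cx : cabs x = 1 by rewrite cabsE x1 sqrtr1.
  have := bd Cz 0 x cx => h.
  have : (limf_esup (fun y : plane R * plane R => Psi (pt Cz y.1, y.2))
    (within [set y | (cabs y.2 < 1)%R] (nbhs ((0 : plane R)%R, x))) < a%:E)%E.
    by apply: le_lt_trans h _; rewrite lte_fin.
  move=> /ereal_inf_lt[_ [V nV <-] Va].
  have := slice x _ nV; apply: filterS => y Vy y1; apply: le_lt_trans Va.
  apply: ereal_sup_ubound; exists (0, y) => //; apply: Vy; by rewrite /= cabs_lt1E.
- move=> c' c'1; have [M near] := pole c' c'1; exists M.
  have := slice 0 _ near; apply: filterS => y h.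
  have E : cabs ((0 : plane R) - 0) ^+ 2 + cabs y ^+ 2 = nsq y.
    by rewrite subrr !cabs_sqr {1}/nsq /= expr0n !add0r.
  have h' : (Psi (Some (0 : plane R)%R, y) <=
      c'%:E * lne (cabs ((0 : plane R) - 0) ^+ 2 + cabs y ^+ 2)%R%:E + M%:E)%E := h.
  by rewrite E in h'.
Qed.

Lemma ln_le_sub1 (a : R) : 0 < a -> ln a <= a - 1.
Proof.
move=> a0; have h : -1 < a - 1 by move: a0; clear; lra.
by have := le_ln1Dx h; rewrite addrC subrK.
Qed.

End Conclusion.

Unset Implicit Arguments.
Set Strict Implicit.
Set Printing Implicit Defensive.

Theorem proposition9p5 (R : realType)
    (Omega0 : set (plane R)) (c : plane R) (theta lambda : R)
    (b : plane R) (r : R) (omega : form11 R)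
    (Omega0_open : open Omega0)
    (Omega0_connected : connected Omega0)
    (Omega0_bounded : bounded_set Omega0)
    (Omega0_0 : Omega0 0)
    (c_corner : corner_point Omega0 c theta)
    (theta_acute : theta < pi / 2)
    (lambda_gt0 : 0 < lambda)
    (omega_ge0 : semipositive omega)
    (omega_mass : total_mass omega = 1%E)
    (ball_large : closure Omega0 `<=` eball b r)
    (omega_ball : forall z, eball b r z ->
       dens omega Cz z = lambda * (1 - \1_Omega0 z))
    (omega_smooth : smooth_on omega (~` (pt Cz @` closure Omega0)))
    (omega_gt0 : positive_on omega (~` (pt Cz @` closure Omega0))) :
  ~ C1_up_to_boundary (envelope omega 0).
Proof.
move=> [f [fE reg]]; have [cF D] := reg Cz; have [g [cg dF]] := D (0, (1, 0)).
have [clc nOc [e [m' [e1 m'0 m'1 wedge]]]] := corner_in_wedge Omega0_open c_corner theta_acute.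
have d0 z : Omega0 z -> dens omega Cz z = 0.
  move=> Oz; rewrite omega_ball; last exact/ball_large/subset_closure.
  by rewrite indicE mem_set// subrr mulr0.
pose F (y : plane R * plane R) : R := f (Some y.1, y.2).
have F0 : forall z tau, nsq tau = 1 -> F (z, tau) = 0 := F_boundary fE.
(* G is constant on the domain, hence has the same value at the corner and at 0 *)
have mean : tilted_supermean Omega0 (slope g).
  by move=> A B kap k1 inOm; exact: (slope_mean Omega0_open d0 fE cF cg dF k1 inOm).
have cG := slope_continuous cg.
have Gc : slope g c = slope g 0.
  exact: supermean_constant Omega0_open Omega0_connected cG mean Omega0_0 clc.
have sq0 : Num.sqrt (1 - 0 ^+ 2 : R) = 1 by rewrite expr0n subr0 sqrtr1.
have mvt z (a : R) : 0 < a -> a < 1 -> exists2 x, a < x < 1 & F (z, (a, 0)) = - ((1 - a) * g (z, (x, 0))).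
  move=> a0 a1; have a2 : a ^+ 2 + 0 ^+ 2 < 1 by rewrite expr0n addr0 expr_lt1// ltW.
  by have := slice_mvt F0 cF dF z a0 a2; rewrite sq0.
have close z (d : R) : 0 < d -> exists2 r0 : R, 0 < r0 & forall x, 0 < x -> x < 1 -> 1 - r0 < x ->
    `|g (z, (x, 0)) - slope g z| < d.
  move=> dp; have [r1 r10 H] := within_punctured (y := (z, one_c)) cg (@nsq_one_c_in01 R) dp.
  exists (Num.min r1 1); first by rewrite lt_min r10 ltr01.
  move=> x x0 x1; rewrite ltrBlDr -ltrBlDl lt_min => /andP[xr _].
  apply: H => /=.
  - by rewrite subrr /nsq /= expr0n addr0.
  - rewrite /nsq /= subr0 expr0n addr0; apply: le_lt_trans xr.
    rewrite -sqrrN opprB expr2 ler_piMl ?subr_ge0 ?(ltW x1)//; move: x0; clear; lra.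
  - by rewrite /nsq /= expr0n addr0 exprn_gt0//= expr_le1// ltW.
(* the bound of f (0, .) by the Green function forces slope 2 on the domain *)
have G0 : 2 <= slope g 0.
  rewrite leNgt; apply/negP => lt.
  have dp : 0 < 2 - slope g 0 by rewrite subr_gt0.
  have [r0 r00 H] := close 0 _ dp.
  pose a := Num.max (1 / 2) (1 - r0).
  have a0 : 0 < a by rewrite lt_max; apply/orP; left; clear; lra.
  have a1 : a < 1 by rewrite gt_max; apply/andP; split; move: r00; clear; lra.
  have [x /andP[ax x1] FE] := mvt 0 a a0 a1.
  have x0 : 0 < x := lt_trans a0 ax.
  have xr : 1 - r0 < x by apply: le_lt_trans ax; rewrite le_max lexx orbT.
  have := H x x0 x1 xr; rewrite ltr_norml => /andP[_ up].
  have n0 : 0 < nsq ((a, 0) : plane R) by rewrite /nsq /= expr0n addr0 exprn_gt0.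
  have n1 : nsq ((a, 0) : plane R) < 1 by rewrite /nsq /= expr0n addr0 expr_lt1// ltW.
  have le : F (0, (a, 0)) <= ln (nsq ((a, 0) : plane R)).
    rewrite -lee_fin /F -fE /=; last by rewrite cabs_gt0E n0 cabs_le1E ltW.
    rewrite /envelope cabs_lt1E /= n1; apply: ge_ereal_sup => _ [Psi cP <-].
    exact: candidate_le_log Omega0_open Omega0_0 d0 cP n0 n1.
  have lnE : ln (nsq ((a, 0) : plane R)) = 2 * ln a.
    by rewrite /nsq /= expr0n addr0 lnXn// mulr2n mulrDl mul1r.
  have la : ln a <= a - 1 := ln_le_sub1 a0.
  rewrite lnE FE in le.
  have : (1 - a) * g (0, (x, 0)) < (1 - a) * 2.
    by rewrite ltr_pM2l ?subr_gt0//; move: up; clear; lra.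
  by move: le la; clear; lra.
(* the barrier forces a slope at most 2 (1 - t) at the corner; a is chosen so close to
   1 that 2 (1 - t) / a <= 2 - t *)
have [t /andP[t0 t1] low] := corner_value Omega0_open Omega0_bounded Omega0_0 clc nOc lambda_gt0
  omega_ge0 ball_large omega_ball e1 m'0 m'1 wedge fE cF.
have [r0 r00 H] := close c t t0.
pose a := Num.max (1 - t / 2) (1 - r0).
have a0 : 0 < a by rewrite lt_max; apply/orP; left; move: t1; clear; lra.
have a1 : a < 1 by rewrite gt_max; apply/andP; split; move: t0 r00; clear; lra.
have at_ : 1 - t / 2 <= a by rewrite le_max lexx.
have [x /andP[ax x1] FE] := mvt c a a0 a1.
have x0 : 0 < x := lt_trans a0 ax.
have xr : 1 - r0 < x by apply: le_lt_trans ax; rewrite le_max lexx orbT.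
have := H x x0 x1 xr; rewrite ltr_norml Gc => /andP[dn _].
have gx : 2 - t < g (c, (x, 0)) by move: dn G0; clear; lra.
have n0 : 0 < nsq ((a, 0) : plane R) by rewrite /nsq /= expr0n addr0 exprn_gt0.
have n1 : nsq ((a, 0) : plane R) < 1 by rewrite /nsq /= expr0n addr0 expr_lt1// ltW.
have := low (a, 0) n0 n1; rewrite -/(F (c, (a, 0))) FE.
have -> : ln (nsq ((a, 0) : plane R)) = 2 * ln a.
  by rewrite /nsq /= expr0n addr0 lnXn// mulr2n mulrDl mul1r.
have la : - ln a <= a^-1 - 1.
  by rewrite -lnV ?posrE//; apply: ln_le_sub1; rewrite invr_gt0.
move=> h.
have la' : a * - ln a <= 1 - a.
  have := ler_wpM2l (ltW a0) la; by rewrite mulrBr divff ?mulr1// gt_eqF.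
have h1 : (1 - a) * (a * g (c, (x, 0))) <= (1 - a) * (2 * (1 - t)).
  have := ler_wpM2l (ltW a0) h; have t10 : 0 <= 2 * (1 - t) by move: t1; clear; lra.
  by have := ler_wpM2l t10 la'; move: (g _) (ln a) => *; lra.
rewrite ler_pM2l ?subr_gt0// in h1.
have h2 : (1 - t / 2) * (2 - t) <= a * (2 - t).
  by rewrite ler_wpM2r//; move: t1; clear; lra.
have h3 : a * (2 - t) < a * g (c, (x, 0)) by rewrite ltr_pM2l.
by have := sqr_ge0 t; move: h1 h2 h3; clear; lra.
Qed.
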